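(* Fix $\bar\tau_0,\bar\tau_1>0$, $n\ge1$, $\lambda_i>0$ with $\sum_{i=1}^n\lambda_i=1$, $a_i>0$, $\mu_i=\mathcal N(m_i,\Sigma_i)\in\mathcal G_d^1$, and use the notation of the context. Let $Z_0=\sum_i\lambda_ia_i^\theta$, $\widetilde\lambda_i=\lambda_ia_i^\theta/Z_0$, and let $\nu_{\mathrm{BW}}\in\mathcal G_d^1$ denote the (existing and unique) Gaussian Wasserstein barycenter of $\mu_1,\dots,\mu_n$ with weights $\widetilde\lambda_i$, i.e. the unique minimizer over $\mathcal G_d^1$ of $\nu\mapsto\sum_i\widetilde\lambda_iW_2^2(\mu_i,\nu)$. For each $\kappa$ choose any $\nu_\kappa\in\operatorname*{argmin}_{\nu\in\mathcal G_d^1}\Phi_\kappa(\nu)$. Then, as $\kappa\to\infty$, $$\nu_\kappa\longrightarrow\nu_{\mathrm{BW}}$$ (in mean--covariance coordinates). Moreover, $$b_\kappa(\nu_\kappa)\longrightarrow Z_0^{1/\theta},\qquad \min_{\nu\in\mathcal G_d^1}\widetilde\Phi_\kappa(\nu)\longrightarrow\Phi_\infty(\nu_{\mathrm{BW}}),$$ where $\widetilde\Phi_\kappa(\nu)=\Phi_\kappa(\nu)-\kappa\bar\tau_0(\bar a-Z_0^{1/\theta})$ and $\Phi_\infty(\nu)=Z_0^{1/\theta}\sum_i\widetilde\lambda_iW_2^2(\mu_i,\nu)$.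
   Context: $\mathcal G_d^1=\{\mathcal N(m,\Sigma):m\in\mathbb R^d,\Sigma\in\mathbb S_{++}^d\}$ (with $\mathbb S_{++}^d$ the symmetric positive-definite matrices), identified with the open set $\mathbb R^d\times\mathbb S_{++}^d$. For $\kappa>0$ the penalties are $\tau_j=\kappa\bar\tau_j$, $j=0,1$; $\bar s=\bar\tau_0+\bar\tau_1$, $\theta=\bar\tau_0/\bar s$, $\bar a=\sum_i\lambda_ia_i$. Define $$A_i^{(\kappa)}(\nu)=\inf_{p,q\in\mathcal P(\mathbb R^d)}\{W_2^2(p,q)+\kappa\bar\tau_0\mathrm{KL}(p\mid\mu_i)+\kappa\bar\tau_1\mathrm{KL}(q\mid\nu)\},$$ with $\mathrm{KL}$ the relative entropy and $W_2$ the quadratic Wasserstein distance ($W_2^2\in[0,\infty]$); $$\mathsf Z_\kappa(\nu)=\sum_i\lambda_ia_i^\theta e^{-A_i^{(\kappa)}(\nu)/(\kappa\bar s)},\quad b_\kappa(\nu)=\mathsf Z_\kappa(\nu)^{1/\theta},\quad \Phi_\kappa(\nu)=\kappa\bar\tau_0\big(\bar a-\mathsf Z_\kappa(\nu)^{1/\theta}\big).$$ ($\Phi_\kappa(\nu)$ is the infimum over $b>0$ of $\sum_i\lambda_i\mathsf U_{\kappa\bar\tau_0,\kappa\bar\tau_1}(a_i\mu_i,b\nu)$, where $\mathsf U$ is the quadratic-cost two-sided KL-unbalanced transport cost, attained at $b_\kappa(\nu)$; $\Phi_\kappa$ is known to attain its minimum on $\mathcal G_d^1$ for every $\kappa>0$.)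 *)

(* Defs.v *)
From HB Require Import structures.
From mathcomp Require Import all_boot all_order all_algebra.
From mathcomp Require Import all_classical all_reals all_analysis.
From mathcomp Require Import measurable_realfun.

Set Implicit Arguments.
Unset Strict Implicit.
Unset Printing Implicit Defensive.

Import Order.TTheory GRing.Theory Num.Theory.
Import numFieldNormedType.Exports.

Local Open Scope classical_set_scope.
Local Open Scope ring_scope.

Definition argmin (T : Type) (disp : Order.disp_t) (V : porderType disp)
    (A : set T) (f : T -> V) : set T :=
  [set x | A x /\ forall y, A y -> (f x <= f y)%O].

Section EuclideanSpace.
Variable R : realType.

(* Points of R^d are d-tuples, because tuples carry the product (= Borel)
   sigma-algebra in the library; means and covariances are matrices. *)
Definition Rd (d : nat) := d.-tuple (measurableTypeR R).

Definition sqdist (d : nat) (x y : Rd d) : R :=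
  \sum_(i < d) ((tnth x i : R) - tnth y i) ^+ 2.

Definition posdef (d : nat) (S : 'M[R]_d) : Prop :=
  S^T = S /\ forall v : 'cV[R]_d, v != 0 -> 0 < (v^T *m S *m v) 0 0.

(* The symmetric positive-definite square root; it exists and is unique
   when S is symmetric positive definite, and the value is junk otherwise. *)
Definition sqrtmx (d : nat) (S : 'M[R]_d) : 'M[R]_d :=
  xget 0 [set L | posdef L /\ L *m L = S].

End EuclideanSpace.

Section Gaussian.
Variable R : realType.

Definition cons_Rd (d : nat) (x : measurableTypeR R * Rd R d) : Rd R d.+1 :=
  [tuple of x.1 :: x.2].

Lemma measurable_cons_Rd (d : nat) : measurable_fun setT (@cons_Rd d).
Proof. by apply: measurable_cons. Qed.

HB.instance Definition _ (d : nat) :=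
  isMeasurableFun.Build _ _ _ _ (@cons_Rd d) (@measurable_cons_Rd d).

(* The standard Gaussian N(0, I_d): the d-fold product of N(0, 1). *)
Fixpoint std_gauss (d : nat) : probability (Rd R d) R :=
  match d with
  | 0%N => \d_([tuple] : Rd R 0)
  | d'.+1 => distribution
      ((normal_prob (0 : R) 1 \x std_gauss d')%E : probability _ R)
      (@cons_Rd d')
  end.

Definition affine_Rd (d : nat) (m : 'cV[R]_d) (L : 'M[R]_d) (x : Rd R d) :
    Rd R d :=
  [tuple m i 0 + \sum_(j < d) L i j * tnth x j | i < d].

Lemma measurable_affine_Rd (d : nat) (m : 'cV[R]_d) (L : 'M[R]_d) :
  measurable_fun setT (affine_Rd m L).
Proof.
apply/measurable_fun_tnthP => i.
rewrite (_ : _ \o _ =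
    fun x : Rd R d => m i 0 + \sum_(j < d) L i j * (tnth x j : R)); last first.
  by apply/funext => x /=; rewrite tnth_mktuple.
apply: measurable_funD; first by []; apply: measurable_sum => j.
by apply: measurable_funM => //; exact: measurable_tnth.
Qed.

HB.instance Definition _ (d : nat) (m : 'cV[R]_d) (L : 'M[R]_d) :=
  isMeasurableFun.Build _ _ _ _ (affine_Rd m L) (measurable_affine_Rd m L).

(* N(m, S) is the law of m + S^{1/2} Z with Z standard Gaussian. *)
Definition gauss (d : nat) (nu : 'cV[R]_d * 'M[R]_d) : probability (Rd R d) R :=
  distribution (std_gauss d) (affine_Rd nu.1 (sqrtmx nu.2)).

(* Gaussians in mean-covariance coordinates. *)
Definition gaussians (d : nat) : set ('cV[R]_d * 'M[R]_d) :=
  [set nu | posdef nu.2].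

End Gaussian.

Arguments gaussians : clear implicits.

Section Transport.
Variables (R : realType) (d : nat).
Implicit Types p q mu : probability (Rd R d) R.

(* Marginals are compared on measurable sets only: a measure is a function on
   all sets, with arbitrary values off the sigma-algebra. *)
Definition coupling p q : set (probability (Rd R d * Rd R d)%type R) :=
  [set pi | (forall A, measurable A -> pi (A `*` setT) = p A) /\
            (forall B, measurable B -> pi (setT `*` B) = q B)].

Definition W2sq p q : \bar R :=
  ereal_inf [set (\int[pi]_z (sqdist z.1 z.2)%:E)%E | pi in coupling p q].

Definition KL p mu : \bar R :=
  if `[< p `<< mu >] then
    (\int[p]_x
       (ln (fine (Radon_Nikodym (charge_of_finite_measure p) mu x)))%:E)%E
  else +oo%E.

End Transport.

Section Barycenter.
Variables (R : realType) (d n : nat) (tau0 tau1 : R) (lambda a : 'I_n -> R).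
Variables (mu : 'I_n -> 'cV[R]_d * 'M[R]_d).
Implicit Types (nu : 'cV[R]_d * 'M[R]_d) (k : R).

Definition sbar : R := tau0 + tau1.
Definition theta : R := tau0 / sbar.
Definition abar : R := \sum_(i < n) lambda i * a i.

Definition Acost k (i : 'I_n) nu : \bar R :=
  ereal_inf [set (W2sq pq.1 pq.2
                  + (k * tau0)%:E * KL pq.1 (gauss (mu i))
                  + (k * tau1)%:E * KL pq.2 (gauss nu))%E
            | pq in [set: probability (Rd R d) R * probability (Rd R d) R]].

(* expeR (-oo) = 0, so an infinite cost contributes nothing. *)
Definition Zk k nu : R :=
  \sum_(i < n) lambda i * (a i `^ theta)
    * fine (expeR (- (Acost k i nu * ((k * sbar)^-1)%:E))%E).

Definition bk k nu : R := Zk k nu `^ theta^-1.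

Definition Phik k nu : R := k * tau0 * (abar - Zk k nu `^ theta^-1).

Definition Z0 : R := \sum_(i < n) lambda i * (a i `^ theta).

Definition lamt (i : 'I_n) : R := lambda i * (a i `^ theta) / Z0.

Definition bary_obj nu : \bar R :=
  (\sum_(i < n) (lamt i)%:E * W2sq (gauss (mu i)) (gauss nu))%E.

Definition Phit k nu : R := Phik k nu - k * tau0 * (abar - Z0 `^ theta^-1).

Definition Phi_inf nu : \bar R := ((Z0 `^ theta^-1)%:E * bary_obj nu)%E.

End Barycenter.

(* Main.v *)
(* Quadratic functions f, g with f x + g y <= |x - y|^2, combined with the
   linearized entropies, bound the unbalanced cost A_i below up to O(1/kappa);
   couplings by affine images of one standard Gaussian bound it above by W_2^2.
   Optimality of nu_kappa keeps every A_i(nu_kappa), hence the mean and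
   covariance of nu_kappa, bounded, and then
     Phit_kappa = Z_0^(1/theta) sum_i w_i A_i + O(1/kappa).
   At the barycenter (m0, S0) the optimal maps P_i satisfy sum_i w_i P_i = 1 and
   sum_i w_i m_i = m0, so the dual bound with potentials P_i^-1, P_i gives
   sum_i w_i A_i(m, S) >= V + |m0 - m|^2 - O(1/kappa), V being the barycentric
   cost. Replacing P_i by P_i + e (S0 - S) adds e tr (S0 - S)^2 - O(e^2): this
   forces the covariances to converge. *)
From HB Require Import structures.
Require Import Defs.
From mathcomp Require Import all_boot all_order all_algebra.
From mathcomp Require Import all_classical all_reals all_analysis.
From mathcomp Require Import measurable_realfun ring lra.
From mathcomp Require complex spectral sesquilinear.
Import Order.TTheory GRing.Theory Num.Theory.
Import numFieldNormedType.Exports.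
Local Open Scope classical_set_scope.
Local Open Scope ring_scope.

Set Implicit Arguments.
Unset Strict Implicit.
Unset Printing Implicit Defensive.

(** * The one-dimensional standard normal law *)

(** [gauss] is built on the symmetric root of the covariance, whereas the coupling carried by an
    optimal map [P] needs the factor [P L]. Rotation invariance of the standard Gaussian bridges the
    two: the law of an affine image depends on [A A^T] only. No formula for [W_2] between Gaussians
    is presupposed. Since [A_i <= W_2^2] for every penalty, letting kappa tend to infinity in the
    dual bound for [A_i] gives the lower bound for [W_2^2] that matches the couplings. The main
    obstacle is a circularity. The error [O(1/kappa)] is uniform only over potentials of bounded
    growth, measured after pullback by the root of the covariance, while boundedness of the
    minimizers is itself to be proved. It is broken by potentials scaled down in proportion to the
    size of [nu], whose growth stays bounded; the coercive term is then merely truncated. *)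

Section NormalLine.
Variable R : realType.
Notation leb := (@lebesgue_measure R).
Notation N01 := (@normal_prob R 0 1).

Definition line_affine (a b : R) (x : measurableTypeR R) : measurableTypeR R :=
  a * x + b.

Lemma measurable_line_affine a b : measurable_fun setT (line_affine a b).
Proof. by apply: measurable_funD => //; apply: measurable_funM. Qed.

HB.instance Definition _ a b :=
  isMeasurableFun.Build _ _ _ _ (line_affine a b) (measurable_line_affine a b).

(** Uniqueness of Lebesgue measure: both sides agree on the intervals []u, v]]. For [a < 0] the
    preimage is closed on the left instead, which leaves its length unchanged. *)
Lemma lebesgue_affine (a b : R) (A : set (measurableTypeR R)) : a != 0 ->
  measurable A ->
  leb A = (`|a|%:E * pushforward leb (line_affine a b) A)%E.
Proof.
move=> a0 mA.
have a0' : 0 < `|a| by rewrite normr_gt0.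
rewrite (_ : (_ * _)%E =
  mscale (NngNum (normr_ge0 a)) (pushforward leb (line_affine a b)) A)//.
apply: lebesgue_measure_unique => //= X [[u v]] /= uv <-.
rewrite /mscale /= /pushforward.
have [ap|an|a00] := ltgtP 0 a; last by rewrite -a00 eqxx in a0.
- rewrite (_ : line_affine a b @^-1` _ = `](u - b) / a, (v - b) / a]%classic); last first.
    apply/seteqP; split=> x /=; rewrite !in_itv /= /line_affine
      ltr_pdivrMr// ler_pdivlMr// ltrBlDr lerBrDr mulrC//.
  rewrite !lebesgue_measure_itv /= !lte_fin ltr_pM2r ?invr_gt0// ltrD2r.
  case: ifP => _; last by rewrite mule0.
  by rewrite -!EFinB -EFinM gtr0_norm//; congr EFin; field.
- rewrite (_ : line_affine a b @^-1` _ = `[(v - b) / a, (u - b) / a[%classic); last first.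
    apply/seteqP; split=> x /=; rewrite !in_itv /= /line_affine
      ler_ndivrMr// ltr_ndivlMr// ltrBlDr lerBrDr mulrC andbC//.
  rewrite !lebesgue_measure_itv /= !lte_fin ltr_nM2r ?invr_lt0// ltrD2r.
  case: ifP => _; last by rewrite mule0.
  by rewrite -!EFinB -EFinM ltr0_norm//; congr EFin; field.
Qed.

Lemma integral_lebesgue_affine (a b : R) (f : R -> \bar R) : a != 0 ->
  measurable_fun [set: measurableTypeR R] f -> (forall x, (0 <= f x)%E) ->
  (\int[leb]_x f x = `|a|%:E * \int[leb]_x f (a * x + b)%R)%E.
Proof.
move=> a0 mf f0.
rewrite (@eq_measure_integral _ _ _ _
  (mscale (NngNum (normr_ge0 a)) (pushforward leb (line_affine a b)))); last first.
  by move=> A mA _; exact: (lebesgue_affine b a0 mA).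
by rewrite ge0_integral_mscale//= ge0_integral_pushforward.
Qed.

Lemma integral_N01 (f : R -> \bar R) :
  measurable_fun [set: measurableTypeR R] f -> (forall x, (0 <= f x)%E) ->
  (\int[N01]_x f x = \int[leb]_x (f x * (normal_pdf 0 1 x)%:E))%E.
Proof.
move=> mf f0.
have dom := @normal_prob_dominates R 0 1.
rewrite -(@Radon_Nikodym_SigmaFinite.change_of_variables _ _ _
  (N01 : {finite_measure set _ -> \bar R}) leb dom)//.
have mRN := Radon_Nikodym_SigmaFinite.f_integrable dom.
have mpdf : measurable_fun setT (EFin \o @normal_pdf R 0 1).
  by apply/measurable_EFinP; exact: measurable_normal_pdf.
apply: ae_eq_integral => //.
- by apply: emeasurable_funM => //; exact: measurable_int mRN.
- exact: emeasurable_funM.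
- apply: ae_eqe_mul2l; apply: integral_ae_eq => // E _ mE.
  by rewrite -Radon_Nikodym_SigmaFinite.f_integral.
Qed.

Lemma normal_pdf_mul (x y u v : R) : x ^+ 2 + y ^+ 2 = u ^+ 2 + v ^+ 2 ->
  normal_pdf 0 1 x * normal_pdf 0 1 y = normal_pdf 0 1 u * normal_pdf 0 1 v.
Proof.
move=> e; rewrite !normal_pdfE ?oner_neq0// /normal_fun !subr0.
rewrite mulrACA -expRD [RHS]mulrACA -expRD; congr (_ * expR _).
by rewrite -!mulrDl -!opprD e.
Qed.

Let mpdf : measurable_fun setT (EFin \o @normal_pdf R 0 1).
Proof. by apply/measurable_EFinP; exact: measurable_normal_pdf. Qed.

Let pdf0 x : (0 <= (@normal_pdf R 0 1 x)%:E)%E.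
Proof. by rewrite lee_fin normal_pdf_ge0. Qed.

(** For [c != 0] the rotation splits into two substitutions of one variable each, with Jacobians
    [c^-1] and [c]; Tonelli's theorem moves the active variable inside each time. *)
Lemma N01_rotation (c s : R) (f : measurableTypeR R * measurableTypeR R -> \bar R) :
  c != 0 -> c ^+ 2 + s ^+ 2 = 1 ->
  measurable_fun setT f -> (forall z, (0 <= f z)%E) ->
  (\int[N01]_x \int[N01]_y f (c * x - s * y, s * x + c * y)%R
   = \int[N01]_x \int[N01]_y f (x, y))%E.
Proof.
move=> c0 cs mf f0.
pose p := @normal_pdf R 0 1.
have mp : measurable_fun setT p by exact: measurable_normal_pdf.
have p0 x : 0 <= p x by exact: normal_pdf_ge0.
have mlin (a b : R) : measurable_fun setT
  (fun z : measurableTypeR R * measurableTypeR R => a * z.1 + b * z.2).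
  by apply: measurable_funD; apply: measurable_funM.
have mfst (a b a' b' : R) : measurable_fun setT
  (fun z : measurableTypeR R * measurableTypeR R =>
    f (a * z.1 + b * z.2, a' * z.1 + b' * z.2)).
  by apply: (measurableT_comp mf); apply/measurable_fun_pairP; split;
    apply: mlin.
have mp12 (a b a' b' : R) : measurable_fun setT
  (fun z : measurableTypeR R * measurableTypeR R =>
    ((p (a * z.1 + b * z.2))%:E * (p (a' * z.1 + b' * z.2))%:E)%E).
  by apply: emeasurable_funM; apply/measurable_EFinP;
    apply: (measurableT_comp mp); apply: mlin.
have dbl (g : measurableTypeR R * measurableTypeR R -> \bar R) :
    measurable_fun setT g -> (forall z, (0 <= g z)%E) ->
  (\int[N01]_x \int[N01]_y g (x, y)
   = \int[leb]_x \int[leb]_y (g (x, y) * ((p x)%:E * (p y)%:E)))%E.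
  move=> mg g0.
  have mgx x : measurable_fun setT (fun y => g (x, y)).
    by apply: measurableT_comp => //.
  rewrite integral_N01; last 2 first.
  - exact: (measurable_fun_fubini_tonelli_F g).
  - by move=> x; apply: integral_ge0.
  apply: eq_integral => x _; rewrite integral_N01//.
  rewrite muleC -ge0_integralZl//.
  - by apply: eq_integral => y _; rewrite muleCA.
  - exact: emeasurable_funM.
  - by move=> y _; rewrite mule_ge0.
pose f' z := f (c * z.1 + (- s) * z.2, s * z.1 + c * z.2)%R.
transitivity (\int[N01]_x \int[N01]_y f' (x, y))%E.
  by apply: eq_integral => x _; apply: eq_integral => y _; rewrite /f' mulNr.
have mf' : measurable_fun setT f' by exact: mfst.
have f'0 z : (0 <= f' z)%E by exact: f0.
apply: (etrans (dbl f' mf' f'0)); apply: etrans (esym (dbl f mf f0)).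
have pp0 x y : (0 <= (p x)%:E * (p y)%:E)%E by rewrite mule_ge0.
apply: (etrans (fubini_tonelli (m1 := leb) (m2 := leb)
  (fun z => f' z * ((p z.1)%:E * (p z.2)%:E))%E _ _)).
- apply: emeasurable_funM; first exact: mf'.
  by apply: emeasurable_funM; apply/measurable_EFinP;
    apply: (measurableT_comp mp).
- by move=> z; rewrite mule_ge0 /f'.
have ci0 : c^-1 != 0 by rewrite invr_eq0.
pose g z := (`|c^-1|%:E * (f (1 * z.1 + 0 * z.2, (s / c) * z.1 + c^-1 * z.2)%R
   * ((p (c^-1 * z.1 + (s / c) * z.2))%:E * (p (0 * z.1 + 1 * z.2))%:E)))%E.
(* Substitution [x := c^-1 x + (s / c) y] at fixed [y], after which the first argument of [f] is [x]
   alone. *)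
transitivity (\int[leb]_y \int[leb]_x g (x, y))%E.
  apply: eq_integral => y _.
  rewrite [LHS](@integral_lebesgue_affine c^-1 (s / c * y))//; last 2 first.
  - apply: emeasurable_funM; first exact: (measurable_fun_pair1 y mf').
    by apply: emeasurable_funM; apply/measurable_EFinP; [exact: mp|exact: (measurable_cst (p y))].
  - by move=> x; rewrite mule_ge0 /f'.
  rewrite -ge0_integralZl; first last.
  - by rewrite lee_fin normr_ge0.
  - by move=> x _; apply: mule_ge0; [exact: f0|exact: pp0].
  - apply: emeasurable_funM.
    + apply: (measurableT_comp mf'); apply: measurable_fun_pair; last exact: (measurable_cst y).
      exact: (measurable_line_affine c^-1 (s / c * y)).
    + apply: emeasurable_funM; apply/measurable_EFinP; last exact: (measurable_cst (p y)).
      exact: (measurableT_comp mp (measurable_line_affine c^-1 (s / c * y))).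
  - exact: measurableT.
  apply: eq_integral => x _; rewrite /g /f' /= !mul0r mul1r addr0 add0r mul1r.
  congr (_ * (f (_, _) * _))%E; first by field.
  have -> : c^-1 * y = c^-1 * (c ^+ 2 + s ^+ 2) * y by rewrite cs mulr1.
  by field.
have mg : measurable_fun setT g.
  by apply: measurable_funeM; apply: emeasurable_funM; [exact: mfst|exact: mp12].
have g0 z : (0 <= g z)%E.
  apply: mule_ge0; first by rewrite lee_fin.
  by apply: mule_ge0; [exact: f0|exact: pp0].
apply: (etrans (esym (fubini_tonelli (m1 := leb) (m2 := leb) g mg g0))).
apply: eq_integral => x _.
have mgx := measurable_fun_pair2 x mg.
(* Substitution [y := c y - s x] at fixed [x], which turns the second argument of [f] into [y]. *)
apply: (etrans (@integral_lebesgue_affine c (- s * x) _ c0 mgx (fun y => g0 (x, y)))).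
rewrite -ge0_integralZl; first last.
- by rewrite lee_fin normr_ge0.
- by move=> y _; exact: g0.
- exact: (measurableT_comp mgx (measurable_line_affine c (- s * x))).
- exact: measurableT.
apply: eq_integral => y _; rewrite /g /= !mul0r !mul1r addr0 add0r.
rewrite muleA -EFinM -normrM divff// normr1 mul1e.
congr (f (_, _) * _)%E.
  by field.
rewrite -!EFinM; congr EFin; apply: normal_pdf_mul.
rewrite (_ : c^-1 * x + _ = c * x + s * y); last first.
  have -> : c^-1 * x = c^-1 * (c ^+ 2 + s ^+ 2) * x by rewrite cs mulr1.
  by field.
transitivity ((c ^+ 2 + s ^+ 2) * (x ^+ 2 + y ^+ 2)); last by rewrite cs mul1r.
by ring.
Qed.

Lemma N01_opp (f : measurableTypeR R -> \bar R) :
  measurable_fun setT f -> (forall x, (0 <= f x)%E) ->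
  (\int[N01]_x f (- x)%R = \int[N01]_x f x)%E.
Proof.
move=> mf f0.
have mo : measurable_fun setT (fun x : measurableTypeR R => f (- x)%R).
  by apply: (measurableT_comp mf).
rewrite !integral_N01//.
rewrite [RHS](@integral_lebesgue_affine (-1) 0); last 3 first.
- by rewrite oppr_eq0 oner_eq0.
- exact: emeasurable_funM.
- by move=> x; apply: mule_ge0; [exact: f0|exact: pdf0].
rewrite normrN1 mul1e; apply: eq_integral => x _.
by rewrite mulN1r addr0 !normal_pdfE ?oner_neq0// /normal_fun !subr0 sqrrN.
Qed.

(** The integrand times the standard density is [t] times the density of standard deviation [t].
    Both the second moment and the exponential integrability of [nrm2] come from this identity. *)
Lemma N01_expR_sqr (t : R) : 0 < t ->
  (\int[N01]_x (expR ((1 - t ^- 2) * x ^+ 2 / 2))%:E = t%:E)%E.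
Proof.
move=> t0; have tn0 : t != 0 by rewrite gt_eqF.
rewrite integral_N01//; last first.
  apply/measurable_EFinP; apply: measurableT_comp => //.
  by apply: measurable_funM => //; apply: measurable_funM.
rewrite -[RHS]mule1 -[X in (_ * X)%E](@integral_normal_pdf R 0 t).
rewrite -ge0_integralZl; first last.
- by rewrite lee_fin ltW.
- by move=> x _; rewrite lee_fin normal_pdf_ge0.
- by apply/measurable_EFinP; exact: measurable_normal_pdf.
- exact: measurableT.
apply: eq_integral => x _; rewrite -!EFinM; congr EFin.
rewrite !normal_pdfE ?oner_neq0// /normal_peak /normal_fun !subr0.
rewrite mulrCA -expRD [RHS]mulrA; congr (_ * expR _).
  rewrite expr1n mul1r -mulrnAr sqrtrM ?sqr_ge0// sqrtr_sqr gtr0_norm//.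
  by rewrite invfM mulrA divff// mul1r.
by field.
Qed.

(** [1 + y <= exp y], integrated at [y = (1 - t^-2) x^2 / 2], gives [v <= 2 t^2 / (t + 1)] for
    [t > 1] and the reverse for [t < 1]; then [t] is taken close to 1 on either side. *)
Lemma N01_sqr : (\int[N01]_x (x ^+ 2)%:E = 1)%E.
Proof.
pose v : \bar R := (\int[N01]_x ((x : R) ^+ 2)%:E)%E.
rewrite -/v.
have mex (b : R) : measurable_fun setT (fun x : measurableTypeR R => expR (b * x ^+ 2 / 2)).
  by apply: measurableT_comp => //; do 2 apply: measurable_funM => //.
have mx2 : measurable_fun setT (fun x : measurableTypeR R => x ^+ 2) by [].
have N1 : (\int[N01]_x (1%R)%:E = 1)%E.
  by rewrite integral_cst//= mul1e; exact: (probability_setT N01).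
have up (t : R) : 1 < t -> (v <= (t ^+ 2)%:E)%E.
  move=> t1; have t0 : 0 < t by lra.
  have b0 : 0 < 1 - t ^- 2.
    by rewrite subr_gt0 invf_lt1 ?exprn_gt0// exprn_egt1.
  have : (((1 - t ^- 2) / 2)%:E * v + 1 <= t%:E)%E.
    rewrite -(N01_expR_sqr t0) -N1 -ge0_integralZl//; last 3 first.
    - exact/measurable_EFinP.
    - by move=> x _; rewrite lee_fin sqr_ge0.
    - by rewrite lee_fin; lra.
    rewrite -ge0_integralD; first last.
    - exact: measurable_cst.
    - by move=> x _; rewrite lee_fin.
    - by apply: measurable_funeM; exact/measurable_EFinP.
    - by move=> x _; rewrite -EFinM lee_fin mulr_ge0 ?sqr_ge0//; lra.
    - exact: measurableT.
    apply: ge0_le_integral => //.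
    - by move=> x _; rewrite adde_ge0// -EFinM lee_fin mulr_ge0 ?sqr_ge0//; lra.
    - apply: emeasurable_funD => //.
      by apply: measurable_funeM; exact/measurable_EFinP.
    - by apply/measurable_EFinP.
    - move=> x _; rewrite -EFinM -EFinD lee_fin.
      apply: (le_trans _ (expR_ge1Dx _)); lra.
  have : (0 <= v)%E by apply: integral_ge0 => x _; rewrite lee_fin sqr_ge0.
  case: (v) => [r| |] // _; last by rewrite gt0_muley ?lte_fin ?divr_gt0.
  rewrite -EFinM -EFinD !lee_fin => h.
  have h2 : (1 - t ^- 2) * r <= 2 * (t - 1) by lra.
  have e : (1 - t ^- 2) * t ^+ 2 = (t - 1) * (t + 1) by field; rewrite gt_eqF.
  rewrite -(ler_pM2l b0) e; apply: (le_trans h2); move: t1; clear; nra.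
have lo (t : R) : 0 < t -> t < 1 -> ((t ^+ 2)%:E <= v)%E.
  move=> t0 t1.
  have b0 : 0 < t ^- 2 - 1.
    by rewrite subr_gt0 invf_gt1 ?exprn_gt0// exprn_ilt1// ltW.
  have : (1 <= ((t ^- 2 - 1) / 2)%:E * v + t%:E)%E.
    rewrite -(N01_expR_sqr t0) -N1 -ge0_integralZl//; last 3 first.
    - exact/measurable_EFinP.
    - by move=> x _; rewrite lee_fin sqr_ge0.
    - by rewrite lee_fin; lra.
    rewrite -ge0_integralD; first last.
    - exact/measurable_EFinP.
    - by move=> x _; rewrite lee_fin expR_ge0.
    - by apply: measurable_funeM; exact/measurable_EFinP.
    - by move=> x _; rewrite -EFinM lee_fin mulr_ge0 ?sqr_ge0//; lra.
    - exact: measurableT.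
    apply: ge0_le_integral => //.
    - apply: emeasurable_funD; last exact/measurable_EFinP.
      by apply: measurable_funeM; exact/measurable_EFinP.
    - move=> x _; rewrite -EFinM -EFinD lee_fin.
      have := expR_ge1Dx ((1 - t ^- 2) * x ^+ 2 / 2); lra.
  have : (0 <= v)%E by apply: integral_ge0 => x _; rewrite lee_fin sqr_ge0.
  case: (v) => [r| |] // _; last by rewrite leey.
  rewrite -EFinM -EFinD !lee_fin => h.
  have h2 : 2 * (1 - t) <= (t ^- 2 - 1) * r by lra.
  have e : (t ^- 2 - 1) * t ^+ 2 = (1 - t) * (t + 1) by field; rewrite gt_eqF.
  rewrite -(ler_pM2l b0) e; apply: le_trans h2; move: t0 t1; clear; nra.
have : (0 <= v)%E by apply: integral_ge0 => x _; rewrite lee_fin sqr_ge0.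
case: (v) up lo => [r| |] up lo //; last first.
  by have := up 2; rewrite leye_eq => /(_ ltac:(lra)).
move=> _; congr EFin; apply/eqP.
rewrite eq_le; apply/andP; split; rewrite leNgt; apply/negP => h.
- pose e := r - 1; pose t : R := 1 + Num.min (e / 4) 1.
  have e0 : 0 < e by rewrite /e; lra.
  have m0 : 0 < Num.min (e / 4) 1 by rewrite lt_min; lra.
  have m1 : Num.min (e / 4) 1 <= 1 by rewrite ge_min lexx orbT.
  have m2 : Num.min (e / 4) 1 <= e / 4 by rewrite ge_min lexx.
  have := up t; rewrite lee_fin => /(_ _); rewrite /t => /(_ ltac:(lra)).
  by rewrite /e in e0 m2 *; set m := Num.min _ _ in m0 m1 m2 *; move: e0 m0 m1 m2; clear; nra.
- pose e := 1 - r; pose t : R := 1 - Num.min (e / 4) (1 / 2).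
  have e0 : 0 < e by rewrite /e; lra.
  have m0 : 0 < Num.min (e / 4) (1 / 2) by rewrite lt_min; lra.
  have m1 : Num.min (e / 4) (1 / 2) <= 1 / 2 by rewrite ge_min lexx orbT.
  have m2 : Num.min (e / 4) (1 / 2) <= e / 4 by rewrite ge_min lexx.
  have := lo t; rewrite lee_fin /t => /(_ ltac:(lra) ltac:(lra)).
  by rewrite /e in e0 m2 *; set m := Num.min _ _ in m0 m1 m2 *; move: e0 m0 m1 m2; clear; nra.
Qed.

End NormalLine.

(** * Rotation invariance of the standard Gaussian *)

Section StandardGaussian.
Variable R : realType.
Notation N01 := (@normal_prob R 0 1).

Lemma N01_rotationT (c s : R)
    (f : measurableTypeR R * measurableTypeR R -> \bar R) :
  c ^+ 2 + s ^+ 2 = 1 -> measurable_fun setT f -> (forall z, (0 <= f z)%E) ->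
  (\int[N01]_x \int[N01]_y f (c * x - s * y, s * x + c * y)%R
   = \int[N01]_x \int[N01]_y f (x, y))%E.
Proof.
move=> cs mf f0; have [c0|c0] := eqVneq c 0; last exact: N01_rotation.
(* a quarter turn is the square of a rotation with nonzero cosine *)
rewrite c0 expr0n add0r in cs.
pose h : R := (Num.sqrt 2)^-1.
have h2 : h ^+ 2 = 2^-1 by rewrite exprVn sqr_sqrtr.
have h0 : h != 0 by rewrite invr_eq0 sqrtr_eq0 -ltNge.
have hs : h ^+ 2 + (h * s) ^+ 2 = 1 by rewrite exprMn cs mulr1 h2; field.
pose F z := f (h * z.1 - h * s * z.2, h * s * z.1 + h * z.2)%R.
have mF : measurable_fun setT F.
  apply: (measurableT_comp mf); apply: measurable_fun_pair.
  - by apply: measurable_funB; apply: measurable_funM.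
  - by apply: measurable_funD; apply: measurable_funM.
have F0 z : (0 <= F z)%E by exact: f0.
apply: etrans (N01_rotation h0 hs mf f0).
apply: etrans (N01_rotation h0 hs mF F0).
apply: eq_integral => x _; apply: eq_integral => y _.
have e : h * h = 2^-1 by rewrite -expr2.
have e' : s * s = 1 by rewrite -expr2.
rewrite /F /= c0; congr (f (_, _)).
- transitivity (h * h * (x * (1 - s * s) - 2 * s * y)); last by ring.
  by rewrite e e'; field.
- transitivity (h * h * (2 * s * x + y * (1 - s * s))); last by ring.
  by rewrite e e'; field.
Qed.

Section Vectors.
Variable d : nat.

Definition vec (z : Rd R d) : 'cV[R]_d := \col_i tnth z i.
Definition unvec (v : 'cV[R]_d) : Rd R d := [tuple v i 0 | i < d].

Lemma vecK : cancel vec unvec.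
Proof. by move=> z; apply: eq_from_tnth => i; rewrite tnth_mktuple mxE. Qed.

Lemma unvecK : cancel unvec vec.
Proof. by move=> v; apply/colP => i; rewrite mxE tnth_mktuple. Qed.

Lemma affine_RdE m L z : affine_Rd m L z = unvec (m + L *m vec z).
Proof.
apply: eq_from_tnth => i; rewrite !tnth_mktuple !mxE.
by congr (_ + _); apply: eq_bigr => j _; rewrite mxE.
Qed.

Lemma vec_affine m L z : vec (affine_Rd m L z) = m + L *m vec z.
Proof. by rewrite affine_RdE unvecK. Qed.

Lemma affine_Rd_comp (m : 'cV[R]_d) (A B : 'M[R]_d) z :
  affine_Rd m A (affine_Rd 0 B z) = affine_Rd m (A *m B) z.
Proof. by rewrite [LHS]affine_RdE vec_affine add0r mulmxA -affine_RdE. Qed.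

Lemma affine_Rd1 z : affine_Rd (0 : 'cV[R]_d) 1%:M z = z.
Proof. by rewrite affine_RdE add0r mul1mx vecK. Qed.

Lemma measurable_affine (m : 'cV[R]_d) (L : 'M[R]_d) :
  measurable_fun setT (affine_Rd m L).
Proof. exact: measurable_affine_Rd. Qed.

(** Testing on nonnegative measurable functions keeps the class stable under composition with affine
    maps and carries no integrability condition. *)
Definition gauss_inv (O : 'M[R]_d) := forall f : Rd R d -> \bar R,
  measurable_fun setT f -> (forall z, (0 <= f z)%E) ->
  (\int[std_gauss R d]_z f (affine_Rd 0 O z) = \int[std_gauss R d]_z f z)%E.

Lemma gauss_inv1 : gauss_inv 1%:M.
Proof. by move=> f _ _; apply: eq_integral => z _; rewrite affine_Rd1. Qed.

Lemma gauss_invM A B : gauss_inv A -> gauss_inv B -> gauss_inv (A *m B).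
Proof.
move=> hA hB f mf f0; rewrite -(hA f mf f0).
have mfA : measurable_fun setT (f \o affine_Rd 0 A).
  exact: (measurableT_comp mf (measurable_affine _ _)).
rewrite -(hB _ mfA (fun z => f0 _)).
by apply: eq_integral => z _ /=; rewrite affine_Rd_comp.
Qed.

End Vectors.

Lemma vec_cons d x (z : Rd R d) :
  vec (cons_Rd (x, z)) = col_mx (x : R)%:M (vec z) :> 'cV[R]_(1 + d).
Proof.
apply/colP => i; rewrite !mxE; case: splitP => j /= ij; rewrite !mxE.
  rewrite [j]ord1 /= mulr1n (_ : i = ord0)//.
  by apply: ord_inj; rewrite [LHS]ij [j]ord1.
by rewrite (_ : i = lift ord0 j) ?tnthS//; apply: ord_inj; rewrite [LHS]ij.
Qed.

Lemma affine_cons d (O : 'M[R]_(1 + d)) x z (v : 'cV[R]_d) (y : R) :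
  O *m col_mx x%:M (vec z) = col_mx y%:M v ->
  affine_Rd 0 O (cons_Rd (x, z)) = cons_Rd (y, unvec v).
Proof.
move=> e; apply: (can_inj (@vecK _)).
by rewrite vec_affine add0r !vec_cons unvecK.
Qed.

Lemma ge0_integral_std_gaussS d (f : Rd R d.+1 -> \bar R) :
  measurable_fun setT f -> (forall z, (0 <= f z)%E) ->
  (\int[std_gauss R d.+1]_z f z =
   \int[N01]_x \int[std_gauss R d]_z f (cons_Rd (x, z)))%E.
Proof.
move=> mf f0; rewrite [LHS]ge0_integral_pushforward//.
have mfc : measurable_fun setT (f \o @cons_Rd R d).
  exact: (measurableT_comp mf (@measurable_cons_Rd R d)).
exact: (fubini_tonelli1 (f \o @cons_Rd R d) mfc (fun z => f0 _)).
Qed.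

Lemma measurable_cons_snd d (f : Rd R d.+1 -> \bar R) x :
  measurable_fun setT f -> measurable_fun setT (fun z => f (cons_Rd (x, z))).
Proof.
move=> mf.
exact: (measurable_fun_pair2 x (measurableT_comp mf (@measurable_cons_Rd R d))).
Qed.

Lemma gauss_inv_lift d (O : 'M[R]_d) : gauss_inv O ->
  gauss_inv (block_mx 1%:M 0 0 O : 'M[R]_(1 + d)).
Proof.
move=> hO f mf f0.
pose B : 'M[R]_d.+1 := block_mx 1%:M 0 0 O : 'M[R]_(1 + d).
have mfB := measurableT_comp mf (measurable_affine 0 B).
apply: etrans (esym (ge0_integral_std_gaussS mf f0)).
apply: (etrans (ge0_integral_std_gaussS mfB (fun z => f0 _))).
apply: eq_integral => x _.
rewrite -(hO _ (measurable_cons_snd x mf) (fun z => f0 _)).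
apply: eq_integral => z _; congr f.
rewrite [affine_Rd 0 O z]affine_RdE add0r; apply: affine_cons.
by rewrite mul_block_col !mul0mx add0r addr0 mul1mx.
Qed.

Definition rot_mx d (c s : R) : 'M[R]_(1 + (1 + d)) :=
  block_mx c%:M (row_mx (- s)%:M 0) (col_mx s%:M 0) (block_mx c%:M 0 0 1%:M).

(** The first two coordinates are integrated outermost, so that the planar invariance applies to the
    inner integral [G]. *)
Lemma gauss_inv_rot d c s : c ^+ 2 + s ^+ 2 = 1 -> gauss_inv (rot_mx d c s).
Proof.
move=> cs f mf f0.
pose G (xy : measurableTypeR R * measurableTypeR R) :=
  (\int[std_gauss R d]_z f (cons_Rd (xy.1, cons_Rd (xy.2, z))))%E.
have mf3 : measurable_fun setT
    (fun p : (measurableTypeR R * measurableTypeR R) * Rd R d =>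
      f (cons_Rd (p.1.1, cons_Rd (p.1.2, p.2)))).
  apply: (measurableT_comp mf); apply: (measurableT_comp (@measurable_cons_Rd R _)).
  apply: measurable_fun_pair; first exact: (measurableT_comp measurable_fst measurable_fst).
  apply: (measurableT_comp (@measurable_cons_Rd R _)).
  apply: measurable_fun_pair => //.
  exact: (measurableT_comp measurable_snd measurable_fst).
have mG : measurable_fun setT G.
  exact: (measurable_fun_fubini_tonelli_F _ mf3 (fun p => f0 _)).
have G0 xy : (0 <= G xy)%E by apply: integral_ge0.
have iter (g : Rd R d.+2 -> \bar R) : measurable_fun setT g ->
    (forall z, (0 <= g z)%E) ->
  (\int[std_gauss R d.+2]_z g z = \int[N01]_x \int[N01]_y
     \int[std_gauss R d]_z g (cons_Rd (x, cons_Rd (y, z))))%E.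
  move=> mg g0; apply: (etrans (ge0_integral_std_gaussS mg g0)).
  apply: eq_integral => x _.
  exact: (ge0_integral_std_gaussS (measurable_cons_snd x mg) (fun z => g0 _)).
apply: etrans (esym (iter f mf f0)).
have mfr := measurableT_comp mf (measurable_affine 0 (rot_mx d c s)).
apply: (etrans (iter _ mfr (fun z => f0 _))).
apply: etrans (N01_rotationT cs mG G0).
apply: eq_integral => x _; apply: eq_integral => y _; apply: eq_integral => z _.
congr f; rewrite (@affine_cons _ _ _ _ (col_mx (s * x + c * y)%:M (vec z)) (c * x - s * y)).
  congr cons_Rd; congr pair; apply: (can_inj (@vecK _)).
  by rewrite unvecK vec_cons.
rewrite vec_cons mul_block_col mul_row_col mul0mx addr0.
rewrite mul_col_mx mul_block_col !mul0mx mul1mx add0r addr0 add_col_mx.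
by rewrite -!scalar_mxM -!raddfD/= mulNr add0r.
Qed.

Lemma gauss_inv_opp : gauss_inv ((-1)%:M : 'M[R]_1).
Proof.
move=> f mf f0.
have mfo := measurableT_comp mf (measurable_affine 0 (-1)%:M).
apply: etrans (esym (ge0_integral_std_gaussS mf f0)).
apply: (etrans (ge0_integral_std_gaussS mfo (fun z => f0 _))).
pose G x := (\int[std_gauss R 0]_z f (cons_Rd (x, z)))%E.
have mG : measurable_fun setT G.
  apply: (measurable_fun_fubini_tonelli_F (f \o @cons_Rd R 0) _ (fun p => f0 _)).
  exact: (measurableT_comp mf (@measurable_cons_Rd R _)).
have G0 x : (0 <= G x)%E by apply: integral_ge0.
apply: etrans (N01_opp mG G0).
apply: eq_integral => x _; apply: eq_integral => z _; congr f.
rewrite (@affine_cons _ _ _ _ (vec z) (- x)) ?vecK//.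
rewrite mul_scalar_mx scale_col_mx scaleN1r; congr col_mx.
  by rewrite -raddfN.
by apply/colP => -[].
Qed.

Definition orthomx d (O : 'M[R]_d) : Prop := O^T *m O = 1%:M.

Lemma orthomxC d (O : 'M[R]_d) : orthomx O -> O *m O^T = 1%:M.
Proof. exact: mulmx1C. Qed.

Lemma orthomxM d (A B : 'M[R]_d) : orthomx A -> orthomx B -> orthomx (A *m B).
Proof.
by move=> hA hB; rewrite /orthomx trmx_mul mulmxA -(mulmxA B^T) hA mulmx1.
Qed.

Lemma orthomx_lift d (O : 'M[R]_d) : orthomx O ->
  orthomx (block_mx 1%:M 0 0 O : 'M[R]_(1 + d)).
Proof.
move=> hO; rewrite /orthomx tr_block_mx mulmx_block !trmx0 !trmx1 !mulmx0.
by rewrite !mul0mx !mul1mx !addr0 add0r hO -scalar_mx_block.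
Qed.

Lemma tr_rot_mx d c s : (rot_mx d c s)^T = rot_mx d c (- s).
Proof.
rewrite /rot_mx tr_block_mx tr_row_mx tr_col_mx tr_block_mx !tr_scalar_mx.
by rewrite !trmx0 opprK.
Qed.

Lemma orthomx_rot d c s : c ^+ 2 + s ^+ 2 = 1 -> orthomx (rot_mx d c s).
Proof.
move=> cs; rewrite /orthomx tr_rot_mx /rot_mx opprK mulmx_block.
rewrite mul_row_col mul_row_block mul_block_col mulmx_block mul_col_row.
rewrite mul_mx_row mul_col_mx !mulmx0 !mul0mx !mul1mx -!scalar_mxM !addr0 !add0r.
rewrite add_row_mx add_col_mx add_block_mx !addr0 ?add0r -!raddfD/=.
have e1 : c * c + s * s = 1 by rewrite -!expr2.
have e2 : - s * - s + c * c = 1 by rewrite mulrNN addrC.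
have e3 : c * - s + s * c = 0 by rewrite mulrN mulrC addNr.
have e4 : - s * c + c * s = 0 by rewrite mulNr mulrC addNr.
rewrite e1 e2 e3 e4 -scalar_mx_block !raddf0 row_mx0 col_mx0.
by rewrite -scalar_mx_block.
Qed.

(* Rotations in the first coordinate plane, together with an orthogonal map of
   the remaining coordinates, move the first basis vector to any unit vector. *)
Lemma gauss_inv_transitive d (v : 'cV[R]_(1 + d)) : (v^T *m v) 0 0 = 1 ->
  exists2 P : 'M[R]_(1 + d), gauss_inv P /\ orthomx P & P *m col_mx 1%:M 0 = v.
Proof.
elim: d v => [|d IHd] v v1.
  have v2 : v 0 0 ^+ 2 = 1 by rewrite -v1 !mxE big_ord1 !mxE expr2.
  have vE : v = (v 0 0)%:M.
    by apply/colP => i; rewrite [i]ord1 !mxE mulr1n.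
  exists (v 0 0)%:M; last first.
    rewrite {2}vE mul_scalar_mx -[in RHS]scalemx1; congr (_ *: _).
    apply/colP => i; rewrite [i]ord1 (_ : 0 = lshift 0 0 :> 'I_(1 + 0)).
      by rewrite col_mxEu !mxE.
    exact: val_inj.
  split; last first.
    by rewrite /orthomx tr_scalar_mx -scalar_mxM -expr2 v2.
  move/eqP: v2; rewrite sqrf_eq1 => /orP[] /eqP ->.
    exact: gauss_inv1.
  exact: gauss_inv_opp.
pose a := v 0 0; pose v' := dsubmx v.
have vE : v = col_mx a%:M v'.
  rewrite -[LHS]vsubmxK; congr col_mx.
  apply/colP => i; rewrite [i]ord1 !mxE mulr1n; congr (v _ _); exact: val_inj.
pose r := Num.sqrt ((v'^T *m v') 0 0).
have vv0 : 0 <= (v'^T *m v') 0 0.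
  by rewrite mxE sumr_ge0// => i _; rewrite mxE -expr2 sqr_ge0.
have ar : a ^+ 2 + r ^+ 2 = 1.
  rewrite sqr_sqrtr// -v1 vE tr_col_mx mul_row_col tr_scalar_mx -scalar_mxM.
  by rewrite [RHS]mxE [X in _ = X + _]mxE mulr1n expr2.
have [P' [gP' oP'] P'e] : exists2 P : 'M[R]_(1 + d), gauss_inv P /\ orthomx P &
    r *: (P *m col_mx 1%:M 0) = v'.
  have [r0|r0] := eqVneq r 0.
    exists 1%:M; first by split; [exact: gauss_inv1|rewrite /orthomx mulmx1 trmx1].
    have/eqP : (v'^T *m v') 0 0 = 0.
      by rewrite -(sqr_sqrtr vv0) -/r r0 expr0n.
    rewrite mxE psumr_eq0; last by move=> i _; rewrite mxE -expr2 sqr_ge0.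
    move=> /allP z; rewrite r0 scale0r; apply/colP => i; rewrite mxE.
    have := z i; rewrite mem_index_enum mxE -expr2 sqrf_eq0 => /(_ isT) /eqP ->.
    by [].
  have [|P [gP oP] Pe] := IHd (r^-1 *: v').
    rewrite [(_ *: _)^T]linearZ -scalemxAl -scalemxAr scalerA mxE -(sqr_sqrtr vv0).
    by rewrite -/r -expr2 exprVn mulVf// sqrf_eq0.
  by exists P => //; rewrite Pe scalerA divff// scale1r.
exists (block_mx 1%:M 0 0 P' *m rot_mx d a r).
  split; first by apply: gauss_invM; [exact: gauss_inv_lift|exact: gauss_inv_rot].
  by apply: orthomxM; [exact: orthomx_lift|exact: orthomx_rot].
rewrite -mulmxA mul_block_col !mulmx0 !addr0 mulmx1 mulmx1 mul_block_col.
rewrite !mul0mx addr0 add0r mul1mx vE; congr col_mx.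
rewrite -P'e scalemxAr; congr (_ *m _).
by rewrite scale_col_mx scaler0 scalemx1.
Qed.

(** If an invariant [P] sends the first basis vector [e] where [O] sends it, then [P^T O] fixes [e];
    being orthogonal, it is block diagonal with blocks 1 and an orthogonal matrix of smaller size,
    to which induction applies. *)
Lemma gauss_inv_orthomx d (O : 'M[R]_d) : orthomx O -> gauss_inv O.
Proof.
elim: d O => [|d IHd] O oO.
  by rewrite (_ : O = 1%:M); [exact: gauss_inv1|apply/matrixP => -[]].
rewrite -[d.+1]/(1 + d)%N in O oO *.
pose e : 'cV[R]_(1 + d) := col_mx 1%:M 0.
have ee : e^T *m e = 1%:M.
  by rewrite tr_col_mx mul_row_col trmx1 trmx0 mul0mx addr0 mulmx1.
have [|P [gP oP] Pe] := @gauss_inv_transitive d (O *m e).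
  by rewrite trmx_mul mulmxA -(mulmxA e^T) oO mulmx1 ee mxE.
pose Q := P^T *m O.
have oQ : orthomx Q.
  by apply: orthomxM => //; rewrite /orthomx trmxK; exact: orthomxC.
have Qe : Q *m e = e by rewrite -mulmxA -Pe mulmxA oP mul1mx.
have Qe' : Q^T *m e = e by rewrite -[in LHS]Qe mulmxA oQ mul1mx.
have QE : Q = block_mx 1%:M 0 0 (drsubmx Q).
  move: Qe Qe'; rewrite -[in Q *m e](submxK Q) -[in Q^T *m e](submxK Q).
  rewrite tr_block_mx !mul_block_col !mulmx1 !mulmx0 !addr0.
  move=> /eq_col_mx[ul dl] /eq_col_mx[_ ur].
  by rewrite -[LHS]submxK ul dl -[ursubmx Q]trmxK ur trmx0.
have -> : O = P *m Q by rewrite mulmxA (orthomxC oP) mul1mx.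
apply: gauss_invM => //; rewrite QE; apply/gauss_inv_lift/IHd.
move: oQ; rewrite /orthomx QE tr_block_mx mulmx_block !trmx0 !trmx1 !mulmx0.
rewrite !mul0mx !mul1mx !addr0 add0r block_mxKdr.
by rewrite [RHS]scalar_mx_block => /eq_block_mx[].
Qed.

End StandardGaussian.

(** * Positive definite matrices and their square roots *)

Section PositiveDefinite.
Variable R : realType.

Definition quad d (M : 'M[R]_d) (v : 'cV[R]_d) : R := (v^T *m M *m v) 0 0.
Definition sqnorm d (v : 'cV[R]_d) : R := (v^T *m v) 0 0.

Lemma sqnormE d (v : 'cV[R]_d) : sqnorm v = \sum_i v i 0 ^+ 2.
Proof. by rewrite /sqnorm mxE; apply: eq_bigr => i _; rewrite mxE expr2. Qed.

Lemma sqnorm_ge0 d (v : 'cV[R]_d) : 0 <= sqnorm v.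
Proof. by rewrite sqnormE sumr_ge0// => i _; rewrite sqr_ge0. Qed.

Lemma sqnorm_eq0 d (v : 'cV[R]_d) : (sqnorm v == 0) = (v == 0).
Proof.
rewrite sqnormE psumr_eq0; last by move=> i _; rewrite sqr_ge0.
apply/allP/eqP => [h|-> i _]; last by rewrite mxE expr0n /= eqxx.
apply/colP => i; have := h i (mem_index_enum i).
by rewrite sqrf_eq0 mxE => /eqP.
Qed.

Lemma sqnorm_gt0 d (v : 'cV[R]_d) : (0 < sqnorm v) = (v != 0).
Proof. by rewrite lt_def sqnorm_ge0 andbT sqnorm_eq0. Qed.

Lemma quad_mulmx d (A M : 'M[R]_d) v : quad (A^T *m M *m A) v = quad M (A *m v).
Proof. by rewrite /quad trmx_mul !mulmxA. Qed.

Lemma quad_gram d (A : 'M[R]_d) v : quad (A^T *m A) v = sqnorm (A *m v).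
Proof. by rewrite /quad /sqnorm trmx_mul !mulmxA. Qed.

Lemma posdef_unit d (S : 'M[R]_d) : posdef S -> S \in unitmx.
Proof.
move=> [_ pS]; rewrite -row_free_unit -kermx_eq0; apply/eqP/row_matrixP => i.
rewrite row0; apply/eqP; apply: contraT => vn0.
have vS : row i (kermx S) *m S = 0 by rewrite -row_mul mulmx_ker row0.
have := pS (row i (kermx S))^T; rewrite trmx_eq0 => /(_ vn0).
by rewrite trmxK vS mul0mx mxE ltxx.
Qed.

Lemma posdef_congr d (A S : 'M[R]_d) : A \in unitmx -> posdef S ->
  posdef (A^T *m S *m A).
Proof.
move=> uA [sS pS]; split; first by rewrite !trmx_mul trmxK sS mulmxA.
move=> v v0; have := quad_mulmx A S v; rewrite /quad => ->; apply: pS.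
by apply: contraNneq v0 => e; rewrite -(mulKmx uA v) e mulmx0.
Qed.

Lemma posdef_sum d n (w : 'I_n -> R) (P : 'I_n -> 'M[R]_d) : (0 < n)%N ->
  (forall i, 0 < w i) -> (forall i, posdef (P i)) -> posdef (\sum_i w i *: P i).
Proof.
case: n => // n in w P * => _ w0 pP; split.
  rewrite raddf_sum; apply: eq_bigr => i _.
  by rewrite /= [(_ *: _)^T]linearZ/= (pP i).1.
move=> v v0; rewrite mulmx_sumr mulmx_suml summxE big_ord_recl.
apply: ltr_pwDl.
  by rewrite -scalemxAr -scalemxAl mxE mulr_gt0//; apply: (pP _).2.
apply: sumr_ge0 => i _; rewrite -scalemxAr -scalemxAl mxE mulr_ge0 ?ltW//.
exact: (pP _).2.
Qed.

(** Newton's scheme: a new node corrects [q] by a multiple of the product that vanishes at the other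
    nodes; a repeated node changes nothing. *)
Lemma interpolation (s : seq R) (f : R -> R) :
  exists q : {poly R}, forall x, x \in s -> q.[x] = f x.
Proof.
elim: s => [|x s [q hq]]; first by exists 0.
have [xs|xs] := boolP (x \in s).
  by exists q => y; rewrite inE => /predU1P[->|]; apply: hq.
pose w : {poly R} := \prod_(y <- s) ('X - y%:P).
have wx : w.[x] != 0 by rewrite -[_ == 0]/(root w x) root_prod_XsubC.
exists (q + ((f x - q.[x]) / w.[x])%:P * w) => y; rewrite inE !hornerE.
move=> /predU1P[->|ys]; first by rewrite divfK// addrC subrK.
have /rootP -> : root w y by rewrite root_prod_XsubC.
by rewrite mulr0 addr0 hq.
Qed.

End PositiveDefinite.

Section SquareRoot.
Import complex spectral sesquilinear.
Local Open Scope complex_scope.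
Variable R : realType.
Notation toC := (real_complex R).

Lemma horner_mx_tr n (A : 'M[R]_n.+1) (q : {poly R}) : A^T = A ->
  (horner_mx A q)^T = horner_mx A q.
Proof.
move=> sA; elim/poly_ind: q => [|q c ih]; first by rewrite rmorph0 trmx0.
rewrite rmorphD rmorphM/= horner_mx_X horner_mx_C linearD/= tr_scalar_mx.
rewrite trmx_mul ih sA; congr (_ + _).
by have := @comm_horner_mx2 _ _ A 'X q; rewrite horner_mx_X.
Qed.

(* Over the complex numbers a symmetric matrix is unitarily diagonalizable;
   interpolating the fourth root on its spectrum gives a polynomial [B] in [A]
   with [B ^ 4 = A], so that [B ^ 2 = B^T B] is the positive square root. *)
Lemma posdef_fourth_root n (A : 'M[R]_n.+1) : posdef A ->
  exists2 B : 'M[R]_n.+1, B^T = B & (B *m B) *m (B *m B) = A.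
Proof.
move=> [sA pA].
pose AC := map_mx toC A.
have hA : AC \is hermsymmx.
  apply: realsym_hermsym.
    apply/is_hermitianmxP; rewrite expr0 scale1r map_mx_id//.
    by rewrite /AC map_trmx sA.
  by apply/mxOverP => i j; rewrite mxE; apply/complex_realP; exists (A i j).
have /hermitian_normalmx/orthomx_spectralP := hA.
set P := spectralmx AC; set D := spectral_diag AC => AE.
have uP : P \in unitmx by exact: spectral_unit.
have realD : forall j, exists x, D 0 j = toC x.
  move=> j; have /mxOverP/(_ 0 j)/complex_realP := hermitian_spectral_diag_real hA.
  by [].
have [x xE] := choice realD.
(* A real eigenvalue of the complexified matrix is an eigenvalue of [A] itself, hence has a real
   eigenvector, on which positive definiteness can be tested. *)
have xpos j : 0 < x j.
  have : eigenvalue AC (toC (x j)).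
    apply/eigenvalueP; exists (row j P).
      rewrite AE -row_mul !mulmxA mulmxV// mul1mx -xE.
      by apply/rowP => k; rewrite mul_diag_mx !mxE.
    apply/eqP => rP0; have := mulmxV uP.
    move/(congr1 (row j)); rewrite row_mul rP0 mul0mx => /rowP/(_ j).
    by rewrite !mxE eqxx => /eqP; rewrite eq_sym oner_eq0.
  rewrite eigenvalue_map => /eigenvalueP[v vA v0].
  have v0' : v^T != 0 by rewrite trmx_eq0.
  have := pA v^T v0'; rewrite trmxK vA -scalemxAl mxE.
  have := sqnorm_gt0 v^T; rewrite /sqnorm trmxK v0' => n0.
  by rewrite pmulr_lgt0.
have [q hq] := interpolation [seq x j | j <- enum 'I_n.+1]
  (fun y => Num.sqrt (Num.sqrt y)).
exists (horner_mx A q); first exact: horner_mx_tr.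
apply: (@map_mx_inj _ _ toC); rewrite -/AC !map_mxM map_horner_mx -/AC.
rewrite AE horner_mx_uconjC// horner_mx_diag.
set E := diag_mx _.
have e2 : E *m E *m (E *m E) = diag_mx D.
  rewrite /E !mulmx_diag; congr diag_mx; apply/rowP => j; rewrite !mxE xE.
  rewrite horner_map hq; last by apply/mapP; exists j => //; rewrite mem_enum.
  rewrite -!rmorphM -!expr2; congr toC.
  by rewrite !sqr_sqrtr ?sqrtr_ge0// ltW.
have cj F G : invmx P *m F *m P *m (invmx P *m G *m P) = invmx P *m (F *m G) *m P.
  by rewrite !mulmxA mulmxK.
by rewrite !cj e2.
Qed.

End SquareRoot.

Section PositiveSquareRoot.
Variables (R : realType).

Lemma posdef_sqrt d (S : 'M[R]_d) : posdef S ->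
  exists L, posdef L /\ L *m L = S.
Proof.
case: d S => [|d] S pS.
  by exists S; split => //; apply/matrixP => -[].
have [B sB BB] := posdef_fourth_root pS; exists (B *m B); split => //.
have uB : B \in unitmx.
  have := posdef_unit pS; rewrite -BB !unitmx_mul.
  by case: (B \in unitmx).
split; first by rewrite trmx_mul sB.
move=> v v0; have := quad_gram B v; rewrite sB /quad => ->.
rewrite sqnorm_gt0; apply: contraNneq v0 => e.
by rewrite -(mulKmx uB v) e mulmx0.
Qed.

Lemma sqrtmxP d (S : 'M[R]_d) : posdef S ->
  posdef (sqrtmx S) /\ sqrtmx S *m sqrtmx S = S.
Proof.
move=> /posdef_sqrt h.
exact: (@xgetPex _ 0 [set L | posdef L /\ L *m L = S] h).
Qed.

(** Any factor [A] of [S] gives the same law as the symmetric root [L]: from [A A^T = L L] it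
    follows that [L^-1 A] is orthogonal, and the standard Gaussian absorbs it. *)
Lemma gauss_affine d (m : 'cV[R]_d) (S A : 'M[R]_d) : posdef S ->
  A *m A^T = S -> forall f : Rd R d -> \bar R, measurable_fun setT f ->
  (forall x, (0 <= f x)%E) ->
  (\int[gauss (m, S)]_x f x = \int[std_gauss R d]_z f (affine_Rd m A z))%E.
Proof.
move=> pS AS f mf f0; have [[sL pL] LL] := sqrtmxP pS.
have uL := posdef_unit (conj sL pL); set L := sqrtmx S in sL pL LL uL *.
rewrite [LHS]ge0_integral_pushforward//.
pose O := invmx L *m A.
have oO : orthomx O.
  rewrite /orthomx; apply: mulmx1C; rewrite trmx_mul trmx_inv sL mulmxA.
  by rewrite -(mulmxA (invmx L)) AS -LL -!mulmxA mulmxV// mulmx1 mulVmx.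
have mfL : measurable_fun setT (f \o affine_Rd m L).
  exact: (measurableT_comp mf (measurable_affine _ _)).
apply: etrans (esym (gauss_inv_orthomx oO mfL (fun z => f0 _))) _.
apply: eq_integral => z _ /=; rewrite affine_Rd_comp; congr (f (affine_Rd _ _ _)).
by rewrite /O mulKVmx.
Qed.

End PositiveSquareRoot.

(** * Weak duality for the unbalanced cost *)

Section Entropy.
Variable R : realType.

(** The integrable bound on the negative part excludes both [-oo] and an undefined difference. The
    lemma is meant for log-densities, whose positive part is not controlled. *)
Lemma integrable_or_pinfty d (T : measurableType d)
    (m : {measure set T -> \bar R}) (l e : T -> R) :
  measurable_fun setT l -> m.-integrable setT (EFin \o e) ->
  (forall x, - e x <= l x) ->
  m.-integrable setT (EFin \o l) \/ (\int[m]_x (l x)%:E = +oo)%E.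
Proof.
move=> ml ie el.
have mE : measurable_fun setT (EFin \o l) by exact/measurable_EFinP.
have mp : measurable_fun setT (EFin \o l)^\+%E by exact: measurable_funepos.
have mn : measurable_fun setT (EFin \o l)^\-%E by exact: measurable_funeneg.
have nfin : (\int[m]_x ((EFin \o l)^\- x) < +oo)%E.
  have /integrableP[me] := ie; apply: le_lt_trans.
  apply: ge0_le_integral => //; first exact: measurableT_comp.
  move=> x _; rewrite funenegE /= ge_max !lee_fin normr_ge0 andbT.
  by have := el x; have := ler_norm (e x); lra.
have [pfin|pinf] := ltP (\int[m]_x ((EFin \o l)^\+ x))%E +oo%E; [left|right].
  apply/integrableP; split => //.
  rewrite (eq_integral (fun x => ((EFin \o l)^\+ x + (EFin \o l)^\- x)%E)).
    by rewrite ge0_integralD// lte_add_pinfty.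
  by move=> x _; exact: (congr1 (fun h => h x) (fune_abse (EFin \o l))).
rewrite integralE; move: pinf; rewrite leye_eq => /eqP ->.
by rewrite addye// eqe_oppLR /= lt_eqF.
Qed.

Section Law.
Context d1 d2 (X : measurableType d1) (Y : measurableType d2).
Variables (m : {measure set X -> \bar R}) (p : {measure set Y -> \bar R}).
Variable phi : X -> Y.
Hypothesis mphi : measurable_fun setT phi.
Hypothesis law : forall A, measurable A -> p A = m (phi @^-1` A).

Lemma ge0_integral_law (f : Y -> \bar R) : measurable_fun setT f ->
  (forall y, (0 <= f y)%E) -> (\int[p]_y f y = \int[m]_x f (phi x))%E.
Proof.
move=> mf f0; rewrite (eq_measure_integral (pushforward m phi)).
  by rewrite ge0_integral_pushforward.
by move=> A mA _; exact: law.
Qed.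

Lemma integrable_law (f : Y -> R) : p.-integrable setT (EFin \o f) ->
  m.-integrable setT (EFin \o (f \o phi)) /\
  \int[p]_y f y = \int[m]_x f (phi x).
Proof.
move=> /integrableP[mf foo].
have im : m.-integrable setT (EFin \o (f \o phi)).
  apply/integrableP; split; first exact: (measurableT_comp mf mphi).
  have mabs : measurable_fun setT (fun x => `|(EFin \o f) x|)%E.
    exact: measurableT_comp.
  by rewrite -(ge0_integral_law mabs (fun x => abse_ge0 _)).
split => //; congr fine; rewrite (eq_measure_integral (pushforward m phi)).
  by rewrite integral_pushforward.
by move=> A mA _; exact: law.
Qed.

End Law.

Variable d : nat.
Implicit Types p q mu nu : probability (Rd R d) R.

(** The last clause is only an inequality: [g * exp (- l)] equals 1 where the density [g] is
    positive, but [mu] may charge the set where [g] vanishes. *)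
Lemma KL_log_density p mu : p `<< mu -> exists l : Rd R d -> R,
  [/\ measurable_fun setT l, KL p mu = (\int[p]_x (l x)%:E)%E &
      forall phi : Rd R d -> \bar R, measurable_fun setT phi ->
        (forall x, (0 <= phi x)%E) ->
        (\int[p]_x (phi x * (expR (- l x))%:E) <= \int[mu]_x phi x)%E].
Proof.
move=> pmu.
pose g := Radon_Nikodym_SigmaFinite.f p mu.
have g0 x : (0 <= g x)%E by exact: Radon_Nikodym_SigmaFinite.f_ge0.
have gfin x : g x \is a fin_num by exact: Radon_Nikodym_SigmaFinite.f_fin_num.
have mg : measurable_fun setT g.
  exact: measurable_int (Radon_Nikodym_SigmaFinite.f_integrable pmu).
pose l x := ln (fine (g x)).
have ml : measurable_fun setT l.
  apply: (measurableT_comp (@measurable_ln R)).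
  exact: (measurableT_comp (fine_measurable measurableT) mg).
exists l; split => //.
- rewrite /KL asboolT//.
  pose f' := Radon_Nikodym (charge_of_finite_measure p) mu.
  have mf' : measurable_fun setT f'.
    exact: measurable_int
      (@Radon_Nikodym_integrable _ _ _ (charge_of_finite_measure p) mu pmu).
  apply: ae_eq_integral => //.
  + apply/measurable_EFinP; apply: (measurableT_comp (@measurable_ln R)).
    exact: (measurableT_comp (fine_measurable measurableT) mf').
  + exact/measurable_EFinP.
  have := null_dominates_ae_eq measurableT pmu
    (ae_eq_Radon_Nikodym_SigmaFinite pmu measurableT).
  by apply: filterS => x /(_ I) e _; rewrite /l /g e.
- move=> phi mphi phi0.
  have mri : measurable_fun setT (fun x => (expR (- l x))%:E).
    apply/measurable_EFinP; apply: (measurableT_comp (@measurable_expR R)).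
    exact: measurableT_comp.
  have mphil : measurable_fun setT (fun x => phi x * (expR (- l x))%:E)%E.
    exact: emeasurable_funM.
  have phil0 x : (0 <= phi x * (expR (- l x))%:E)%E.
    by rewrite mule_ge0// lee_fin expR_ge0.
  rewrite -(Radon_Nikodym_SigmaFinite.change_of_variables pmu phil0)// -/g.
  apply: ge0_le_integral => //.
  + by move=> x _; rewrite mule_ge0.
  + exact: emeasurable_funM.
  (* Where [g] is 0, [l] is the default value of [ln]; the factor [g x] removes it. *)
  move=> x _; have [->|gn0] := eqVneq (g x) 0%E; first by rewrite mule0.
  have gp : 0 < fine (g x) by rewrite fine_gt0// lt_def gn0 g0/= -ge0_fin_numE.
  rewrite -muleA -[X in (_ * (_ * X))%E]fineK// -EFinM expRN lnK ?posrE//.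
  by rewrite mulVf ?mule1// gt_eqF.
Qed.

Lemma KL_refl mu : KL mu mu = 0%E.
Proof.
have mumu : mu `<< mu by [].
rewrite /KL asboolT//.
pose f' := Radon_Nikodym (charge_of_finite_measure mu) mu.
have mf' : measurable_fun setT f'.
  exact: measurable_int
    (@Radon_Nikodym_integrable _ _ _ (charge_of_finite_measure mu) mu mumu).
rewrite (@ae_eq_integral _ _ _ mu setT (cst 0%E))//; first by rewrite integral0.
- apply/measurable_EFinP; apply: (measurableT_comp (@measurable_ln R)).
  exact: (measurableT_comp (fine_measurable measurableT) mf').
- have : ae_eq mu setT f' (cst 1%E).
    apply: integral_ae_eq => //; first exact: Radon_Nikodym_integrable.
    move=> E _ mE; rewrite -Radon_Nikodym_integral// integral_cst//= mul1e.
    by [].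
  by apply: filterS => x /(_ I) e _; rewrite -/(f' x) e /= ln1.
Qed.

Lemma coupling_law p q pi : coupling p q pi ->
  (forall A, measurable A -> p A = pi (fst @^-1` A)) /\
  (forall A, measurable A -> q A = pi (snd @^-1` A)).
Proof.
move=> [p1 p2]; split=> A mA.
- apply: (etrans (esym (p1 A mA))); congr (pi _).
  by apply/seteqP; split=> z //= [].
- apply: (etrans (esym (p2 A mA))); congr (pi _).
  by apply/seteqP; split=> z //= [].
Qed.

Lemma KL_pinfty_or_integrable p mu : KL p mu = +oo%E \/
  exists l : Rd R d -> R, [/\ p.-integrable setT (EFin \o l),
    KL p mu = (\int[p]_x l x)%:E &
    forall h : Rd R d -> R, measurable_fun setT h ->
      mu.-integrable setT (fun x => (expR (h x))%:E) ->
      p.-integrable setT (fun x => (expR (h x - l x))%:E) /\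
      \int[p]_x expR (h x - l x) <= \int[mu]_x expR (h x)].
Proof.
have [pmu|npmu] := pselect (p `<< mu); last by left; rewrite /KL asboolF.
have [l [ml KLE hl]] := KL_log_density pmu.
have hexp (h : Rd R d -> R) : measurable_fun setT h ->
    mu.-integrable setT (fun x => (expR (h x))%:E) ->
    p.-integrable setT (fun x => (expR (h x - l x))%:E) /\
    \int[p]_x expR (h x - l x) <= \int[mu]_x expR (h x).
  move=> mh /integrableP[meh ih].
  have e0 x : (0 <= (expR (h x))%:E)%E by rewrite lee_fin expR_ge0.
  have := hl _ meh e0.
  rewrite (eq_integral (fun x => (expR (h x - l x))%:E)); last first.
    by move=> x _; rewrite -EFinM -expRD.
  have eabs (m : {measure set _ -> \bar R}) (u : Rd R d -> R) :
      (\int[m]_x `|(expR (u x))%:E| = \int[m]_x (expR (u x))%:E)%E.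
    by apply: eq_integral => x _; rewrite gee0_abs// lee_fin expR_ge0.
  have mhl : measurable_fun setT (fun x => (expR (h x - l x))%:E).
    apply/measurable_EFinP; apply: (measurableT_comp (@measurable_expR R)).
    exact: measurable_funB.
  rewrite eabs in ih => le.
  have ihl : (\int[p]_x (expR (h x - l x))%:E < +oo)%E by exact: le_lt_trans ih.
  have Fge (m : {measure set _ -> \bar R}) (u : Rd R d -> R) :
      (0 <= \int[m]_x (expR (u x))%:E)%E.
    by apply: integral_ge0 => x _; rewrite lee_fin expR_ge0.
  split; first by apply/integrableP; split => //; rewrite eabs.
  by apply: fine_le => //; rewrite ge0_fin_numE.
(* The test function [h = 0] makes [exp (- l)] integrable under [p], and [- exp (- l) <= l] then
   controls the negative part of [l]. *)
have i1 : mu.-integrable setT (fun x => (expR (0 : R))%:E).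
  exact: finite_measure_integrable_cst.
have m0 : measurable_fun setT (fun _ : Rd R d => 0 : R) by [].
have [il _] := hexp _ m0 i1.
have [|il'|lo] := integrable_or_pinfty ml il.
- move=> x; have := expR_ge1Dx (0 - l x); lra.
- right; exists l; split => //.
  by rewrite KLE /Rintegral fineK//; exact: integrable_fin_num.
- by left; rewrite KLE.
Qed.

(* Weak duality: [f x + g y <= |x - y|^2] plays the role of a Kantorovich
   potential, and [log r >= h + 1 - exp h / r] linearizes each entropy. *)
Lemma unbalanced_weak_duality p q mu nu (c0 c1 : R) (f g : Rd R d -> R) :
  0 < c0 -> 0 < c1 -> measurable_fun setT f -> measurable_fun setT g ->
  (forall x y, f x + g y <= sqdist x y) ->
  mu.-integrable setT (fun x => (expR (- f x / c0))%:E) ->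
  nu.-integrable setT (fun x => (expR (- g x / c1))%:E) ->
  ((c0 * (1 - \int[mu]_x expR (- f x / c0))
    + c1 * (1 - \int[nu]_x expR (- g x / c1)))%:E
   <= W2sq p q + c0%:E * KL p mu + c1%:E * KL q nu)%E.
Proof.
move=> c00 c10 mf mg fg iF iG.
have W0 : (0 <= W2sq p q)%E.
  apply: le_ereal_inf_tmp => _ [pi _ <-]; apply: integral_ge0 => z _.
  by rewrite lee_fin sumr_ge0// => i _; rewrite sqr_ge0.
have Wn : W2sq p q != -oo%E by rewrite gt_eqF// (lt_le_trans _ W0).
have mf' : measurable_fun setT (fun x => - f x / c0).
  by apply: measurable_funM => //; exact: measurableT_comp.
have mg' : measurable_fun setT (fun x => - g x / c1).
  by apply: measurable_funM => //; exact: measurableT_comp.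
(* An infinite entropy makes the bound trivial, provided that none of the three terms is [-oo]. *)
have inf3 (w x y : \bar R) (r : R) : w != -oo%E -> x != -oo%E -> y != -oo%E ->
    x = +oo%E \/ y = +oo%E -> (r%:E <= w + x + y)%E.
  by case: w x y => [w| |] [x| |] [y| |] // _ _ _ []//; rewrite leey.
have [kp|[l [il kE hl]]] := KL_pinfty_or_integrable p mu.
  apply: inf3 => //; rewrite ?kp ?gt0_muley//; last by left.
  by have [->|[l' [_ -> _]]] := KL_pinfty_or_integrable q nu; rewrite ?gt0_muley.
have [kq|[l' [il' kE' hl']]] := KL_pinfty_or_integrable q nu.
  by apply: inf3 => //; rewrite ?kq ?kE ?gt0_muley//; right.
have {hl} [ie le] := hl _ mf' iF; have {hl'} [ie' le'] := hl' _ mg' iG.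
rewrite kE kE' -addeA -!EFinM -EFinD -leeBlDr// -EFinB.
apply: le_ereal_inf_tmp => _ [pi cpl <-].
have [law1 law2] := coupling_law cpl.
have [j e1] := integrable_law measurable_fst law1 il.
have [j' e1'] := integrable_law measurable_snd law2 il'.
have [k e2] := integrable_law measurable_fst law1 ie.
have [k' e2'] := integrable_law measurable_snd law2 ie'.
rewrite e1 e1'; rewrite e2 in le; rewrite e2' in le'.
have sd0 z : (0 <= (sqdist z.1 z.2 : R)%:E)%E.
  by rewrite lee_fin sumr_ge0// => i _; rewrite sqr_ge0.
have msd : measurable_fun setT (fun z : Rd R d * Rd R d => (sqdist z.1 z.2)%:E).
  apply/measurable_EFinP; apply: measurable_sum => i.
  apply: measurable_funX; apply: measurable_funB.
  - exact: (measurableT_comp (measurable_tnth i) measurable_fst).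
  - exact: (measurableT_comp (measurable_tnth i) measurable_snd).
have [cfin|] := ltP (\int[pi]_z (sqdist z.1 z.2)%:E)%E +oo%E; last first.
  by rewrite leye_eq => /eqP ->; rewrite leey.
have isd : pi.-integrable setT (fun z => (sqdist z.1 z.2)%:E).
  apply/integrableP; split => //.
  by under eq_integral do rewrite gee0_abs//.
rewrite -[leRHS]fineK; last exact: integrable_fin_num.
rewrite lee_fin lerBlDr.
set L0 := \int[pi]_x l (fst x); set L1 := \int[pi]_x l' (snd x).
pose E0 (z : Rd R d * Rd R d) := expR (- f z.1 / c0 - l z.1).
pose E1 (z : Rd R d * Rd R d) := expR (- g z.2 / c1 - l' z.2).
have iEZ (c : R) (u : Rd R d * Rd R d -> R) : pi.-integrable setT (EFin \o u) ->
  pi.-integrable setT (EFin \o (fun z => c * u z)).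
  move=> iu; rewrite (_ : _ \o _ = (fun z => c%:E * (EFin \o u) z)%E).
    exact: integrableZl.
  by apply/funext => z; rewrite /= EFinM.
have iED (u v : Rd R d * Rd R d -> R) : pi.-integrable setT (EFin \o u) ->
  pi.-integrable setT (EFin \o v) -> pi.-integrable setT (EFin \o (fun z => u z + v z)).
  by move=> iu iv; exact: (integrableD measurableT iu iv).
have icst (c : R) : pi.-integrable setT (EFin \o (fun=> c)).
  exact: finite_measure_integrable_cst.
have pi1 : fine (pi setT) = 1 by rewrite probability_setT.
(* [1 + y <= exp y] at [y = - f / c0 - l], multiplied by [c0], reads [c0 - c0 * E0 <= f + c0 * l];
   likewise for [g]. Their sum meets [f + g <= sqdist] under the coupling. *)
have key : \int[pi]_z (c0 + c1 + (- c0) * E0 z + (- c1) * E1 z)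
   <= \int[pi]_z (sqdist z.1 z.2 + c0 * l z.1 + c1 * l' z.2).
  apply: le_Rintegral => //.
  - apply: (iED); last exact: (iEZ).
    by apply: (iED); [exact: (icst)|exact: (iEZ)].
  - apply: (iED); last exact: (iEZ).
    by apply: (iED) => //; exact: (iEZ).
  move=> z _; have := fg z.1 z.2.
  have h0 := expR_ge1Dx (- f z.1 / c0 - l z.1).
  have h1 := expR_ge1Dx (- g z.2 / c1 - l' z.2).
  have h0' : c0 * (1 + (- f z.1 / c0 - l z.1)) <= c0 * E0 z by rewrite ler_pM2l.
  have h1' : c1 * (1 + (- g z.2 / c1 - l' z.2)) <= c1 * E1 z by rewrite ler_pM2l.
  have e0 : c0 * (1 + (- f z.1 / c0 - l z.1)) = c0 - f z.1 - c0 * l z.1.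
    by field; rewrite gt_eqF.
  have e3 : c1 * (1 + (- g z.2 / c1 - l' z.2)) = c1 - g z.2 - c1 * l' z.2.
    by field; rewrite gt_eqF.
  rewrite e0 in h0'; rewrite e3 in h1'; lra.
move: key.
rewrite !(RintegralD measurableT); do ?
  [exact: (icst) | exact: (iEZ) | apply: (iED); [| exact: (iEZ)]; [] | exact: isd].
rewrite !RintegralZl// !Rintegral_cst// pi1 !mulr1.
move=> key; apply: (le_trans _ (le_trans key _)).
  have : c0 * \int[pi]_z E0 z <= c0 * \int[mu]_x expR (- f x / c0).
    by rewrite ler_pM2l.
  have : c1 * \int[pi]_z E1 z <= c1 * \int[nu]_x expR (- g x / c1).
    by rewrite ler_pM2l.
  by move: (\int[_]_z E0 z) (\int[_]_z E1 z) => x y; lra.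
by rewrite addrA.
Qed.

End Entropy.

(** * Gaussian moments and exponential integrals *)

Section GaussianMoments.
Variable R : realType.

(** A Taylor bound for both signs, whose remainder stays integrable under the Gaussian when [y]
    grows quadratically with a small constant. *)
Lemma expR_le_quadratic (y : R) : expR y <= 1 + y + y ^+ 2 * expR `|y|.
Proof.
have hp (u : R) : 1 - u <= expR (- u) by have := expR_ge1Dx (- u).
have [y0|y0] := leP 0 y.
  rewrite ger0_norm//; have e : expR (- y) * expR y = 1 by rewrite -expRD addNr expR0.
  have h1 : expR y - 1 <= y * expR y.
    by have := hp y; rewrite -(ler_pM2r (expR_gt0 y)) e; lra.
  have h2 : y * (expR y - 1) <= y * (y * expR y) by rewrite ler_wpM2l.
  by rewrite expr2 -mulrA; lra.
rewrite ltr0_norm//; set u := - y; have -> : y = - u by rewrite opprK.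
have u0 : 0 < u by rewrite oppr_gt0.
have e : expR (- u) * expR u = 1 by rewrite -expRD addNr expR0.
have h1 : u * expR (- u) <= 1 - expR (- u).
  by have := expR_ge1Dx u; rewrite -(ler_pM2l (expR_gt0 (- u))) e; lra.
have h2 : u * (1 - expR (- u)) <= u * u by rewrite ler_pM2l//; have := hp u; lra.
have h3 : u * u * 1 <= u * u * expR u.
  by rewrite ler_pM2l ?mulr_gt0//; have := expR_ge1Dx u; lra.
by rewrite sqrrN expr2; lra.
Qed.

Lemma expR_ge_sqr4 (x : R) : 0 <= x -> x ^+ 2 / 4 <= expR x.
Proof.
move=> x0; have h : 1 + x / 2 <= expR (x / 2) by exact: expR_ge1Dx.
have -> : expR x = expR (x / 2) * expR (x / 2) by rewrite -expRD; congr expR; field.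
have : (1 + x / 2) * (1 + x / 2) <= expR (x / 2) * expR (x / 2).
  by apply: ler_pM => //; lra.
apply: le_trans; nra.
Qed.

Lemma Rintegral_sum d (T : measurableType d) (m : {measure set T -> \bar R})
    (I : Type) (s : seq I) (f : I -> T -> R) :
  (forall i, m.-integrable setT (EFin \o f i)) ->
  m.-integrable setT (EFin \o (fun x => \sum_(i <- s) f i x)) /\
  \int[m]_x (\sum_(i <- s) f i x) = \sum_(i <- s) \int[m]_x f i x.
Proof.
move=> fi; elim: s => [|i s [ih1 ih2]].
  rewrite big_nil (_ : (fun x => _) = fun=> 0); last first.
    by apply/funext => x; rewrite big_nil.
  split; first exact: integrable0.
  by rewrite /Rintegral integral0.
rewrite big_cons -ih2.
rewrite (_ : (fun x => _) = fun x => f i x + \sum_(i <- s) f i x); last first.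
  by apply/funext => x; rewrite big_cons.
split; last exact: RintegralD.
exact: (integrableD measurableT (fi i) ih1).
Qed.

Definition nrm2 d (z : Rd R d) : R := sqnorm (vec z).

Lemma nrm2E d (z : Rd R d) : nrm2 z = \sum_i (tnth z i : R) ^+ 2.
Proof. by rewrite /nrm2 sqnormE; apply: eq_bigr => i _; rewrite mxE. Qed.

Lemma nrm2_ge0 d (z : Rd R d) : 0 <= nrm2 z.
Proof. exact: sqnorm_ge0. Qed.

Lemma nrm2_cons d x (z : Rd R d) : nrm2 (cons_Rd (x, z)) = (x : R) ^+ 2 + nrm2 z.
Proof.
rewrite !nrm2E big_ord_recl tnth0; congr (_ + _).
by apply: eq_bigr => i _; rewrite tnthS.
Qed.

Lemma measurable_nrm2 d : measurable_fun setT (@nrm2 d).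
Proof.
rewrite (_ : @nrm2 d = fun z => \sum_i (tnth z i : R) ^+ 2); last first.
  by apply/funext => z; rewrite nrm2E.
apply: measurable_sum => i; apply: measurable_funX; exact: measurable_tnth.
Qed.

(** The rate 1/4 stays below the Gaussian rate 1/2 and splits into two factors of rate 1/8: one
    bounds [exp |h / c|] when [8 * K <= c], the other absorbs [h ^+ 2]. *)
Definition gwt d (z : Rd R d) : R := expR ((1 + nrm2 z) / 4).

Lemma measurable_gwt d : measurable_fun setT (@gwt d).
Proof.
apply: (measurableT_comp (@measurable_expR R)); apply: measurable_funM => //.
by apply: measurable_funD => //; exact: measurable_nrm2.
Qed.

Lemma integral_expR_nrm2 d :
  (\int[std_gauss R d]_z (expR (nrm2 z / 4))%:E = (Num.sqrt 2 ^+ d)%:E)%E.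
Proof.
elim: d => [|d ih].
  have -> : (fun z : Rd R 0 => (expR (nrm2 z / 4))%:E) = cst 1%E.
    by apply/funext => z; rewrite nrm2E big_ord0 mul0r expR0.
  by rewrite integral_cst//= mul1e; exact: (probability_setT (std_gauss R 0)).
have me k : measurable_fun setT (fun z : Rd R k => (expR (nrm2 z / 4))%:E).
  apply/measurable_EFinP; apply: (measurableT_comp (@measurable_expR R)).
  by apply: measurable_funM => //; exact: measurable_nrm2.
have e0 k (z : Rd R k) : (0 <= (expR (nrm2 z / 4))%:E)%E by rewrite lee_fin expR_ge0.
apply: (etrans (ge0_integral_std_gaussS (me d.+1) (@e0 d.+1))).
(* [sqrt 2] solves [(1 - t^-2) / 2 = 1 / 4], which matches the exponent of [N01_expR_sqr]. *)
pose t : R := Num.sqrt 2.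
have t0 : 0 < t by rewrite sqrtr_gt0.
have te (x : R) : (1 - t ^- 2) * x ^+ 2 / 2 = x ^+ 2 / 4.
  by rewrite sqr_sqrtr//; field.
transitivity (\int[@normal_prob R 0 1]_x
    ((t ^+ d)%:E * (expR ((1 - t ^- 2) * x ^+ 2 / 2))%:E))%E.
  apply: eq_integral => x _; rewrite -ih te muleC -ge0_integralZl; first last.
  - by rewrite lee_fin expR_ge0.
  - by move=> z _; exact: e0.
  - exact: me.
  - exact: measurableT.
  by apply: eq_integral => z _; rewrite nrm2_cons mulrDl expRD EFinM.
rewrite ge0_integralZl; first last.
- by rewrite lee_fin exprn_ge0// ltW.
- by move=> x _; rewrite lee_fin expR_ge0.
- apply/measurable_EFinP; apply: (measurableT_comp (@measurable_expR R)).
  by do 2 apply: measurable_funM => //.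
- exact: measurableT.
by rewrite N01_expR_sqr// -EFinM exprSr.
Qed.

Lemma integrable_gwt d : (std_gauss R d).-integrable setT (EFin \o @gwt d).
Proof.
apply/integrableP; split; first by apply/measurable_EFinP; exact: measurable_gwt.
rewrite (eq_integral (fun z => (expR 4^-1)%:E * (expR (nrm2 z / 4))%:E)%E).
  rewrite ge0_integralZl; first last.
  - by rewrite lee_fin expR_ge0.
  - by move=> z _; rewrite lee_fin expR_ge0.
  - apply/measurable_EFinP; apply: (measurableT_comp (@measurable_expR R)).
    by apply: measurable_funM => //; exact: measurable_nrm2.
  - exact: measurableT.
  by rewrite integral_expR_nrm2 -EFinM ltry.
move=> z _; rewrite gee0_abs ?lee_fin ?expR_ge0// -EFinM -expRD.
by congr (expR _)%:E; field.
Qed.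

Lemma Rintegral_std_gauss_cst d (a : R) : \int[std_gauss R d]_z a = a.
Proof.
rewrite Rintegral_cst// (_ : fine _ = 1) ?mulr1//.
by rewrite [X in fine X](probability_setT (std_gauss R d)).
Qed.

Definition gB d : R := \int[std_gauss R d]_z gwt z.

Lemma gB_ge0 d : 0 <= gB d.
Proof. by apply: Rintegral_ge0 => z _; exact: expR_ge0. Qed.

Lemma integrable_le_gwt d (f : Rd R d -> R) (K : R) : measurable_fun setT f ->
  (forall z, `|f z| <= K * gwt z) -> (std_gauss R d).-integrable setT (EFin \o f).
Proof.
move=> mf fK; apply: (@le_integrable _ _ _ _ _ measurableT _
  (fun z => K%:E * (EFin \o @gwt d) z)%E).
- exact/measurable_EFinP.
- move=> z _; rewrite /= lee_fin; apply: (le_trans (fK z)).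
  exact: ler_norm.
- by apply: integrableZl => //; exact: integrable_gwt.
Qed.

Lemma integrable_le_quadratic d (f : Rd R d -> R) (K : R) : 0 <= K ->
  measurable_fun setT f -> (forall z, `|f z| <= K * (1 + nrm2 z)) ->
  (std_gauss R d).-integrable setT (EFin \o f).
Proof.
move=> K0 mf fK; apply: (@integrable_le_gwt _ _ (K * 4)) => // z.
apply: (le_trans (fK z)); rewrite -mulrA ler_wpM2l//.
have := expR_ge1Dx ((1 + nrm2 z) / 4); rewrite -/(gwt z); have := nrm2_ge0 z; lra.
Qed.

(* The expansion [c (1 - E exp (- h / c)) = E h + O(1/c)], uniformly over the
   functions [h] of at most quadratic growth with constant [K]. *)
Lemma gauss_exp_estimate d (h : Rd R d -> R) (K c : R) : 0 <= K -> 0 < c ->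
  8 * K <= c -> measurable_fun setT h ->
  (forall z, `|h z| <= K * (1 + nrm2 z)) ->
  (std_gauss R d).-integrable setT (fun z => (expR (- h z / c))%:E) /\
  \int[std_gauss R d]_z h z - 256 * K ^+ 2 * gB d / c
    <= c * (1 - \int[std_gauss R d]_z expR (- h z / c)).
Proof.
move=> K0 c0 Kc mh hK.
have hc z : `|- h z / c| <= (1 + nrm2 z) / 8.
  rewrite normrM normrN [`|c^-1|]gtr0_norm ?invr_gt0// ler_pdivrMr//.
  apply: (le_trans (hK z)); have := nrm2_ge0 z; nra.
have e1 z : expR `|- h z / c| <= expR ((1 + nrm2 z) / 8) by rewrite ler_expR.
have mexp : measurable_fun setT (fun z => expR (- h z / c)).
  apply: (measurableT_comp (@measurable_expR R)); apply: measurable_funM => //.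
  exact: measurableT_comp.
have iexp : (std_gauss R d).-integrable setT (EFin \o (fun z => expR (- h z / c))).
  apply: (@integrable_le_gwt _ _ 1) => // z; rewrite mul1r ger0_norm ?expR_ge0//.
  rewrite ler_expR; have := hc z; have := ler_norm (- h z / c).
  by have := nrm2_ge0 z; lra.
split; first exact: iexp.
have ih := integrable_le_quadratic K0 mh hK.
pose C := 256 * K ^+ 2 / c.
have C0 : 0 <= C by rewrite !mulr_ge0 ?invr_ge0 ?sqr_ge0// ltW.
have pt z : h z - C * gwt z <= c - c * expR (- h z / c).
  have := expR_le_quadratic (- h z / c).
  rewrite -(ler_pM2l c0) => q.
  have e2 : c * (1 + - h z / c + (- h z / c) ^+ 2 * expR `|- h z / c|) =
    c - h z + h z ^+ 2 / c * expR `|- h z / c|.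
    by move: (expR _) => E; field; rewrite gt_eqF.
  rewrite e2 in q.
  have h2 : h z ^+ 2 <= K ^+ 2 * (1 + nrm2 z) ^+ 2.
    by rewrite -exprMn -real_normK ?num_real// lerXn2r ?nnegrE ?mulr_ge0//
      addr_ge0// nrm2_ge0.
  (* [x ^+ 2 / 4 <= exp x] at [x = (1 + nrm2 z) / 8], whence [256 = 4 * 8 ^+ 2]. *)
  have q2 : (1 + nrm2 z) ^+ 2 <= 256 * expR ((1 + nrm2 z) / 8).
    have := @expR_ge_sqr4 ((1 + nrm2 z) / 8) _; rewrite exprMn => /(_ _).
    have := nrm2_ge0 z; move: (expR _) => ? ? /(_ ltac:(lra)); lra.
  have gE : gwt z = expR ((1 + nrm2 z) / 8) * expR ((1 + nrm2 z) / 8).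
    by rewrite -expRD; congr expR; field.
  have e0 : 0 < expR ((1 + nrm2 z) / 8) := expR_gt0 _.
  have bd : h z ^+ 2 / c * expR `|- h z / c| <= C * gwt z.
    rewrite gE mulrA; apply: ler_pM => //; rewrite ?expR_ge0//.
      by rewrite mulr_ge0 ?sqr_ge0// invr_ge0 ltW.
    have -> : C * expR ((1 + nrm2 z) / 8) = K ^+ 2 * (256 * expR ((1 + nrm2 z) / 8)) / c.
      by rewrite /C; ring.
    rewrite ler_pM2r ?invr_gt0//; apply: (le_trans h2).
    by rewrite ler_wpM2l// sqr_ge0.
  by lra.
have icst (a : R) : (std_gauss R d).-integrable setT (EFin \o (fun=> a)).
  exact: finite_measure_integrable_cst.
have iM (a : R) (u : Rd R d -> R) : (std_gauss R d).-integrable setT (EFin \o u) ->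
  (std_gauss R d).-integrable setT (EFin \o (fun z => a * u z)).
  move=> iu; rewrite (_ : _ \o _ = (fun z => a%:E * (EFin \o u) z)%E).
    exact: integrableZl.
  by apply/funext => z; rewrite /= EFinM.
have iB (u v : Rd R d -> R) : (std_gauss R d).-integrable setT (EFin \o u) ->
  (std_gauss R d).-integrable setT (EFin \o v) ->
  (std_gauss R d).-integrable setT (EFin \o (fun z => u z - v z)).
  by move=> iu iv; exact: (integrableB measurableT iu iv).
have ig := @integrable_gwt d.
have : \int[std_gauss R d]_z (h z - C * gwt z)
    <= \int[std_gauss R d]_z (c - c * expR (- h z / c)).
  apply: le_Rintegral => //.
  - by apply: (iB) => //; exact: (iM).
  - by apply: (iB); [exact: (icst)|exact: (iM)].
rewrite RintegralB//; last exact: (iM).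
rewrite RintegralB//; last exact: (iM).
rewrite !RintegralZl// Rintegral_std_gauss_cst mulrBr mulr1.
by rewrite /C /gB mulrAC.
Qed.

Lemma gauss_inv_law d (O : 'M[R]_d) : gauss_inv O -> forall A, measurable A ->
  std_gauss R d A = std_gauss R d (affine_Rd 0 O @^-1` A).
Proof.
move=> hO A mA.
have mI : measurable_fun setT (EFin \o (\1_A : Rd R d -> R)).
  by apply/measurable_EFinP; exact: measurable_indic.
have I0 z : (0 <= (EFin \o (\1_A : Rd R d -> R)) z)%E by rewrite lee_fin.
have m1 : measurable (affine_Rd 0 O @^-1` A).
  by rewrite -[X in measurable X]setTI; apply: measurable_affine.
have := hO _ mI I0; have := integral_indic (std_gauss R d) measurableT mA.
have := integral_indic (std_gauss R d) measurableT m1.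
by rewrite !setIT => <- <- ->.
Qed.

Lemma measurable_coord d (i : 'I_d) : measurable_fun setT (fun z : Rd R d => vec z i 0).
Proof.
rewrite (_ : (fun z => _) = fun z : Rd R d => tnth z i).
  exact: measurable_tnth.
by apply/funext => z; rewrite mxE.
Qed.

Lemma coord_bound d (z : Rd R d) i : vec z i 0 ^+ 2 <= nrm2 z.
Proof.
by rewrite /nrm2 sqnormE (bigD1 i)//= lerDl sumr_ge0// => j _; rewrite sqr_ge0.
Qed.

Lemma integrable_coord d (i : 'I_d) :
  (std_gauss R d).-integrable setT (EFin \o (fun z => vec z i 0)).
Proof.
apply: (@integrable_le_quadratic _ _ 1) => //; first exact: measurable_coord.
move=> z; rewrite mul1r; have := coord_bound z i.
by move: (vec z i 0) (nrm2 z) => x y h; rewrite ler_norml; apply/andP; split; nra.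
Qed.

Lemma integrable_coord2 d (i j : 'I_d) :
  (std_gauss R d).-integrable setT (EFin \o (fun z => vec z i 0 * vec z j 0)).
Proof.
apply: (@integrable_le_quadratic _ _ 1) => //.
  by apply: measurable_funM; exact: measurable_coord.
move=> z; rewrite mul1r; have := coord_bound z i; have := coord_bound z j.
move: (vec z i 0) (vec z j 0) (nrm2 z) => x y w h h'; rewrite ler_norml.
by apply/andP; split; nra.
Qed.

(** The reflection of coordinate [i] is orthogonal, so it preserves the integral while changing its
    sign. This covers the means and the off-diagonal covariances. *)
Lemma gauss_odd d (i : 'I_d) (f : Rd R d -> R) :
  (std_gauss R d).-integrable setT (EFin \o f) ->
  (forall z z', vec z' i 0 = - vec z i 0 ->
    (forall j, j != i -> vec z' j 0 = vec z j 0) -> f z' = - f z) ->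
  \int[std_gauss R d]_z f z = 0.
Proof.
move=> fi fodd.
pose O : 'M[R]_d := diag_mx (\row_j (if j == i then -1 else 1)).
have oO : orthomx O.
  rewrite /orthomx tr_diag_mx mulmx_diag -[1%:M]diag_const_mx; congr diag_mx.
  by apply/rowP => j; rewrite !mxE; case: ifP => _; rewrite ?mulrNN mulr1.
have [_ e] := integrable_law (measurable_affine 0 O)
  (gauss_inv_law (gauss_inv_orthomx oO)) fi.
have e2 : \int[std_gauss R d]_x f (affine_Rd 0 O x) = - \int[std_gauss R d]_x f x.
  rewrite -mulN1r -RintegralZl//; apply: eq_Rintegral => z _; rewrite mulN1r.
  apply: fodd => [|j ji]; rewrite vec_affine add0r mul_diag_mx !mxE.
    by rewrite eqxx mulN1r.
  by rewrite (negbTE ji) mul1r.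
by rewrite e2 in e; lra.
Qed.

Lemma gauss_coord d (i : 'I_d) : \int[std_gauss R d]_z vec z i 0 = 0.
Proof. by apply: (@gauss_odd _ i); [exact: integrable_coord|]. Qed.

Lemma gauss_coord_sqr d (i : 'I_d) :
  (\int[std_gauss R d]_z (vec z i 0 ^+ 2)%:E = 1)%E.
Proof.
elim: d i => [[]//|d ih] i.
have ms k (j : 'I_k) : measurable_fun setT (fun z : Rd R k => (vec z j 0 ^+ 2)%:E).
  by apply/measurable_EFinP; apply: measurable_funX; exact: measurable_coord.
have s0 k (j : 'I_k) (z : Rd R k) : (0 <= (vec z j 0 ^+ 2)%:E)%E.
  by rewrite lee_fin sqr_ge0.
apply: (etrans (ge0_integral_std_gaussS (ms _ i) (s0 _ i))).
have [j ->|->] := unliftP ord0 i.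
- transitivity (\int[@normal_prob R 0 1]_x (cst 1%E x))%E.
    apply: eq_integral => x _; rewrite /= -(ih j).
    by apply: eq_integral => z _; rewrite !mxE tnthS.
  by rewrite integral_cst//= mul1e; exact: (probability_setT (@normal_prob R 0 1)).
- rewrite -(N01_sqr R); apply: eq_integral => x _.
  transitivity (\int[std_gauss R d]_z (cst ((x : R) ^+ 2)%:E z))%E.
    by apply: eq_integral => z _; rewrite !mxE tnth0.
  rewrite integral_cst//= (_ : _ setT = 1%E) ?mule1//.
  exact: (probability_setT (std_gauss R d)).
Qed.

Lemma gauss_coord2 d (i j : 'I_d) :
  \int[std_gauss R d]_z (vec z i 0 * vec z j 0) = (i == j)%:R.
Proof.
have [->|ij] := eqVneq i j.
  rewrite /Rintegral -[RHS]/(fine 1%E) -(gauss_coord_sqr j); congr fine.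
apply: (@gauss_odd _ i); first exact: integrable_coord2.
by move=> z z' -> -> ; rewrite ?mulNr// eq_sym.
Qed.

Definition qpoly d (a : R) (b : 'cV[R]_d) (M : 'M[R]_d) (z : Rd R d) : R :=
  a + (b^T *m vec z) 0 0 + quad M (vec z).

Lemma gauss_qpoly d a (b : 'cV[R]_d) M :
  (std_gauss R d).-integrable setT (EFin \o qpoly a b M) /\
  \int[std_gauss R d]_z qpoly a b M z = a + \tr M.
Proof.
have iM (c : R) (u : Rd R d -> R) : (std_gauss R d).-integrable setT (EFin \o u) ->
  (std_gauss R d).-integrable setT (EFin \o (fun z => c * u z)).
  move=> iu; rewrite (_ : _ \o _ = (fun z => c%:E * (EFin \o u) z)%E).
    exact: integrableZl.
  by apply/funext => z; rewrite /= EFinM.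
have [i1 e1] := @Rintegral_sum _ _ (std_gauss R d) _ (index_enum 'I_d)
  (fun i z => b i 0 * vec z i 0) (fun i => iM _ _ (integrable_coord i)).
have [i2 e2] := @Rintegral_sum _ _ (std_gauss R d) _ (index_enum ('I_d * 'I_d)%type)
  (fun ij z => M ij.1 ij.2 * (vec z ij.1 0 * vec z ij.2 0))
  (fun ij => iM _ _ (integrable_coord2 ij.1 ij.2)).
have -> : qpoly a b M = fun z => (a + \sum_i b i 0 * vec z i 0) +
    \sum_ij M ij.1 ij.2 * (vec z ij.1 0 * vec z ij.2 0).
  apply/funext => z; rewrite /qpoly /quad; congr (_ + _ + _).
    by rewrite mxE; apply: eq_bigr => i _; rewrite mxE.
  rewrite mxE (eq_bigr (fun j => \sum_i M i j * (vec z i 0 * vec z j 0))).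
    by rewrite exchange_big pair_big.
  move=> j _; rewrite mxE mulr_suml; apply: eq_bigr => i _.
  by rewrite mxE; ring.
have i0 : (std_gauss R d).-integrable setT (EFin \o (fun=> a)).
  exact: finite_measure_integrable_cst.
have i01 : (std_gauss R d).-integrable setT
    (EFin \o (fun z => a + \sum_i b i 0 * vec z i 0)).
  exact: (integrableD measurableT i0 i1).
split; first exact: (integrableD measurableT i01 i2).
rewrite RintegralD// RintegralD// e1 e2 Rintegral_std_gauss_cst.
rewrite big1 ?addr0; last first.
  move=> i _; rewrite RintegralZl//; last exact: integrable_coord.
  by rewrite gauss_coord mulr0.
congr (_ + _); transitivity (\sum_i \sum_j M i j * (i == j)%:R).
  rewrite pair_big; apply: eq_bigr => -[i j] _ /=.
  by rewrite RintegralZl ?gauss_coord2//; exact: integrable_coord2.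
apply: eq_bigr => i _; rewrite (bigD1 i)//= big1 ?addr0 ?eqxx ?mulr1// => j ji.
by rewrite eq_sym (negbTE ji) mulr0.
Qed.

End GaussianMoments.

(** * Quadratic dual potentials and affine couplings *)

Section EntrywiseNorm.
Variable R : realType.

Definition dot d (u v : 'cV[R]_d) : R := (u^T *m v) 0 0.

Lemma dotC d (u v : 'cV[R]_d) : dot u v = dot v u.
Proof.
by rewrite /dot !mxE; apply: eq_bigr => i _; rewrite !mxE mulrC.
Qed.

Lemma dotZl d (c : R) (u v : 'cV[R]_d) : dot (c *: u) v = c * dot u v.
Proof. by rewrite /dot [(_ *: _)^T]linearZ -scalemxAl mxE. Qed.

Lemma dotDl d (u v w : 'cV[R]_d) : dot (u + v) w = dot u w + dot v w.
Proof. by rewrite /dot [(_ + _)^T]linearD mulmxDl mxE. Qed.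

Lemma dotDr d (u v w : 'cV[R]_d) : dot w (u + v) = dot w u + dot w v.
Proof. by rewrite /dot mulmxDr mxE. Qed.

Lemma dotNl d (u v : 'cV[R]_d) : dot (- u) v = - dot u v.
Proof. by rewrite -scaleN1r dotZl mulN1r. Qed.

Lemma dotNr d (u v : 'cV[R]_d) : dot v (- u) = - dot v u.
Proof. by rewrite dotC dotNl dotC. Qed.

Lemma dot_mulmx d (A : 'M[R]_d) (u v : 'cV[R]_d) : dot u (A *m v) = dot (A^T *m u) v.
Proof. by rewrite /dot trmx_mul trmxK mulmxA. Qed.

Lemma sqnormD d (u v : 'cV[R]_d) : sqnorm (u + v) = sqnorm u + 2 * dot u v + sqnorm v.
Proof.
rewrite -![sqnorm _]/(dot _ _) dotDl !dotDr [dot v u]dotC.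
ring.
Qed.

Lemma sqnormB d (u v : 'cV[R]_d) : sqnorm (u - v) = sqnorm u - 2 * dot u v + sqnorm v.
Proof.
rewrite sqnormD dotNr mulrN; congr (_ + _).
by rewrite /sqnorm [(- _)^T]linearN/= mulNmx mulmxN opprK.
Qed.

(** The entrywise l^1 norm serves for all constants: it is submultiplicative, invariant under
    transposition, and dominates traces and quadratic forms. *)
Definition mn1 m n (A : 'M[R]_(m, n)) : R := \sum_i \sum_j `|A i j|.

Lemma mn1_ge0 m n (A : 'M[R]_(m, n)) : 0 <= mn1 A.
Proof. by apply: sumr_ge0 => i _; apply: sumr_ge0. Qed.

Lemma mn1_tr m n (A : 'M[R]_(m, n)) : mn1 A^T = mn1 A.
Proof.
rewrite /mn1 exchange_big; apply: eq_bigr => i _; apply: eq_bigr => j _.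
by rewrite mxE.
Qed.

Lemma mn1N m n (A : 'M[R]_(m, n)) : mn1 (- A) = mn1 A.
Proof.
by apply: eq_bigr => i _; apply: eq_bigr => j _; rewrite mxE normrN.
Qed.

Lemma mn1D m n (A B : 'M[R]_(m, n)) : mn1 (A + B) <= mn1 A + mn1 B.
Proof.
rewrite /mn1 -big_split; apply: ler_sum => i _; rewrite -big_split.
by apply: ler_sum => j _; rewrite mxE ler_normD.
Qed.

Lemma mn1Z m n (c : R) (A : 'M[R]_(m, n)) : mn1 (c *: A) = `|c| * mn1 A.
Proof.
rewrite /mn1 mulr_sumr; apply: eq_bigr => i _; rewrite mulr_sumr.
by apply: eq_bigr => j _; rewrite mxE normrM.
Qed.

Lemma mn1M m n p (A : 'M[R]_(m, n)) (B : 'M[R]_(n, p)) :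
  mn1 (A *m B) <= mn1 A * mn1 B.
Proof.
rewrite {1 2}/mn1 mulr_suml; apply: ler_sum => i _.
apply: (@le_trans _ _ (\sum_j \sum_k `|A i k| * `|B k j|)).
  apply: ler_sum => j _; rewrite mxE; apply: (le_trans (ler_norm_sum _ _ _)).
  by apply: ler_sum => k _; rewrite normrM.
rewrite exchange_big /= mulr_suml; apply: ler_sum => k _; rewrite -mulr_sumr.
rewrite ler_wpM2l// /mn1 (bigD1 k)//= lerDl.
by apply: sumr_ge0 => l _; apply: sumr_ge0.
Qed.

Lemma mn1_trace n (A : 'M[R]_n) : `|\tr A| <= mn1 A.
Proof.
apply: (le_trans (ler_norm_sum _ _ _)); apply: ler_sum => i _.
by rewrite (bigD1 i)//= lerDl sumr_ge0.
Qed.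

Lemma coord_le_sqnorm d (v : 'cV[R]_d) i : v i 0 ^+ 2 <= sqnorm v.
Proof. by rewrite sqnormE (bigD1 i)//= lerDl sumr_ge0// => j _; rewrite sqr_ge0. Qed.

Lemma quad_le_mn1 d (M : 'M[R]_d) v : `|quad M v| <= mn1 M * sqnorm v.
Proof.
have -> : quad M v = \sum_i \sum_j M i j * (v i 0 * v j 0).
  rewrite /quad mxE exchange_big; apply: eq_bigr => j _.
  by rewrite mxE mulr_suml; apply: eq_bigr => i _; rewrite mxE; ring.
rewrite mulr_suml; apply: (le_trans (ler_norm_sum _ _ _)); apply: ler_sum => i _.
rewrite mulr_suml; apply: (le_trans (ler_norm_sum _ _ _)); apply: ler_sum => j _.
rewrite normrM ler_wpM2l//; have := coord_le_sqnorm v i; have := coord_le_sqnorm v j.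
move: (v i 0) (v j 0) (sqnorm v) => x y w h h'; rewrite ler_norml.
by apply/andP; split; nra.
Qed.

Lemma dot_le_mn1 d (b v : 'cV[R]_d) : `|(b^T *m v) 0 0| <= mn1 b * (1 + sqnorm v).
Proof.
rewrite mxE mulr_suml; apply: (le_trans (ler_norm_sum _ _ _)); apply: ler_sum => i _.
rewrite big_ord1 mxE normrM ler_wpM2l//; have := coord_le_sqnorm v i.
move: (v i 0) (sqnorm v) => x w h; rewrite ler_norml; apply/andP; split; nra.
Qed.

(** Growth constant of [qpoly a b M] relative to [1 + nrm2 z], the quantity that [K] bounds in the
    estimates below. *)
Definition qn d (a : R) (b : 'cV[R]_d) (M : 'M[R]_d) : R := `|a| + mn1 b + mn1 M.

Lemma qpoly_bound d a (b : 'cV[R]_d) M z :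
  `|qpoly a b M z| <= qn a b M * (1 + nrm2 z).
Proof.
have n0 := nrm2_ge0 z.
have h1 := dot_le_mn1 b (vec z); have h2 := quad_le_mn1 M (vec z).
rewrite /qpoly /qn; apply: (le_trans (ler_normD _ _)).
rewrite -/(nrm2 z) in h1 h2.
have h3 := ler_normD a ((b^T *m vec z) 0 0).
have a0 : 0 <= `|a| * nrm2 z by rewrite mulr_ge0.
have M0 := mn1_ge0 M.
have -> : (`|a| + mn1 b + mn1 M) * (1 + nrm2 z) =
  `|a| + `|a| * nrm2 z + mn1 b * (1 + nrm2 z) + mn1 M + mn1 M * nrm2 z by ring.
lra.
Qed.

Lemma measurable_qpoly d a (b : 'cV[R]_d) M : measurable_fun setT (qpoly a b M).
Proof.
by have [/measurable_int/measurable_EFinP] := gauss_qpoly a b M.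
Qed.

End EntrywiseNorm.

(** * Two-sided bounds on transport costs between Gaussians *)

Section TransportBounds.
Variables (R : realType) (d : nat).

Lemma sqdistE (x y : Rd R d) : sqdist x y = sqnorm (vec x - vec y).
Proof. by rewrite sqnormE; apply: eq_bigr => i _; rewrite !mxE. Qed.

Lemma measurable_vec_sub (c : 'cV[R]_d) i :
  measurable_fun setT (fun x : Rd R d => (vec x - c) i 0).
Proof.
rewrite (_ : (fun x => _) = fun x : Rd R d => vec x i 0 - c i 0).
  by apply: measurable_funB => //; exact: measurable_coord.
by apply/funext => x; rewrite !mxE.
Qed.

(** Centring at the mean [c] makes the pullback along [affine_Rd c L] a [qpoly] with the same
    constant term, whose linear part has Gaussian mean zero. *)
Definition cpoly (c : 'cV[R]_d) (a : R) (b : 'cV[R]_d) (M : 'M[R]_d)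
    (x : Rd R d) : R :=
  a + (b^T *m (vec x - c)) 0 0 + quad M (vec x - c).

Lemma cpoly_affine c a b M (L : 'M[R]_d) z :
  cpoly c a b M (affine_Rd c L z) = qpoly a (L^T *m b) (L^T *m M *m L) z.
Proof.
rewrite /cpoly /qpoly vec_affine (addrC c) addrK quad_mulmx.
by rewrite trmx_mul trmxK mulmxA.
Qed.

Lemma measurable_cpoly c a b M : measurable_fun setT (cpoly c a b M).
Proof.
rewrite (_ : cpoly c a b M = fun x : Rd R d => a + \sum_i b i 0 * (vec x - c) i 0
    + \sum_i \sum_j M i j * ((vec x - c) i 0 * (vec x - c) j 0)).
  apply: measurable_funD; first apply: measurable_funD => //.
    apply: measurable_sum => i; apply: measurable_funM => //.
    exact: measurable_vec_sub.
  apply: measurable_sum => i; apply: measurable_sum => j.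
  by apply: measurable_funM => //; apply: measurable_funM; exact: measurable_vec_sub.
apply/funext => x; rewrite /cpoly /quad; congr (_ + _ + _).
  by rewrite mxE; apply: eq_bigr => i _; rewrite mxE.
rewrite mxE exchange_big; apply: eq_bigr => j _.
by rewrite mxE mulr_suml; apply: eq_bigr => i _; rewrite mxE; ring.
Qed.

Lemma gauss_exp_cpoly (nu : 'cV[R]_d * 'M[R]_d) a b M (K c : R) :
  let L := sqrtmx nu.2 in
  posdef nu.2 -> 0 < c -> 8 * K <= c ->
  qn a (L^T *m b) (L^T *m M *m L) <= K ->
  (gauss nu).-integrable setT (fun x => (expR (- cpoly nu.1 a b M x / c))%:E) /\
  a + \tr (M *m nu.2) - 256 * K ^+ 2 * gB R d / c <=
    c * (1 - \int[gauss nu]_x expR (- cpoly nu.1 a b M x / c)).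
Proof.
move=> L pS c0 Kc qK.
have K0 : 0 <= K by apply: le_trans qK; rewrite !addr_ge0// mn1_ge0.
have mex : measurable_fun setT (fun x => expR (- cpoly nu.1 a b M x / c)).
  apply: (measurableT_comp (@measurable_expR R)); apply: measurable_funM => //.
  by apply: measurableT_comp => //; exact: measurable_cpoly.
have hK z : `|qpoly a (L^T *m b) (L^T *m M *m L) z| <= K * (1 + nrm2 z).
  apply: (le_trans (qpoly_bound _ _ _ _)); rewrite ler_wpM2r// addr_ge0//.
  exact: nrm2_ge0.
have [ie le] := gauss_exp_estimate K0 c0 Kc (measurable_qpoly _ _ _) hK.
have [_ Eq] := gauss_qpoly a (L^T *m b) (L^T *m M *m L).
have [[sL _] LL] := sqrtmxP pS.
have trE : \tr (L^T *m M *m L) = \tr (M *m nu.2).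
  by rewrite -mulmxA mxtrace_mulC -mulmxA sL LL.
rewrite {}Eq {}trE in le.
have comp : (fun x => (expR (- cpoly nu.1 a b M x / c))%:E) \o affine_Rd nu.1 L =
    (fun z => (expR (- qpoly a (L^T *m b) (L^T *m M *m L) z / c))%:E).
  by apply/funext => z /=; rewrite cpoly_affine.
have ie' : (std_gauss R d).-integrable (affine_Rd nu.1 L @^-1` setT)
    ((fun x => (expR (- cpoly nu.1 a b M x / c))%:E) \o affine_Rd nu.1 L).
  by rewrite preimage_setT comp.
have mex' : measurable_fun setT (fun x => (expR (- cpoly nu.1 a b M x / c))%:E).
  exact/measurable_EFinP.
split; first exact: (integrable_pushforward (measurable_affine _ _) mex' ie').
apply: (le_trans le); rewrite ler_pM2l// lerD2l lerN2 le_eqVlt; apply/orP; left.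
apply/eqP; congr fine.
have := integral_pushforward (measurable_affine nu.1 L) mex' ie' measurableT.
by rewrite preimage_setT comp.
Qed.

Variables (n : nat) (tau0 tau1 : R) (mu : 'I_n -> 'cV[R]_d * 'M[R]_d).

(** The potentials are written in the displacements [u], [v] from the two means, so that their
    expectations reduce to constants and traces; [K] bounds their growth in standard coordinates. *)
Lemma Acost_ge_quad (k : R) i nu a0 (b0 : 'cV[R]_d) M0 a1 (b1 : 'cV[R]_d) M1 K :
  let L0 := sqrtmx (mu i).2 in let L := sqrtmx nu.2 in
  0 < k * tau0 -> 0 < k * tau1 -> 8 * K <= k * tau0 -> 8 * K <= k * tau1 ->
  posdef (mu i).2 -> posdef nu.2 ->
  qn a0 (L0^T *m b0) (L0^T *m M0 *m L0) <= K ->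
  qn a1 (L^T *m b1) (L^T *m M1 *m L) <= K ->
  (forall u v : 'cV[R]_d, a0 + (b0^T *m u) 0 0 + quad M0 u
     + (a1 + (b1^T *m v) 0 0 + quad M1 v) <= sqnorm ((mu i).1 - nu.1 + u - v)) ->
  ((a0 + \tr (M0 *m (mu i).2) + (a1 + \tr (M1 *m nu.2))
    - 256 * K ^+ 2 * gB R d * ((k * tau0)^-1 + (k * tau1)^-1))%:E
   <= Acost tau0 tau1 mu k i nu)%E.
Proof.
move=> L0 L c0 c1 Kc0 Kc1 pS0 pS q0 q1 fg.
have [i0 l0] := gauss_exp_cpoly pS0 c0 Kc0 q0.
have [i1 l1] := gauss_exp_cpoly pS c1 Kc1 q1.
apply: le_ereal_inf_tmp => _ [[p q] _ <-] /=.
have fg' x y : cpoly (mu i).1 a0 b0 M0 x + cpoly nu.1 a1 b1 M1 y <= sqdist x y.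
  have := fg (vec x - (mu i).1) (vec y - nu.1); rewrite sqdistE.
  rewrite (_ : (mu i).1 - nu.1 + (vec x - (mu i).1) - (vec y - nu.1) = vec x - vec y)//.
  by apply/colP => j; rewrite !mxE; ring.
apply: le_trans (unbalanced_weak_duality p q c0 c1 (measurable_cpoly _ _ _ _)
  (measurable_cpoly _ _ _ _) fg' i0 i1).
by rewrite lee_fin; apply: le_trans (lerD l0 l1); rewrite mulrDr; lra.
Qed.

(** Zero potentials have growth constant 0, so the dual bound has no error term. *)
Lemma Acost_ge0 (k : R) i nu : 0 < k * tau0 -> 0 < k * tau1 ->
  posdef (mu i).2 -> posdef nu.2 -> (0 <= Acost tau0 tau1 mu k i nu)%E.
Proof.
move=> c0 c1 pS0 pS.
have q0 (L : 'M[R]_d) : qn 0 (L^T *m 0) (L^T *m 0 *m L) <= 0 :> R.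
  have mn0 m' n' : mn1 (0 : 'M[R]_(m', n')) = 0.
    by apply: big1 => j _; apply: big1 => l _; rewrite mxE normr0.
  by rewrite /qn !mulmx0 mul0mx !mn0 normr0 !addr0.
have := @Acost_ge_quad k i nu 0 0 0 0 0 0 0 c0 c1.
rewrite !mulr0 (ltW c0) (ltW c1) => /(_ isT isT pS0 pS (q0 _) (q0 _)).
rewrite expr0n /= mulr0 !mul0r subr0 !mul0mx mxtrace0 !addr0; apply => u v.
by rewrite /quad !trmx0 !mulmx0 !mul0mx !mxE !addr0 sqnorm_ge0.
Qed.

Definition affine_pair (m0 : 'cV[R]_d) A0 m1 A1 (z : Rd R d) : Rd R d * Rd R d :=
  (affine_Rd m0 A0 z, affine_Rd m1 A1 z).

Lemma measurable_affine_pair m0 A0 m1 A1 :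
  measurable_fun setT (affine_pair m0 A0 m1 A1).
Proof. by apply: measurable_fun_pair; exact: measurable_affine. Qed.

HB.instance Definition _ m0 A0 m1 A1 :=
  isMeasurableFun.Build _ _ _ _ (affine_pair m0 A0 m1 A1)
    (measurable_affine_pair m0 A0 m1 A1).

Lemma gauss_law (m : 'cV[R]_d) (S A : 'M[R]_d) : posdef S -> A *m A^T = S ->
  forall B, measurable B ->
  gauss (m, S) B = std_gauss R d (affine_Rd m A @^-1` B).
Proof.
move=> pS AS B mB.
have mI : measurable_fun setT (EFin \o (\1_B : Rd R d -> R)).
  by apply/measurable_EFinP; exact: measurable_indic.
have I0 z : (0 <= (EFin \o (\1_B : Rd R d -> R)) z)%E by rewrite lee_fin.
have m1 : measurable (affine_Rd m A @^-1` B).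
  by rewrite -[X in measurable X]setTI; apply: measurable_affine.
have := gauss_affine m pS AS mI I0.
have := integral_indic (gauss (m, S)) measurableT mB.
have := integral_indic (std_gauss R d) measurableT m1.
by rewrite !setIT => <- <- ->.
Qed.

(** One standard sample drives both marginals. The free choice of factors matters: with [A0 = P A1]
    the coupling is carried by the graph of an affine map with linear part [P]. *)
Lemma W2sq_gauss_le (m0 m1 : 'cV[R]_d) (S0 S1 A0 A1 : 'M[R]_d) :
  posdef S0 -> posdef S1 -> A0 *m A0^T = S0 -> A1 *m A1^T = S1 ->
  (W2sq (gauss (m0, S0)) (gauss (m1, S1)) <=
   (sqnorm (m0 - m1) + \tr ((A0 - A1) *m (A0 - A1)^T))%:E)%E.
Proof.
move=> pS0 pS1 e0 e1.
pose pi : probability (Rd R d * Rd R d)%type R :=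
  distribution (std_gauss R d) (affine_pair m0 A0 m1 A1).
apply: ge_ereal_inf; exists (\int[pi]_z (sqdist z.1 z.2)%:E)%E.
  exists pi => //; split=> B mB.
  - rewrite (gauss_law m0 pS0 e0 mB) /pi /distribution /pushforward /=.
    by congr (std_gauss R d _); apply/seteqP; split=> z //= [].
  - rewrite (gauss_law m1 pS1 e1 mB) /pi /distribution /pushforward /=.
    by congr (std_gauss R d _); apply/seteqP; split=> z //= [].
have msd : measurable_fun setT (fun z : Rd R d * Rd R d => (sqdist z.1 z.2)%:E).
  apply/measurable_EFinP; apply: measurable_sum => i.
  apply: measurable_funX; apply: measurable_funB.
  - exact: (measurableT_comp (measurable_tnth i) measurable_fst).
  - exact: (measurableT_comp (measurable_tnth i) measurable_snd).
rewrite ge0_integral_distribution//; last first.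
  by move=> z; rewrite lee_fin sumr_ge0// => i _; rewrite sqr_ge0.
pose B := A0 - A1; pose del := m0 - m1.
have [iq Eq] := gauss_qpoly (sqnorm del) (2 *: (B^T *m del)) (B^T *m B).
rewrite (eq_integral (EFin \o qpoly (sqnorm del) (2 *: (B^T *m del)) (B^T *m B))).
  rewrite -[leLHS]fineK; last exact: integrable_fin_num.
  by rewrite lee_fin [leLHS]Eq mxtrace_mulC.
move=> z _ /=; rewrite sqdistE !vec_affine; congr EFin.
rewrite (_ : m0 + _ - _ = del + B *m vec z); last first.
  by rewrite mulmxBl opprD addrACA.
by rewrite /qpoly quad_gram sqnormD dot_mulmx -dotZl.
Qed.

Lemma Acost_le_W2sq (k : R) i nu :
  (Acost tau0 tau1 mu k i nu <= W2sq (gauss (mu i)) (gauss nu))%E.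
Proof.
apply: ge_ereal_inf; eexists; first by exists (gauss (mu i), gauss nu).
by rewrite /= !KL_refl !mule0 !adde0.
Qed.

End TransportBounds.

(** * Quadratic forms in duality *)

Section MatrixDuality.
Variable R : realType.

Lemma quadDm d (A B : 'M[R]_d) v : quad (A + B) v = quad A v + quad B v.
Proof. by rewrite /quad mulmxDr mulmxDl mxE. Qed.

Lemma quadZm d (c : R) (A : 'M[R]_d) v : quad (c *: A) v = c * quad A v.
Proof. by rewrite /quad -scalemxAr -scalemxAl mxE. Qed.

Lemma quadNm d (A : 'M[R]_d) v : quad (- A) v = - quad A v.
Proof. by rewrite -scaleN1r quadZm mulN1r. Qed.

Lemma quad1 d (v : 'cV[R]_d) : quad 1%:M v = sqnorm v.
Proof. by rewrite /quad mulmx1. Qed.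

Lemma quad_dot d (A : 'M[R]_d) v : quad A v = dot v (A *m v).
Proof. by rewrite /quad /dot mulmxA. Qed.

Lemma quadB d (A : 'M[R]_d) u v : A^T = A ->
  quad A (u - v) = quad A u - 2 * dot (A *m u) v + quad A v.
Proof.
move=> sA; rewrite !quad_dot mulmxBr !(dotDl, dotDr, dotNl, dotNr).
rewrite [dot u (A *m v)]dot_mulmx sA [dot v (A *m u)]dotC; ring.
Qed.

Lemma quadZ d (A : 'M[R]_d) (c : R) v : quad A (c *: v) = c ^+ 2 * quad A v.
Proof.
by rewrite !quad_dot -scalemxAr dotZl dotC dotZl dotC mulrA expr2.
Qed.

Lemma posdef_quad_ge0 d (P : 'M[R]_d) v : posdef P -> 0 <= quad P v.
Proof.
move=> [_ pP]; have [->|/pP/ltW//] := eqVneq v 0.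
by rewrite /quad mulmx0 mxE.
Qed.

Lemma posdef_invmx_tr d (P : 'M[R]_d) : posdef P -> (invmx P)^T = invmx P.
Proof. by move=> [sP _]; rewrite trmx_inv sP. Qed.

(** Compactness of the sphere is avoided: if [L L = P], the form of [L^-2] at [L v] is [sqnorm v],
    while [sqnorm (L v) = quad P v]. Adding 1 to the norm keeps the constant positive. *)
Lemma posdef_sqnorm_le d (P : 'M[R]_d) : posdef P ->
  exists2 p : R, 0 < p & forall v, p * sqnorm v <= quad P v.
Proof.
move=> pP; have [L [[sL pL] LL]] := posdef_sqrt pP.
have uL := posdef_unit (conj sL pL).
pose N := invmx L *m invmx L.
exists (1 + mn1 N)^-1; first by rewrite invr_gt0 ltr_pwDl// mn1_ge0.
move=> v; have c0 : 0 < 1 + mn1 N by rewrite ltr_pwDl// mn1_ge0.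
rewrite mulrC ler_pdivrMr//.
have -> : quad P v = sqnorm (L *m v) by rewrite -LL -[X in X *m _]sL quad_gram.
have := quad_le_mn1 N (L *m v).
have -> : quad N (L *m v) = sqnorm v.
  rewrite /N -{1}sL -trmx_inv quad_gram mulKmx//.
have := sqnorm_ge0 (L *m v); have := ler_norm (sqnorm v); nra.
Qed.

(** [P = L^-1 (L S' L)^(1/2) L^-1] with [L = S^(1/2)]: the linear part of the Brenier map between
    Gaussians of covariances [S] and [S']. *)
Lemma optimal_map d (S S' : 'M[R]_d) : posdef S -> posdef S' ->
  exists2 P, posdef P & P *m S *m P = S'.
Proof.
move=> pS pS'; have [L [pL LL]] := posdef_sqrt pS.
have uL := posdef_unit pL; have sL := pL.1.
have uLi : invmx L \in unitmx by rewrite unitmx_inv.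
have sLi : (invmx L)^T = invmx L by rewrite trmx_inv sL.
have pM := posdef_congr uL pS'.
have [N [pN NN]] := posdef_sqrt pM.
exists (invmx L *m N *m invmx L); first by have := posdef_congr uLi pN; rewrite sLi.
rewrite -LL !mulmxA mulmxKV// -[_ *m L *m invmx L]mulmxA mulmxV// mulmx1.
rewrite -(mulmxA (invmx L) N N) NN sL !mulmxA mulVmx// mul1mx.
by rewrite -mulmxA mulmxV// mulmx1.
Qed.

(* [dual_mx P H e] replaces [(P + e H)^-1] by its second-order expansion at
   [e = 0], with a remainder large enough to dominate it. *)
Definition dual_mx d (P H : 'M[R]_d) (e : R) : 'M[R]_d :=
  invmx P - e *: (invmx P *m H *m invmx P)
  + (2 * e ^+ 2) *: (invmx P *m H *m invmx P *m H *m invmx P).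

(** With [u = P a], [v = a - w] and [y = P^-1 H a], the right side minus the left is
    [quad P (w - 2 e y) / 2] plus [quad P w / 2 + e * quad H w], both nonnegative. The factor 2 of
    the remainder in [dual_mx] pays for spending only half of [quad P w] on the square. *)
Lemma dual_mx_le d (P H : 'M[R]_d) (e : R) : posdef P -> H^T = H ->
  (forall v, `|e * quad H v| <= quad P v / 2) ->
  forall u v, 2 * dot u v <= quad (dual_mx P H e) u + quad (P + e *: H) v.
Proof.
move=> pP sH eH u v; have uP := posdef_unit pP; have sP := pP.1.
have sI := posdef_invmx_tr pP.
pose a := invmx P *m u; pose w := a - v; pose y := invmx P *m (H *m a).
have uE : u = P *m a by rewrite mulKVmx.
have Ha : H *m a = P *m y by rewrite mulKVmx.
have e1 : quad (invmx P) u = quad P a.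
  by rewrite -quad_mulmx sI mulVmx// mul1mx.
have e2 : quad (invmx P *m H *m invmx P) u = quad H a.
  by rewrite -quad_mulmx sI.
have e3 : quad (invmx P *m H *m invmx P *m H *m invmx P) u = quad P y.
  rewrite /y /a !mulmxA -quad_mulmx; congr quad.
  by rewrite !trmx_mul sI sH !mulmxA mulmxKV.
rewrite /dual_mx !quadDm quadNm !quadZm e1 e2 e3 uE.
have vE : v = a - w by rewrite opprB addrC subrK.
have Pw : quad P w = quad P a - 2 * dot (P *m a) v + quad P v by rewrite quadB.
have Hv : quad H v = quad H a - 2 * dot (P *m y) w + quad H w.
  by rewrite {1}vE quadB// Ha.
have := posdef_quad_ge0 (w - (2 * e) *: y) pP.
rewrite quadB// quadZ [dot _ (_ *: y)]dotC dotZl dot_mulmx sP.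
have := eH w; rewrite ler_norml => /andP[h _].
by rewrite Hv; lra.
Qed.

Lemma trace_dual_mx d (P H S : 'M[R]_d) (e : R) : posdef P ->
  \tr (dual_mx P H e *m (P *m S *m P)) =
  \tr (P *m S) - e * \tr (H *m S) + 2 * e ^+ 2 * \tr (H *m invmx P *m H *m S).
Proof.
move=> pP; have uP := posdef_unit pP.
rewrite /dual_mx !mulmxDl mulNmx -!scalemxAl !mxtraceD raddfN /= !mxtraceZ.
congr (_ - _ * _ + _ * _).
- by rewrite !mulmxA mulVmx// mul1mx mxtrace_mulC.
- by rewrite !mulmxA mulmxKV// mxtrace_mulC !mulmxA mulmxV// mul1mx.
- by rewrite !mulmxA mulmxKV// mxtrace_mulC !mulmxA mulmxV// mul1mx.
Qed.

(** Common form of two variances: [G = 1] on the mean vectors and [G = S0] on the maps [P i]. *)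
Definition tq m n (G : 'M[R]_n) (X : 'M[R]_(m, n)) : R := \tr (X *m G *m X^T).

Lemma tq_gram m n (L : 'M[R]_n) (X : 'M[R]_(m, n)) :
  tq (L *m L^T) X = \sum_i \sum_j (X *m L) i j ^+ 2.
Proof.
rewrite /tq mulmxA -mulmxA -trmx_mul; apply: eq_bigr => i _.
by rewrite mxE; apply: eq_bigr => j _; rewrite !mxE expr2.
Qed.

Lemma sqnorm_tq d (v : 'cV[R]_d) : sqnorm v = tq 1%:M v.
Proof. by rewrite /tq mulmx1 mxtrace_mulC [RHS]big_ord1. Qed.

(** Huygens' identity: the cross term pairs the constant [Xb - Y] with the weighted sum of the
    deviations from [Xb], which is zero. *)
Lemma tq_variance m n (I : finType) (w : I -> R) (G : 'M[R]_n)
    (X : I -> 'M[R]_(m, n)) (Y : 'M[R]_(m, n)) : \sum_i w i = 1 -> G^T = G ->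
  \sum_i w i * tq G (X i - Y) =
  \sum_i w i * tq G (X i - \sum_j w j *: X j) + tq G (\sum_j w j *: X j - Y).
Proof.
move=> w1 sG; set Xb := \sum_j w j *: X j.
have tqD A B : tq G (A + B) = tq G A + 2 * \tr (A *m G *m B^T) + tq G B.
  have sym : \tr (B *m G *m A^T) = \tr (A *m G *m B^T).
    by rewrite -[LHS]mxtrace_tr !trmx_mul trmxK sG mulmxA.
  rewrite /tq [(A + B)^T]linearD/= mulmxDl mulmxDr !mulmxDl !mxtraceD sym; ring.
pose B := Xb - Y.
have XY i : X i - Y = (X i - Xb) + B by rewrite addrA subrK.
rewrite (eq_bigr (fun i => w i * tq G (X i - Xb)
   + (2 * \tr ((w i *: (X i - Xb)) *m G *m B^T) + w i * tq G B))); last first.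
  by move=> i _; rewrite XY tqD -!scalemxAl mxtraceZ; ring.
rewrite !big_split /= -mulr_suml w1 mul1r -mulr_sumr; congr (_ + _).
rewrite -[in X in 2 * X]linear_sum /= -!mulmx_suml.
rewrite (eq_bigr (fun i => w i *: X i - w i *: Xb)); last first.
  by move=> i _; rewrite scalerBr.
by rewrite sumrB -scaler_suml w1 scale1r subrr !mul0mx mxtrace0 mulr0 add0r.
Qed.

End MatrixDuality.

(** * Bounds uniform in the penalty *)

Section UniformBounds.
Variables (R : realType) (d n : nat) (tau0 tau1 : R).
Variable mu : 'I_n -> 'cV[R]_d * 'M[R]_d.
Hypotheses (tau0_gt0 : 0 < tau0) (tau1_gt0 : 0 < tau1).
Hypothesis pmu : forall i, posdef (mu i).2.

Lemma mn1_le p q (A : 'M[R]_(p, q)) r : (forall i j, `|A i j| <= r) ->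
  mn1 A <= p%:R * q%:R * r.
Proof.
move=> Ar; apply: (@le_trans _ _ (\sum_(i < p) \sum_(j < q) r)).
  by apply: ler_sum => i _; apply: ler_sum.
by rewrite !sumr_const !card_ord -(mulr_natl r q) -(mulr_natl (_ * r) p) mulrA.
Qed.

Lemma trace_sqrtmx (S : 'M[R]_d) : posdef S ->
  \tr S = \sum_i \sum_j sqrtmx S i j ^+ 2.
Proof.
move=> pS; have [[sL _] LL] := sqrtmxP pS.
rewrite -[in LHS]LL; apply: eq_bigr => i _; rewrite mxE; apply: eq_bigr => j _.
by rewrite -[in X in _ * X]sL mxE expr2.
Qed.

Lemma posdef_trace_ge0 (S : 'M[R]_d) : posdef S -> 0 <= \tr S.
Proof.
move=> /trace_sqrtmx ->; apply: sumr_ge0 => i _; apply: sumr_ge0 => j _.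
exact: sqr_ge0.
Qed.

Lemma mn1_sqrtmx (S : 'M[R]_d) : posdef S ->
  mn1 (sqrtmx S) <= d%:R * d%:R * Num.sqrt (\tr S).
Proof.
move=> pS; apply: mn1_le => i j; rewrite -sqrtr_sqr ler_wsqrtr//.
rewrite trace_sqrtmx// (bigD1 i)//= (bigD1 j)//= -addrA lerDl addr_ge0//.
  by apply: sumr_ge0 => l _; exact: sqr_ge0.
by apply: sumr_ge0 => l _; apply: sumr_ge0 => l' _; exact: sqr_ge0.
Qed.

Lemma mn1_sqnorm (v : 'cV[R]_d) : mn1 v <= d%:R * Num.sqrt (sqnorm v).
Proof.
rewrite -[d%:R]mulr1; apply: mn1_le => i j; rewrite -sqrtr_sqr ler_wsqrtr//.
by rewrite [j]ord1 coord_le_sqnorm.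
Qed.

Let tinv := tau0^-1 + tau1^-1.

Let tinv_gt0 : 0 < tinv.
Proof. by rewrite addr_gt0 ?invr_gt0. Qed.

(** [C] and [k0] are fixed before [nu] and the potentials, which enter through the growth bound [K]
    only; this order of quantifiers lets the bound follow the moving minimizers. Beyond [k0] both
    [k * tau0] and [k * tau1] are at least [8 * K]. *)
Lemma Acost_ge_quad_unif (K : R) : 0 <= K -> exists C k0 : R,
  [/\ 0 <= C, 0 < k0 & forall k i nu a0 (b0 : 'cV[R]_d) M0 a1 (b1 : 'cV[R]_d) M1,
  let L0 := sqrtmx (mu i).2 in let L := sqrtmx nu.2 in
  k0 <= k -> posdef nu.2 ->
  qn a0 (L0^T *m b0) (L0^T *m M0 *m L0) <= K ->
  qn a1 (L^T *m b1) (L^T *m M1 *m L) <= K ->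
  (forall u v : 'cV[R]_d, a0 + dot b0 u + quad M0 u
     + (a1 + dot b1 v + quad M1 v) <= sqnorm ((mu i).1 - nu.1 + u - v)) ->
  ((a0 + \tr (M0 *m (mu i).2) + (a1 + \tr (M1 *m nu.2)) - C / k)%:E
   <= Acost tau0 tau1 mu k i nu)%E].
Proof.
move=> K0; exists (256 * K ^+ 2 * gB R d * tinv), (1 + 8 * K * tinv); split.
- apply: mulr_ge0; last exact: ltW.
  by apply: mulr_ge0; [apply: mulr_ge0 => //; exact: sqr_ge0|exact: gB_ge0].
- by rewrite ltr_pwDl// mulr_ge0 ?(ltW tinv_gt0)// mulr_ge0.
move=> k i nu a0 b0 M0 a1 b1 M1 L0 L kk pS q0 q1 fg.
have k0 : 0 < k.
  by apply: lt_le_trans kk; rewrite ltr_pwDl// mulr_ge0 ?(ltW tinv_gt0)// mulr_ge0.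
have K8 (t : R) : 0 < t -> t^-1 <= tinv -> 8 * K <= k * t.
  move=> t0 tt; rewrite -ler_pdivrMr//; apply: le_trans kk.
  apply: (@le_trans _ _ (8 * K * tinv)); first by rewrite ler_wpM2l// mulr_ge0.
  by rewrite lerDr.
have K80 : 8 * K <= k * tau0 by apply: K8 => //; rewrite lerDl invr_ge0 ltW.
have K81 : 8 * K <= k * tau1 by apply: K8 => //; rewrite lerDr invr_ge0 ltW.
apply: le_trans (Acost_ge_quad (mulr_gt0 k0 tau0_gt0) (mulr_gt0 k0 tau1_gt0)
  K80 K81 (pmu i) pS q0 q1 fg).
rewrite lee_fin lerD2l lerN2 [(k * tau0)^-1]invfM [(k * tau1)^-1]invfM.
by rewrite -mulrDr -/tinv mulrCA [k^-1 * _]mulrC.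
Qed.

(** In [sqnorm (del + u - v)] only [2 * dot u v] couples the variables. Bounding it by the forms [T]
    and [Q] leaves separate potentials with quadratic parts [1 - T], [1 - Q] and linear parts
    [2 del], [- 2 del]. *)
Lemma Acost_ge_dual (B : R) : 1 <= B -> exists C k0 : R,
  [/\ 0 <= C, 0 < k0 & forall k i nu T Q, k0 <= k -> posdef nu.2 ->
  sqnorm ((mu i).1 - nu.1) <= B -> mn1 ((mu i).1 - nu.1) <= B ->
  mn1 (sqrtmx (mu i).2) <= B -> mn1 (sqrtmx nu.2) <= B ->
  mn1 (1%:M - T) <= B -> mn1 (1%:M - Q) <= B ->
  (forall u v : 'cV[R]_d, 2 * dot u v <= quad T u + quad Q v) ->
  ((sqnorm ((mu i).1 - nu.1) + \tr ((1%:M - T) *m (mu i).2)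
    + \tr ((1%:M - Q) *m nu.2) - C / k)%:E <= Acost tau0 tau1 mu k i nu)%E].
Proof.
move=> B1; have B0 : 0 <= B by lra.
(* Both growth constants are at most [B + 2 B^2 + B^3], and [B >= 1]. *)
have [|C [k0 [C0 k00 H]]] := @Acost_ge_quad_unif (4 * B ^+ 3).
  by rewrite mulr_ge0// exprn_ge0.
exists C, k0; split => // k i nu T Q kk pS h1 h2 h3 h4 h5 h6 TQ.
set del := (mu i).1 - nu.1 in h1 h2 *.
have qb (a : R) (b : 'cV[R]_d) (M L : 'M[R]_d) : `|a| <= B -> mn1 b <= 2 * B ->
    mn1 M <= B -> mn1 L <= B -> qn a (L^T *m b) (L^T *m M *m L) <= 4 * B ^+ 3.
  move=> ha hb hM hL; rewrite /qn.
  have l0 := mn1_ge0 L.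
  have e1 : mn1 (L^T *m b) <= B * (2 * B).
    by apply: (le_trans (mn1M _ _)); rewrite mn1_tr ler_pM ?mn1_ge0.
  have e2 : mn1 (L^T *m M *m L) <= B * B * B.
    apply: (le_trans (mn1M _ _)); rewrite ler_pM ?mn1_ge0//.
    by apply: (le_trans (mn1M _ _)); rewrite mn1_tr ler_pM ?mn1_ge0.
  have B2 : B <= B * B by rewrite ler_peMr.
  have B3 : B * B <= B * B * B by rewrite ler_peMr// mulr_ge0.
  have -> : B ^+ 3 = B * B * B by ring.
  lra.
have := H k i nu (sqnorm del) (2 *: del) (1%:M - T) 0 (- (2 *: del)) (1%:M - Q) kk pS.
rewrite add0r; apply.
- by apply: qb => //; rewrite ?ger0_norm ?sqnorm_ge0// mn1Z ger0_norm// ler_pM2l.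
- by apply: qb => //; rewrite ?normr0// mn1N mn1Z ger0_norm// ler_pM2l.
move=> u v; rewrite -/del !quadDm !quadNm !quad1 sqnormB sqnormD.
rewrite dotNl !dotZl dotDl; have := TQ u v; lra.
Qed.

(** The potentials [- sqnorm u] and [(s / 2) sqnorm (del - v)] are admissible for [0 <= s <= 1],
    because [sqnorm (w + u) >= sqnorm w / 2 - sqnorm u]. As [nu] is arbitrary, [s] decreases like
    [r / N] to keep the growth below a constant fixed in advance; the price is the truncation at
    [r]. *)
Lemma Acost_ge_coercive (i : 'I_n) (r : R) : 0 < r -> exists C k0 : R,
  [/\ 0 <= C, 0 < k0 & forall k nu, k0 <= k -> posdef nu.2 ->
  ((- \tr (mu i).2 + Num.min (sqnorm ((mu i).1 - nu.1) + \tr nu.2) r / 2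
    - C / k)%:E <= Acost tau0 tau1 mu k i nu)%E].
Proof.
move=> r0; pose D : R := d%:R ^+ 3 + d%:R ^+ 4 + 1.
have D0 : 0 <= D by rewrite !addr_ge0// exprn_ge0.
pose K := mn1 (mu i).2 + D * r.
have [|C [k0 [C0 k00 H]]] := @Acost_ge_quad_unif K.
  by rewrite addr_ge0 ?mn1_ge0// mulr_ge0// ltW.
exists C, k0; split => // k nu kk pS.
set del := (mu i).1 - nu.1; pose N := sqnorm del + \tr nu.2.
have tS := posdef_trace_ge0 pS; have sd := sqnorm_ge0 del.
have N0 : 0 <= N by rewrite addr_ge0.
have [s [s0 s1 sN]] : exists s, [/\ 0 <= s, s <= 1 & s * N = Num.min N r].
  have [Nr|rN] := leP N r; first by exists 1; rewrite mul1r.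
  exists (r / N); split; first by rewrite divr_ge0// ltW.
    by rewrite ler_pdivrMr ?mul1r ?ltW// (lt_trans r0).
  by rewrite divfK// gt_eqF// (lt_trans r0).
rewrite -/N -sN.
have sNr : s * N <= r by rewrite sN ge_min lexx orbT.
have rt : Num.sqrt N ^+ 2 = N by rewrite sqr_sqrtr.
set q := Num.sqrt N in rt; have q0 : 0 <= q by exact: sqrtr_ge0.
have dl : mn1 del <= d%:R * q.
  apply: (le_trans (mn1_sqnorm _)); rewrite ler_wpM2l// ler_wsqrtr//.
  by rewrite /N lerDl.
have Ll : mn1 (sqrtmx nu.2) <= d%:R * d%:R * q.
  apply: (le_trans (mn1_sqrtmx pS)); rewrite ler_wpM2l ?mulr_ge0// ler_wsqrtr//.
  by rewrite /N lerDr.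
have [[sL _] LL] := sqrtmxP pS; have [[sL0 _] LL0] := sqrtmxP (pmu i).
have := H k i nu 0 0 (- 1%:M) (s / 2 * sqnorm del) (- (s *: del)) ((s / 2) *: 1%:M) kk pS.
rewrite add0r mulNmx mul1mx raddfN /= -scalemxAl mul1mx mxtraceZ.
have trN : \tr (- (mu i).2) = - \tr (mu i).2.
  by rewrite -scaleN1r mxtraceZ mulN1r.
rewrite -mulrDr -/N -[s * N / 2]mulrAC trN; apply.
- rewrite /qn normr0 mulmx0 add0r ?mulmxN mulNmx mulmx1 sL0 LL0 mn1N.
  rewrite (_ : mn1 0 = 0) ?add0r; first by rewrite lerDl mulr_ge0// ltW.
  by apply: big1 => j _; apply: big1 => l _; rewrite mxE normr0.
- rewrite /qn mulmxN mn1N -scalemxAr -scalemxAr -scalemxAl mulmx1 !mn1Z.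
  rewrite !ger0_norm ?mulr_ge0 ?divr_ge0// sL LL.
  have e1 : mn1 (sqrtmx nu.2 *m del) <= d%:R ^+ 3 * N.
    apply: (le_trans (mn1M _ _)).
    apply: (@le_trans _ _ ((d%:R * d%:R * q) * (d%:R * q))).
      by rewrite ler_pM ?mn1_ge0.
    by rewrite -rt le_eqVlt; apply/orP; left; apply/eqP; ring.
  have e2 : mn1 nu.2 <= d%:R ^+ 4 * N.
    rewrite -[X in mn1 X]LL; apply: (le_trans (mn1M _ _)).
    apply: (@le_trans _ _ ((d%:R * d%:R * q) * (d%:R * d%:R * q))).
      by rewrite ler_pM ?mn1_ge0.
    by rewrite -rt le_eqVlt; apply/orP; left; apply/eqP; ring.
  have e3 : s * mn1 (sqrtmx nu.2 *m del) <= d%:R ^+ 3 * (s * N).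
    by rewrite mulrCA ler_wpM2l.
  have e4 : s * mn1 nu.2 <= d%:R ^+ 4 * (s * N).
    by rewrite mulrCA ler_wpM2l.
  have e5 : s * sqnorm del <= s * N by rewrite ler_wpM2l// /N lerDl.
  have e6 : D * (s * N) <= D * r by rewrite ler_wpM2l.
  have e7 := mn1_ge0 (mu i).2.
  have e8 : 0 <= d%:R ^+ 4 * (s * N) by rewrite !mulr_ge0// exprn_ge0.
  have e9 : 0 <= s * N by rewrite mulr_ge0.
  rewrite /K /D in e6 *; lra.
move=> u v; rewrite -/del quadNm quad1 dotNl dotZl quadZm quad1.
have -> : dot (0 : 'cV[R]_d) u = 0 by rewrite /dot trmx0 mul0mx mxE.
pose w := del - v.
have -> : del + u - v = w + u by rewrite /w addrAC.
have wn : sqnorm w = sqnorm del - 2 * dot del v + sqnorm v by rewrite sqnormB.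
have := sqnorm_ge0 (w + 2 *: u); rewrite (sqnormD w (2 *: u)) (sqnormD w u) [dot w (2 *: u)]dotC dotZl.
have -> : sqnorm (2 *: u) = 4 * sqnorm u.
  by rewrite -[LHS]/(dot _ _) dotZl dotC dotZl mulrA; congr (_ * _); ring.
rewrite [dot u w]dotC => h.
have : s * sqnorm w <= sqnorm w by rewrite ler_piMl// sqnorm_ge0.
rewrite wn in h *; lra.
Qed.

End UniformBounds.

(** * The barycenter and its first-order condition *)

Section Barycenter.
Variables (R : realType) (d n : nat) (tau0 tau1 : R) (lambda a : 'I_n -> R).
Variables (mu : 'I_n -> 'cV[R]_d * 'M[R]_d) (nuBW : 'cV[R]_d * 'M[R]_d).
Hypotheses (n_gt0 : (0 < n)%N) (tau0_gt0 : 0 < tau0) (tau1_gt0 : 0 < tau1).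
Hypotheses (lambda_gt0 : forall i, 0 < lambda i) (a_gt0 : forall i, 0 < a i).
Hypothesis pmu : forall i, posdef (mu i).2.

Notation Z0 := (Z0 tau0 tau1 lambda a).
Notation w := (lamt tau0 tau1 lambda a).

Lemma Z0_gt0 : 0 < Z0.
Proof.
case: n n_gt0 lambda a lambda_gt0 a_gt0 => // n' _ l b l0 b0.
rewrite /Defs.Z0 big_ord_recl ltr_pwDl ?mulr_gt0 ?powR_gt0//.
by apply: sumr_ge0 => i _; rewrite mulr_ge0 ?powR_ge0// ltW.
Qed.

Lemma lamt_gt0 i : 0 < w i.
Proof. by rewrite /lamt divr_gt0 ?Z0_gt0// mulr_gt0 ?powR_gt0. Qed.

Lemma sum_lamt : \sum_i w i = 1.
Proof. by rewrite /lamt -mulr_suml divff// gt_eqF// Z0_gt0. Qed.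

Lemma le_of_le_subdiv (x y C k0 : R) : 0 <= C -> 0 < k0 ->
  (forall k, k0 <= k -> x - C / k <= y) -> x <= y.
Proof.
move=> C0 k00 h; apply/ler_addgt0Pr => e e0.
have Ce : 0 <= C / e by rewrite divr_ge0// ltW.
have kp : 0 < k0 + C / e by rewrite ltr_pwDl.
have := h (k0 + C / e); rewrite lerDl => /(_ Ce).
have : C / (k0 + C / e) <= e.
  by rewrite ler_pdivrMr// mulrDr [e * (C / e)]mulrC divfK ?gt_eqF// lerDr mulr_ge0// ltW.
lra.
Qed.

(** The lower half of Kantorovich duality follows from the entropic bound: [Acost] is below [W2sq]
    for every [k], and [C / k] vanishes in the limit. Since [nu] is fixed here, [B] may depend on
    it. *)
Lemma W2sq_gauss_ge i (nu : 'cV[R]_d * 'M[R]_d) T Q : posdef nu.2 ->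
  (forall u v : 'cV[R]_d, 2 * dot u v <= quad T u + quad Q v) ->
  ((sqnorm ((mu i).1 - nu.1) + \tr ((1%:M - T) *m (mu i).2)
    + \tr ((1%:M - Q) *m nu.2))%:E <= W2sq (gauss (mu i)) (gauss nu))%E.
Proof.
move=> pS TQ.
pose del := (mu i).1 - nu.1.
pose B := 1 + sqnorm del + mn1 del + mn1 (sqrtmx (mu i).2) + mn1 (sqrtmx nu.2)
  + mn1 (1%:M - T) + mn1 (1%:M - Q).
have g0 := (sqnorm_ge0 del, mn1_ge0 del, mn1_ge0 (sqrtmx (mu i).2),
  mn1_ge0 (sqrtmx nu.2), mn1_ge0 (1%:M - T), mn1_ge0 (1%:M - Q)).
case: g0 => -[[[[h1 h2] h3] h4] h5] h6.
have [|C [k0 [C0 k00 H]]] := @Acost_ge_dual R d n tau0 tau1 mu tau0_gt0 tau1_gt0 pmu B.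
  by rewrite /B; lra.
have {}H k : k0 <= k -> ((sqnorm del + \tr ((1%:M - T) *m (mu i).2)
    + \tr ((1%:M - Q) *m nu.2) - C / k)%:E <= W2sq (gauss (mu i)) (gauss nu))%E.
  move=> kk; apply: le_trans (Acost_le_W2sq tau0 tau1 mu k i nu).
  by apply: H => //; rewrite -/del /B; lra.
have := H; case: (W2sq _ _) => [x| |] {}H; last 2 first.
- by rewrite leey.
- by have := H k0 (lexx _).
by rewrite lee_fin; apply: (le_of_le_subdiv C0 k00) => k kk; rewrite -lee_fin; apply: H.
Qed.

Lemma bary_obj_le (nu : 'cV[R]_d * 'M[R]_d) (U : 'I_n -> R) :
  (forall i, (W2sq (gauss (mu i)) (gauss nu) <= (U i)%:E)%E) ->
  (bary_obj tau0 tau1 lambda a mu nu <= (\sum_i w i * U i)%:E)%E.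
Proof.
move=> hU; rewrite /bary_obj -sumEFin; apply: lee_sum => i _.
by rewrite (EFinM _ (U i)); apply: lee_wpmul2l => //; rewrite lee_fin ltW// lamt_gt0.
Qed.

Hypothesis BW : argmin (gaussians R d) (bary_obj tau0 tau1 lambda a mu) nuBW.

Let m0 := nuBW.1.
Let S0 := nuBW.2.

Let pS0 : posdef S0.
Proof. by case: BW. Qed.

Lemma optimal_maps : exists P : 'I_n -> 'M[R]_d,
  forall i, posdef (P i) /\ P i *m S0 *m P i = (mu i).2.
Proof.
have h i : exists P : 'M[R]_d, posdef P /\ P *m S0 *m P = (mu i).2.
  by have [P pP e] := optimal_map pS0 (pmu i); exists P.
by have [P hP] := choice h; exists P.
Qed.

Variable P : 'I_n -> 'M[R]_d.
Hypothesis pP : forall i, posdef (P i).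
Hypothesis PSP : forall i, P i *m S0 *m P i = (mu i).2.

(** The Bures formula for the Gaussian [W_2^2]; its cross term, the trace of
    [(S0^(1/2) Sigma_i S0^(1/2))^(1/2)], is written as [\tr (P i *m S0)]. *)
Definition bw_cost i : R := sqnorm ((mu i).1 - m0) + \tr (mu i).2 + \tr S0
  - 2 * \tr (P i *m S0).

Lemma bw_cost_tq i : bw_cost i = sqnorm ((mu i).1 - m0) + tq S0 (P i - 1%:M).
Proof.
rewrite /bw_cost /tq linearB/= trmx1 (pP i).1 mulmxBl mul1mx mulmxBr mulmx1.
rewrite mulmxBl PSP !raddfB/= [\tr (S0 *m _)]mxtrace_mulC; ring.
Qed.

(** The coupling with factors [P L] and [L] and the conjugate forms [P^-1], [P] yield the same
    value; the latter are [dual_mx_le] without perturbation. *)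
Lemma W2sq_bw i : W2sq (gauss (mu i)) (gauss nuBW) = (bw_cost i)%:E.
Proof.
have [L [pL LL]] := posdef_sqrt pS0; have sL := pL.1.
apply/eqP; rewrite eq_le; apply/andP; split.
- rewrite bw_cost_tq [mu i]surjective_pairing [nuBW]surjective_pairing /=.
  have := @W2sq_gauss_le _ _ (mu i).1 m0 (mu i).2 S0 (P i *m L) L (pmu i) pS0.
  rewrite trmx_mul sL (pP i).1 mulmxA -(mulmxA (P i)) LL PSP => /(_ erefl erefl).
  rewrite (_ : \tr _ = tq S0 (P i - 1%:M))//.
  have -> : P i *m L - L = (P i - 1%:M) *m L by rewrite mulmxBl mul1mx.
  by rewrite trmx_mul sL mulmxA -(mulmxA (_ - _)) LL.
- have z : forall v, `|0 * quad (0 : 'M[R]_d) v| <= quad (P i) v / 2.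
    by move=> v; rewrite mul0r normr0 divr_ge0// posdef_quad_ge0.
  have := W2sq_gauss_ge i pS0 (dual_mx_le (pP i) (trmx0 _ _ _) z).
  rewrite scale0r addr0; apply: le_trans; rewrite lee_fin /bw_cost.
  rewrite !mulmxBl !mul1mx !raddfB/= -[in X in \tr (dual_mx _ _ _ *m X)]PSP.
  rewrite trace_dual_mx// !mul0r expr0n /= mulr0 mul0r; lra.
Qed.

Lemma bary_obj_bw :
  bary_obj tau0 tau1 lambda a mu nuBW = (\sum_i w i * bw_cost i)%:E.
Proof.
by rewrite /bary_obj -sumEFin; apply: eq_bigr => i _; rewrite W2sq_bw -EFinM.
Qed.

(* The competitor with mean [sum w_i m_i] and covariance [Pb S0 Pb], where
   [Pb = sum w_i P_i], improves the cost by the variance of the [P_i]. *)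
Lemma bw_first_order :
  \sum_i w i *: P i = 1%:M /\ \sum_i w i *: (mu i).1 = m0.
Proof.
pose Pb := \sum_i w i *: P i; pose mb := \sum_i w i *: (mu i).1.
have pPb : posdef Pb by apply: posdef_sum => //; exact: lamt_gt0.
have pS1 : posdef (Pb *m S0 *m Pb).
  by have := posdef_congr (posdef_unit pPb) pS0; rewrite pPb.1.
have [L [pL LL]] := posdef_sqrt pS0; have sL := pL.1.
have up i : (W2sq (gauss (mu i)) (gauss (mb, Pb *m S0 *m Pb)) <=
    (sqnorm ((mu i).1 - mb) + tq S0 (P i - Pb))%:E)%E.
  rewrite [mu i]surjective_pairing /=.
  have := @W2sq_gauss_le _ _ (mu i).1 mb (mu i).2 _ (P i *m L) (Pb *m L) (pmu i) pS1.
  rewrite !trmx_mul sL (pP i).1 pPb.1 !mulmxA -(mulmxA (P i)) -(mulmxA Pb) LL PSP.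
  move=> /(_ erefl erefl); rewrite (_ : \tr _ = tq S0 (P i - Pb))//.
  have -> : P i *m L - Pb *m L = (P i - Pb) *m L by rewrite mulmxBl.
  by rewrite trmx_mul sL mulmxA -(mulmxA (_ - _)) LL.
have [_ /(_ (mb, Pb *m S0 *m Pb) pS1) opt] := BW.
have := le_trans opt (bary_obj_le up); rewrite bary_obj_bw lee_fin.
rewrite (eq_bigr (fun i => w i * tq 1%:M ((mu i).1 - m0) + w i * tq S0 (P i - 1%:M))).
  rewrite [X in _ <= X](eq_bigr (fun i => w i * tq 1%:M ((mu i).1 - mb)
      + w i * tq S0 (P i - Pb))).
    have v1 := @tq_variance R d 1 _ w 1%:M (fun i => (mu i).1) m0 sum_lamt (trmx1 _ _).
    have v2 := @tq_variance R d d _ w S0 P 1%:M sum_lamt pS0.1.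
    rewrite big_split [X in _ <= X]big_split /= v1 v2 -/mb -/Pb -sqnorm_tq => h.
    have t0 : 0 <= tq S0 (Pb - 1%:M).
      rewrite -LL -[in X in _ *m X]sL tq_gram.
      by apply: sumr_ge0 => i _; apply: sumr_ge0 => j _; exact: sqr_ge0.
    have s0 := sqnorm_ge0 (mb - m0).
    have sz : sqnorm (mb - m0) = 0 by lra.
    have tz : tq S0 (Pb - 1%:M) = 0 by lra.
    split; last by apply/eqP; rewrite -subr_eq0 -sqnorm_eq0 sz.
    apply/eqP; rewrite -subr_eq0 -/Pb.
    (* The vanishing trace is the sum of the squared entries of [(Pb - 1) L], and [L] is
       invertible. *)
    suff e : (Pb - 1%:M) *m L = 0 by rewrite -(mulmxK (posdef_unit pL) (_ - _)) e mul0mx.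
    move: tz; rewrite -LL -[in X in _ *m X]sL tq_gram => /eqP.
    rewrite psumr_eq0 => [/allP tz|i _]; last by apply: sumr_ge0 => j _; exact: sqr_ge0.
    apply/matrixP => i j; have := tz i (mem_index_enum i).
    rewrite psumr_eq0 => [/allP/(_ j (mem_index_enum j))|l _]; last exact: sqr_ge0.
    by rewrite sqrf_eq0 => /eqP ->; rewrite mxE.
  by move=> i _; rewrite sqnorm_tq mulrDr.
by move=> i _; rewrite bw_cost_tq sqnorm_tq mulrDr.
Qed.

(** The first-order conditions make the traces of [(1 - P_i) nu.2] cancel on average, so [nu.2]
    appears only in the term linear in [e], which becomes a square for [H = S0 - nu.2]. The means
    contribute by Huygens' identity. *)
Lemma perturbed_dual_value (nu : 'cV[R]_d * 'M[R]_d) (H : 'M[R]_d) (e : R) :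
  \sum_i w i * (sqnorm ((mu i).1 - nu.1)
    + \tr ((1%:M - dual_mx (P i) H e) *m (mu i).2)
    + \tr ((1%:M - (P i + e *: H)) *m nu.2)) =
  \sum_i w i * bw_cost i + sqnorm (m0 - nu.1) + e * \tr (H *m (S0 - nu.2))
  - 2 * e ^+ 2 * \sum_i w i * \tr (H *m invmx (P i) *m H *m S0).
Proof.
have [Pb mb] := bw_first_order.
have trB (A B : 'M[R]_d) : \tr (A - B) = \tr A - \tr B by rewrite raddfB.
have tE i : \tr ((1%:M - dual_mx (P i) H e) *m (mu i).2) = \tr (mu i).2
    - (\tr (P i *m S0) - e * \tr (H *m S0)
       + 2 * e ^+ 2 * \tr (H *m invmx (P i) *m H *m S0)).
  by rewrite mulmxBl mul1mx trB -{2}PSP trace_dual_mx.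
have qE i : \tr ((1%:M - (P i + e *: H)) *m nu.2) =
    \tr nu.2 - \tr (P i *m nu.2) - e * \tr (H *m nu.2).
  by rewrite mulmxBl mul1mx trB mulmxDl mxtraceD -scalemxAl mxtraceZ; ring.
have trP (S : 'M[R]_d) : \sum_i w i * \tr (P i *m S) = \tr S.
  rewrite -[in RHS](mul1mx S) -Pb mulmx_suml raddf_sum; apply: eq_bigr => i _.
  by rewrite -scalemxAl /= mxtraceZ.
have v1 Y := @tq_variance R d 1 _ w 1%:M (fun i => (mu i).1) Y sum_lamt (trmx1 _ _).
have vnu : \sum_i w i * sqnorm ((mu i).1 - nu.1) =
    \sum_i w i * sqnorm ((mu i).1 - m0) + sqnorm (m0 - nu.1).
  have vE Y : \sum_i w i * sqnorm ((mu i).1 - Y) = \sum_i w i * tq 1%:M ((mu i).1 - Y).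
    by apply: eq_bigr => i _; rewrite sqnorm_tq.
  by rewrite (vE nu.1) (vE m0) (v1 nu.1) mb -[X in _ + X]sqnorm_tq.
rewrite (eq_bigr (fun i => w i * sqnorm ((mu i).1 - nu.1) + (w i * \tr (mu i).2
   + (w i * (e * (\tr (H *m S0) - \tr (H *m nu.2)) + \tr nu.2)
   + (- (w i * \tr (P i *m S0)) + (- (w i * \tr (P i *m nu.2))
   - 2 * e ^+ 2 * (w i * \tr (H *m invmx (P i) *m H *m S0)))))))); last first.
  by move=> i _; rewrite tE qE; ring.
rewrite !big_split/= !sumrN -mulr_suml sum_lamt mul1r !trP -mulr_sumr vnu.
rewrite [in RHS](eq_bigr (fun i => w i * sqnorm ((mu i).1 - m0) + (w i * \tr (mu i).2
   + (w i * \tr S0 + - 2 * (w i * \tr (P i *m S0)))))); last first.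
  by move=> i _; rewrite /bw_cost; ring.
rewrite !big_split/= -mulr_suml sum_lamt mul1r -mulr_sumr trP mulmxBr trB; ring.
Qed.

(** * Energy expansion as the penalty grows *)

Lemma expRN_le_quadratic (x : R) : 0 <= x -> expR (- x) <= 1 - x + x ^+ 2.
Proof.
move=> x0; have e : expR (- x) * expR x = 1 by rewrite -expRD addNr expR0.
have h := expR_ge1Dx x; have p := expR_gt0 (- x).
have h1 : expR (- x) * (1 + x) <= 1 by rewrite -[leRHS]e ler_pM2l.
have x1 : 0 < 1 + x by lra.
rewrite -(ler_pM2r x1); apply: (le_trans h1).
have : 0 <= x ^+ 3 by rewrite exprn_ge0.
have -> : (1 - x + x ^+ 2) * (1 + x) = 1 + x ^+ 3 by ring.
lra.
Qed.

Lemma expRN_le_bound (x eta : R) : 0 <= x -> 1 - eta <= expR (- x) -> eta <= 1 / 2 ->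
  x <= 2 * eta.
Proof.
move=> x0 h e2; have e : expR (- x) * expR x = 1 by rewrite -expRD addNr expR0.
have h1 : (1 - eta) * (1 + x) <= 1.
  by rewrite -[leRHS]e; apply: ler_pM => //; [lra|lra|exact: expR_ge1Dx].
nra.
Qed.

Notation s := (sbar tau0 tau1).
Notation th := (theta tau0 tau1).

Lemma sbar_gt0 : 0 < s. Proof. by rewrite /sbar addr_gt0. Qed.

Lemma theta_gt0 : 0 < th. Proof. by rewrite /theta divr_gt0 ?sbar_gt0. Qed.

Lemma theta_le1 : th <= 1.
Proof. by rewrite /theta ler_pdivrMr ?sbar_gt0// mul1r /sbar lerDl ltW. Qed.

Definition acost k i nu : R := fine (Acost tau0 tau1 mu k i nu).

Lemma W2sq_gauss_fin i (nu : 'cV[R]_d * 'M[R]_d) : posdef nu.2 ->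
  (W2sq (gauss (mu i)) (gauss nu) < +oo)%E.
Proof.
move=> pS; have [[sL _] LL] := sqrtmxP pS; have [[sL' _] LL'] := sqrtmxP (pmu i).
rewrite [mu i]surjective_pairing [nu]surjective_pairing.
apply: le_lt_trans (@W2sq_gauss_le _ _ _ _ _ _ (sqrtmx (mu i).2) (sqrtmx nu.2)
  (pmu i) pS _ _) (ltry _); by rewrite ?sL ?sL'.
Qed.

Lemma acostE k i nu : 0 < k -> posdef nu.2 ->
  Acost tau0 tau1 mu k i nu = (acost k i nu)%:E /\ 0 <= acost k i nu.
Proof.
move=> k0 pS.
have A0 := Acost_ge0 (mulr_gt0 k0 tau0_gt0) (mulr_gt0 k0 tau1_gt0) (pmu i) pS.
have Ay := le_lt_trans (Acost_le_W2sq tau0 tau1 mu k i nu) (W2sq_gauss_fin i pS).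
split; last exact: fine_ge0.
by rewrite fineK// ge0_fin_numE.
Qed.

(** The ratio [Zk / Z0], in [[0, 1]] for positive [k]. Up to the factor [Z0^(1/theta)], [Phit] is
    [k tau0 (1 - yk^(1/theta))]: the divergent constants have cancelled. *)
Definition yk k nu : R := \sum_i w i * expR (- (acost k i nu / (k * s))).

Lemma yk_ge0 k nu : 0 <= yk k nu.
Proof. by apply: sumr_ge0 => i _; rewrite mulr_ge0 ?expR_ge0// ltW// lamt_gt0. Qed.

Lemma yk_le1 k nu : 0 < k -> posdef nu.2 -> yk k nu <= 1.
Proof.
move=> k0 pS; rewrite -sum_lamt; apply: ler_sum => i _.
apply: ler_piMr; first exact: ltW (lamt_gt0 i).
rewrite expR_le1 oppr_le0 divr_ge0//; first exact: (acostE i k0 pS).2.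
by apply: ltW; rewrite mulr_gt0// sbar_gt0.
Qed.

Lemma ZkE k nu : 0 < k -> posdef nu.2 -> Zk tau0 tau1 lambda a mu k nu = Z0 * yk k nu.
Proof.
move=> k0 pS; rewrite /Zk /yk mulr_sumr; apply: eq_bigr => i _.
have [-> _] := acostE i k0 pS.
rewrite /= mulrA /lamt [Z0 * _]mulrC divfK; last by rewrite gt_eqF// Z0_gt0.
by [].
Qed.

Lemma bkE k nu : 0 < k -> posdef nu.2 ->
  bk tau0 tau1 lambda a mu k nu = Z0 `^ th^-1 * yk k nu `^ th^-1.
Proof.
by move=> k0 pS; rewrite /bk ZkE// powRM ?yk_ge0// ltW// Z0_gt0.
Qed.

Lemma PhitE k nu : 0 < k -> posdef nu.2 -> Phit tau0 tau1 lambda a mu k nu =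
  Z0 `^ th^-1 * (k * tau0 * (1 - yk k nu `^ th^-1)).
Proof.
move=> k0 pS; rewrite /Phit /Phik -/(bk _ _ _ _ _ _ _) bkE//; ring.
Qed.

Let V := \sum_i w i * bw_cost i.

Lemma bw_cost_ge0 i : 0 <= bw_cost i.
Proof.
rewrite -lee_fin -W2sq_bw; apply: le_ereal_inf_tmp => _ [pi _ <-].
by apply: integral_ge0 => z _; rewrite lee_fin sumr_ge0// => j _; rewrite sqr_ge0.
Qed.

Lemma V_ge0 : 0 <= V.
Proof.
by apply: sumr_ge0 => i _; rewrite mulr_ge0 ?bw_cost_ge0// ltW// lamt_gt0.
Qed.

(* Jensen: [sum w_i exp (- x_i) >= exp (- sum w_i x_i)]. *)
Lemma yk_bw k : 0 < k -> expR (- (V / (k * s))) <= yk k nuBW.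
Proof.
move=> k0; have ks : 0 < k * s by rewrite mulr_gt0 ?sbar_gt0.
pose x i := bw_cost i / (k * s); pose X := V / (k * s).
have XE : X = \sum_i w i * x i.
  by rewrite /X /V mulr_suml; apply: eq_bigr => i _; rewrite mulrA.
apply: (@le_trans _ _ (\sum_i w i * expR (- x i))); last first.
  apply: ler_sum => i _; rewrite ler_pM2l ?lamt_gt0// ler_expR lerN2.
  rewrite ler_pM2r ?invr_gt0// -lee_fin -W2sq_bw -(acostE i k0 pS0).1.
  exact: Acost_le_W2sq.
apply: (@le_trans _ _ (\sum_i w i * (expR (- X) * (1 + (X - x i))))).
  rewrite (eq_bigr (fun i => expR (- X) * (w i * (1 + X) - w i * x i))); last first.
    by move=> i _; ring.
  rewrite -mulr_sumr sumrB -mulr_suml sum_lamt mul1r -XE.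
  by rewrite addrK mulr1.
apply: ler_sum => i _; rewrite ler_pM2l ?lamt_gt0//.
have -> : expR (- x i) = expR (- X) * expR (X - x i) by rewrite -expRD addKr.
by rewrite ler_pM2l ?expR_gt0// expR_ge1Dx.
Qed.

(** [sbar * theta = tau0]: the power [theta^-1] turns the rate [k * sbar] of the exponentials into
    the prefactor [k * tau0], so the limit acquires no extra constant. *)
Lemma sbar_theta k : 0 < k -> (k * s)^-1 * th^-1 = (k * tau0)^-1.
Proof.
move=> k0; rewrite /theta; have := sbar_gt0 => s0.
by field; rewrite !gt_eqF.
Qed.

(** Jensen's inequality and [1 - x <= exp (- x)] both err on the favourable side, so the bound holds
    at every [k] without error term. *)
Lemma Phit_bw_le k : 0 < k -> Phit tau0 tau1 lambda a mu k nuBW <= Z0 `^ th^-1 * V.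
Proof.
move=> k0; rewrite PhitE// ler_wpM2l ?powR_ge0//.
have kt : 0 < k * tau0 by rewrite mulr_gt0.
have : expR (- (V / (k * tau0))) <= yk k nuBW `^ th^-1.
  rewrite -(sbar_theta k0) mulrA -mulNr expRM.
  apply: ge0_ler_powR; rewrite ?nnegrE ?expR_ge0 ?yk_ge0//.
    by rewrite invr_ge0 ltW// theta_gt0.
  exact: yk_bw.
have := expR_ge1Dx (- (V / (k * tau0))).
move=> h1 h2; have h3 : 1 - yk k nuBW `^ th^-1 <= V / (k * tau0) by lra.
by rewrite mulrC -ler_pdivlMr.
Qed.

(** * Consequences of the optimality of [nu k] *)

Variable nu : R -> 'cV[R]_d * 'M[R]_d.
Hypothesis nu_argmin : forall k, 0 < k ->
  argmin (gaussians R d) (Phik tau0 tau1 lambda a mu k) (nu k).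

Let pnu k : 0 < k -> posdef (nu k).2.
Proof. by move=> /nu_argmin[]. Qed.

Lemma Phit_min_le k x : 0 < k -> posdef x.2 ->
  Phit tau0 tau1 lambda a mu k (nu k) <= Phit tau0 tau1 lambda a mu k x.
Proof. by move=> /nu_argmin[_ h] px; rewrite /Phit lerD2r; exact: h. Qed.

Lemma ykp_ge k : 0 < k -> 1 - V / (k * tau0) <= yk k (nu k) `^ th^-1.
Proof.
move=> k0; have kt : 0 < k * tau0 by rewrite mulr_gt0.
have := le_trans (Phit_min_le k0 pS0) (Phit_bw_le k0).
rewrite PhitE//; last exact: pnu.
rewrite ler_pM2l ?powR_gt0 ?Z0_gt0// mulrC -ler_pdivlMr// => h; lra.
Qed.

(** As [theta^-1 >= 1] and [yk] lies in []0, 1]], the power is at most [yk]; the condition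
    [V < k * tau0] excludes [yk = 0]. *)
Lemma yk_ge k : 0 < k -> V < k * tau0 -> 1 - V / (k * tau0) <= yk k (nu k).
Proof.
move=> k0 Vk; have kt : 0 < k * tau0 by rewrite mulr_gt0.
have h := ykp_ge k0; apply: (le_trans h).
have v1 : 0 < 1 - V / (k * tau0) by rewrite subr_gt0 ltr_pdivrMr// mul1r.
have yp : 0 < yk k (nu k).
  have := yk_ge0 k (nu k); rewrite le_eqVlt => /predU1P[y0|//].
  move: h; rewrite -y0 powR0; first lra.
  by rewrite invr_eq0 gt_eqF// theta_gt0.
apply: ge1r_powR; first by rewrite yp yk_le1//; exact: pnu.
by rewrite -[leLHS]invr1 lef_pV2 ?posrE ?theta_gt0// theta_le1.
Qed.

(** An explicit positive threshold makes every [k] concerned positive, so that inequalities are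
    checked pointwise; filters return at the passage to the limit. *)
Definition ev (Q : R -> Prop) := exists2 K : R, 0 < K & forall k, K <= k -> Q k.

Lemma ev_ge (K : R) : ev (fun k => K <= k).
Proof.
by exists (1 + `|K|); [rewrite ltr_pwDl|move=> k; have := ler_norm K; lra].
Qed.

Lemma evI (Q Q' : R -> Prop) : ev Q -> ev Q' -> ev (fun k => Q k /\ Q' k).
Proof.
move=> [K K0 h] [K' K0' h']; exists (K + K'); first by rewrite addr_gt0.
by move=> k kk; split; [apply: h|apply: h']; lra.
Qed.

Lemma ev_imp (Q Q' : R -> Prop) : (forall k, 0 < k -> Q k -> Q' k) -> ev Q -> ev Q'.
Proof.
move=> QQ [K K0 h]; exists K => // k kk; apply: QQ; last exact: h.
exact: lt_le_trans kk.
Qed.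

Lemma ev_forall (I : finType) (Q : I -> R -> Prop) :
  (forall i, ev (Q i)) -> ev (fun k => forall i, Q i k).
Proof.
move=> h; have h' i : exists K, 0 < K /\ forall k, K <= k -> Q i k.
  by have [K] := h i; exists K.
have [K hK] := choice h'; exists (1 + \sum_i K i).
  by rewrite ltr_pwDl// sumr_ge0// => i _; rewrite ltW// (hK i).1.
move=> k kk i; apply: (hK i).2; apply: le_trans kk.
rewrite (bigD1 i)//= addrCA lerDl addr_ge0// sumr_ge0// => j _.
by rewrite ltW// (hK j).1.
Qed.

Lemma ev_div_le (C e : R) : 0 < e -> ev (fun k => C / k <= e).
Proof.
move=> e0; apply: ev_imp (ev_ge (C / e)) => k k0.
by rewrite ler_pdivrMr// ler_pdivrMr// mulrC.
Qed.

(** Bounding the other exponentials by 1 isolates one term: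
    [w i * (1 - exp (- x)) <= V / (k * tau0)]. Hence [x] is of order [1/k], and the factor
    [k * sbar] gives a bound free of [k]. *)
Lemma acost_bounded : exists2 Am : R, 0 <= Am &
  ev (fun k => forall i, acost k i (nu k) <= Am).
Proof.
have s0 := sbar_gt0; have V0 := V_ge0.
pose b i := 2 * (V * s / (tau0 * w i)).
have b0 i : 0 <= b i.
  apply: mulr_ge0 => //; apply: divr_ge0; first by rewrite mulr_ge0// ltW.
  by rewrite ltW// mulr_gt0// lamt_gt0.
exists (\sum_i b i); first exact: sumr_ge0.
apply: ev_forall => i.
apply: ev_imp (evI (ev_ge ((V + 1) / tau0)) (ev_ge (2 * V / (tau0 * w i)))).
move=> k k0 []; have wi := lamt_gt0 i.
have tw : 0 < tau0 * w i := mulr_gt0 tau0_gt0 wi.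
rewrite ler_pdivrMr// => h1; rewrite ler_pdivrMr// => h2.
have Vk : V < k * tau0 by lra.
have kt : 0 < k * tau0 by rewrite mulr_gt0.
have := yk_ge k0 Vk; set x := acost k i (nu k) / (k * s) => hy.
have x0 : 0 <= x by rewrite divr_ge0 ?(acostE i k0 (pnu k0)).2// mulr_ge0// ltW.
have yle : yk k (nu k) <= 1 - w i * (1 - expR (- x)).
  have -> : 1 - w i * (1 - expR (- x)) = \sum_(j | j != i) w j + w i * expR (- x).
    have -> : \sum_(j | j != i) w j = 1 - w i.
      by rewrite -sum_lamt [in RHS](bigD1 i)//= addrC addrK.
    by ring.
  rewrite /yk (bigD1 i)//= addrC lerD2r; apply: ler_sum => j _.
  apply: ler_piMr; first exact: ltW (lamt_gt0 j).
  rewrite expR_le1 oppr_le0 divr_ge0//; first exact: (acostE j k0 (pnu k0)).2.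
  by apply: ltW; rewrite mulr_gt0.
pose eta := V / (k * tau0) / w i.
have e1 : 1 - eta <= expR (- x).
  rewrite lerBlDr -lerBlDl ler_pdivlMr// mulrC; lra.
have e2 : eta <= 1 / 2.
  by rewrite /eta ler_pdivrMr// ler_pdivrMr//; lra.
have := expRN_le_bound x0 e1 e2; rewrite /x ler_pdivrMr ?mulr_gt0// => h.
apply: (le_trans h); rewrite (bigD1 i)//= -[leLHS]addr0; apply: lerD; last exact: sumr_ge0.
rewrite /b /eta le_eqVlt; apply/orP; left; apply/eqP; field.
by rewrite !gt_eqF.
Qed.

Lemma cov_bounded : exists2 N : R, 0 <= N & ev (fun k => forall i,
  sqnorm ((mu i).1 - (nu k).1) + \tr (nu k).2 <= N).
Proof.
have [Am A0 evA] := acost_bounded.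
pose b i := 2 * (Am + \tr (mu i).2 + 1).
have b0 i : 0 <= b i by have := posdef_trace_ge0 (pmu i); rewrite /b; lra.
exists (\sum_i b i); first exact: sumr_ge0.
apply: ev_forall => i.
(* The truncation level exceeds [b i], so an active truncation would force a cost above [Am]. *)
have [|C [k0 [C0 k00 H]]] := Acost_ge_coercive tau0_gt0 tau1_gt0 pmu i (r := b i + 1).
  by rewrite ltr_wpDl.
apply: ev_imp (evI evA (evI (ev_ge k0) (ev_div_le C ltr01))) => k kp [hA [hk hC]].
have := H k (nu k) hk (pnu kp); rewrite (acostE i kp (pnu kp)).1 lee_fin.
set N := _ + \tr (nu k).2 => h; have := hA i => hi.
have le : N <= b i.
  move: h; have [Nb|bN] := leP N (b i + 1) => h; first by rewrite /b; lra.
  by rewrite /b in h *; lra.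
by apply: (le_trans le); rewrite (bigD1 i)//= lerDl sumr_ge0.
Qed.

Definition asum k := \sum_i w i * acost k i (nu k).

(** [exp (- x) <= 1 - x + x^2] termwise, then [1 - X + E2 <= exp (- (X - E2))]. Bounded costs make
    [E2] of order [k^-2], hence [1/k] after scaling by [k * sbar]. *)
Lemma ykp_le : exists2 D : R, 0 <= D & ev (fun k =>
  yk k (nu k) `^ th^-1 <= expR (- ((asum k - D / k) / (k * tau0)))).
Proof.
have [Am A0 evA] := acost_bounded; have s0 := sbar_gt0.
exists (Am ^+ 2 / s); first by rewrite divr_ge0 ?sqr_ge0// ltW.
apply: ev_imp evA => k k0 hA.
have kt : 0 < k * tau0 by rewrite mulr_gt0.
have ks : 0 < k * s by rewrite mulr_gt0.
pose x i := acost k i (nu k) / (k * s).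
have x0 i : 0 <= x i.
  by rewrite divr_ge0 ?(acostE i k0 (pnu k0)).2// ltW.
pose X := \sum_i w i * x i; pose E2 := \sum_i w i * x i ^+ 2.
have yle : yk k (nu k) <= 1 - X + E2.
  rewrite -sum_lamt -sumrB -big_split; apply: ler_sum => i _ /=.
  have -> : w i - w i * x i + w i * x i ^+ 2 = w i * (1 - x i + x i ^+ 2) by ring.
  rewrite ler_pM2l; last exact: lamt_gt0.
  exact: expRN_le_quadratic (x0 i).
have XE : asum k = k * s * X.
  rewrite /X mulr_sumr; apply: eq_bigr => i _; rewrite /x.
  by field; rewrite !gt_eqF.
have E2le : E2 <= Am ^+ 2 / (k * s) ^+ 2.
  rewrite -[leRHS]mul1r -sum_lamt mulr_suml; apply: ler_sum => i _.
  rewrite ler_pM2l ?lamt_gt0// /x exprMn exprVn ler_pM2r ?invr_gt0 ?exprn_gt0//.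
  by rewrite lerXn2r// ?nnegrE// (acostE i k0 (pnu k0)).2.
apply: (@le_trans _ _ (expR (- (X - E2) * th^-1))).
  rewrite expRM; apply: ge0_ler_powR; rewrite ?nnegrE ?expR_ge0 ?yk_ge0//.
    by rewrite invr_ge0 ltW// theta_gt0.
  apply: (le_trans yle); have := expR_ge1Dx (- (X - E2)); lra.
rewrite ler_expR mulNr lerN2 XE ler_pdivrMr//.
have -> : (X - E2) / th * (k * tau0) = k * s * X - k * s * E2.
  by rewrite /theta; field; rewrite !gt_eqF.
rewrite lerD2l lerN2.
have -> : Am ^+ 2 / s / k = k * s * (Am ^+ 2 / (k * s) ^+ 2).
  by field; rewrite !gt_eqF.
by rewrite ler_pM2l.
Qed.

(** The two bounds on the power of [yk] give [1 - v <= exp (- t)], hence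
    [t <= v / (1 - v) <= v + 2 v^2] for [v <= 1/2]; multiplication by [k * tau0] turns [v^2] into
    [O(1/k)]. *)
Lemma asum_le : exists2 C : R, 0 <= C & ev (fun k => asum k <= V + C / k).
Proof.
have [D D0 evD] := ykp_le; have V0 := V_ge0.
exists (2 * V ^+ 2 / tau0 + D).
  by rewrite addr_ge0// divr_ge0 ?mulr_ge0 ?sqr_ge0// ltW.
apply: ev_imp (evI evD (ev_ge (2 * V / tau0))) => k k0 [hy].
rewrite ler_pdivrMr// => hk.
have kt : 0 < k * tau0 by rewrite mulr_gt0.
pose v := V / (k * tau0); have v2 : v <= 1 / 2 by rewrite ler_pdivrMr//; lra.
have v0 : 0 <= v by rewrite divr_ge0// ltW.
set t := (_ / (k * tau0)) in hy.
have vt : 1 - v <= expR (- t) := le_trans (ykp_ge k0) hy.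
have tv : t <= v + 2 * v ^+ 2.
  have e : expR (- t) * expR t = 1 by rewrite -expRD addNr expR0.
  have [t1|t1] := leP (1 + t) 0; first by nra.
  have h1 : (1 - v) * (1 + t) <= 1.
    by rewrite -[leRHS]e; apply: ler_pM; [lra|lra|exact: vt|exact: expR_ge1Dx].
  have v3 : 0 < 1 - v by lra.
  rewrite -(ler_pM2l v3); nra.
rewrite /t ler_pdivrMr// in tv.
have e : (v + 2 * v ^+ 2) * (k * tau0) = V + 2 * V ^+ 2 / tau0 / k.
  by rewrite /v; field; rewrite !gt_eqF.
rewrite e in tv; rewrite mulrDl; lra.
Qed.

(** * Convergence *)

Lemma trace_sqr_ge (H : 'M[R]_d) i j : H^T = H -> H i j ^+ 2 <= \tr (H *m H).
Proof.
move=> sH; have -> : \tr (H *m H) = \sum_i \sum_j H i j ^+ 2.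
  apply: eq_bigr => l _; rewrite mxE; apply: eq_bigr => l' _.
  by rewrite -[in X in _ * X]sH mxE expr2.
rewrite (bigD1 i)//= (bigD1 j)//= -addrA lerDl addr_ge0//.
  by apply: sumr_ge0 => l _; exact: sqr_ge0.
by apply: sumr_ge0 => l _; apply: sumr_ge0 => l' _; exact: sqr_ge0.
Qed.

Lemma sqrt_le1D (x : R) : 0 <= x -> Num.sqrt x <= 1 + x.
Proof.
move=> x0; have := sqr_sqrtr x0; have := sqrtr_ge0 x.
by move: (Num.sqrt x) => y; nra.
Qed.

(* The potentials are perturbed in the direction [H = S0 - (nu k).2]; the linear
   gain [e * \tr (H *m H)] beats the [e ^+ 2] loss for small [e]. *)
Lemma asum_ge : exists C1 C2 e0 : R, [/\ 0 <= C1, 0 <= C2, 0 < e0 & ev (fun k =>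
  forall e, 0 <= e -> e <= e0 ->
  V + sqnorm (m0 - (nu k).1) + e * \tr ((S0 - (nu k).2) *m (S0 - (nu k).2))
    - C1 * e ^+ 2 - C2 / k <= asum k)].
Proof.
have [N N0 evN] := cov_bounded.
have hp i : exists p : R, 0 < p /\ forall v, p * sqnorm v <= quad (P i) v.
  by have [p] := posdef_sqnorm_le (pP i); exists p.
have [p /all_and2[p0 pq]] := choice hp.
pose lb := d%:R * d%:R * (1 + N); pose db := d%:R * (1 + N).
have lb0 : 0 <= lb by rewrite !mulr_ge0// addr_ge0.
have db0 : 0 <= db by rewrite !mulr_ge0// addr_ge0.
pose hb := 1 + mn1 S0 + lb * lb.
have hb1 : 1 <= hb.
  by rewrite /hb -addrA lerDl addr_ge0 ?mn1_ge0// mulr_ge0.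
have hb0 : 0 <= hb by lra.
pose I i := mn1 (invmx (P i)); have I0 i : 0 <= I i := mn1_ge0 _.
pose d1 := mn1 (1%:M : 'M[R]_d); have d10 : 0 <= d1 := mn1_ge0 _.
pose tb i := d1 + I i + I i * hb * I i + 2 * (I i * hb * I i * hb * I i).
pose qb i := d1 + mn1 (P i) + hb.
have tb0 i : 0 <= tb i by rewrite !addr_ge0// !mulr_ge0.
have qb0 i : 0 <= qb i.
  by apply: addr_ge0 => //; apply: addr_ge0 => //; exact: mn1_ge0.
pose l0 i := mn1 (sqrtmx (mu i).2); have l00 i : 0 <= l0 i := mn1_ge0 _.
(* [B] collects bounds on all that [Acost_ge_dual] measures, uniformly in large [k] and in [e <= 1];
   [hb] bounds the direction [H]. *)
pose B := 1 + N + db + lb + \sum_i (l0 i + tb i + qb i).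
have sum_ge i : l0 i + tb i + qb i <= \sum_i (l0 i + tb i + qb i).
  by rewrite (bigD1 i)//= lerDl sumr_ge0// => j _; apply: addr_ge0 => //; exact: addr_ge0.
have sum0 : 0 <= \sum_i (l0 i + tb i + qb i).
  by apply: sumr_ge0 => j _; apply: addr_ge0 => //; exact: addr_ge0.
have [|C [k0 [C0 k00 H]]] := Acost_ge_dual tau0_gt0 tau1_gt0 pmu (B := B).
  by rewrite /B; lra.
(* At most 1, and small enough for [e0 * hb <= p i / 2] for all [i], which yields the hypothesis of
   [dual_mx_le]. *)
pose e0 := (1 + \sum_i 2 * hb / p i)^-1.
have se0 : 0 <= \sum_i 2 * hb / p i.
  by apply: sumr_ge0 => i _; rewrite divr_ge0 ?mulr_ge0// ltW.
have e0p : 0 < e0 by rewrite invr_gt0 ltr_pwDl.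
have e01 : e0 <= 1 by rewrite invf_le1 ?lerDl// ltr_pwDl.
have e0hb i : e0 * hb <= p i / 2.
  rewrite mulrC ler_pdivrMr ?ltr_pwDl//.
  have : p i / 2 * (2 * hb / p i) <= p i / 2 * (1 + \sum_i 2 * hb / p i).
    rewrite ler_pM2l ?divr_gt0// (bigD1 i)//= addrCA lerDl addr_ge0//.
    by apply: sumr_ge0 => j _; rewrite divr_ge0 ?mulr_ge0// ltW.
  have -> : p i / 2 * (2 * hb / p i) = hb by field; rewrite gt_eqF.
  by [].
pose C1 := 2 * \sum_i w i * (hb * I i * hb * mn1 S0).
exists C1, C, e0; split => //.
  rewrite mulr_ge0// sumr_ge0// => i _; apply: mulr_ge0; first exact: ltW (lamt_gt0 i).
  by rewrite !mulr_ge0// mn1_ge0.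
apply: ev_imp (evI evN (ev_ge k0)) => k kp [hN hk] e ep ee.
have pk := pnu kp; set Hk := S0 - (nu k).2.
have sH : Hk^T = Hk by rewrite /Hk linearB/= pS0.1 pk.1.
have tN : \tr (nu k).2 <= N.
  have i0 : 'I_n := Ordinal n_gt0.
  by apply: le_trans (hN i0); rewrite lerDr sqnorm_ge0.
have dN i : sqnorm ((mu i).1 - (nu k).1) <= N.
  by apply: le_trans (hN i); rewrite lerDl posdef_trace_ge0.
have Lb : mn1 (sqrtmx (nu k).2) <= lb.
  apply: (le_trans (mn1_sqrtmx pk)); rewrite /lb ler_wpM2l ?mulr_ge0//.
  by apply: (le_trans (sqrt_le1D (posdef_trace_ge0 pk))); rewrite lerD2l.
have Hb : mn1 Hk <= hb.
  rewrite /Hk; apply: (le_trans (mn1D _ _)); rewrite mn1N /hb.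
  have : mn1 (nu k).2 <= lb * lb.
    rewrite -[X in mn1 X](sqrtmxP pk).2; apply: (le_trans (mn1M _ _)).
    by rewrite ler_pM ?mn1_ge0.
  lra.
have e1 : e <= 1 := le_trans ee e01.
have Pi1 i : mn1 (invmx (P i) *m Hk *m invmx (P i)) <= I i * hb * I i.
  apply: (le_trans (mn1M _ _)); rewrite ler_wpM2r ?mn1_ge0//.
  by apply: (le_trans (mn1M _ _)); rewrite ler_wpM2l ?mn1_ge0.
have Pi2 i : mn1 (invmx (P i) *m Hk *m invmx (P i) *m Hk *m invmx (P i)) <=
    I i * hb * I i * hb * I i.
  apply: (le_trans (mn1M _ _)); rewrite ler_wpM2r ?mn1_ge0//.
  apply: (le_trans (mn1M _ _)); rewrite ler_pM ?mn1_ge0//; exact: Pi1.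
have Tb i : mn1 (1%:M - dual_mx (P i) Hk e) <= tb i.
  rewrite /dual_mx; apply: (le_trans (mn1D _ _)); rewrite mn1N.
  have t1 := mn1D (invmx (P i) - e *: (invmx (P i) *m Hk *m invmx (P i)))
    ((2 * e ^+ 2) *: (invmx (P i) *m Hk *m invmx (P i) *m Hk *m invmx (P i))).
  have t2 := mn1D (invmx (P i)) (- (e *: (invmx (P i) *m Hk *m invmx (P i)))).
  rewrite mn1N mn1Z (ger0_norm ep) in t2.
  rewrite mn1Z ger0_norm in t1; last by rewrite mulr_ge0// sqr_ge0.
  have t3 : e * mn1 (invmx (P i) *m Hk *m invmx (P i)) <= I i * hb * I i.
    by rewrite -[leRHS]mul1r ler_pM ?mn1_ge0//; exact: Pi1.
  have t4 : 2 * e ^+ 2 * mn1 (invmx (P i) *m Hk *m invmx (P i) *m Hk *m invmx (P i))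
      <= 2 * (I i * hb * I i * hb * I i).
    rewrite -mulrA ler_pM2l// -[leRHS]mul1r; apply: ler_pM; last exact: Pi2.
    - exact: sqr_ge0.
    - exact: mn1_ge0.
    - by rewrite exprn_ile1.
  rewrite /tb -/d1 -/(I i); rewrite -/(I i) in t2; lra.
have Qb i : mn1 (1%:M - (P i + e *: Hk)) <= qb i.
  apply: (le_trans (mn1D _ _)); rewrite mn1N.
  have t1 := mn1D (P i) (e *: Hk); rewrite mn1Z (ger0_norm ep) in t1.
  have t2 : e * mn1 Hk <= hb by rewrite -[leRHS]mul1r ler_pM ?mn1_ge0.
  rewrite /qb -/d1; lra.
have dual i : forall v, `|e * quad Hk v| <= quad (P i) v / 2.
  move=> v; rewrite normrM (ger0_norm ep).
  apply: (@le_trans _ _ (e0 * (hb * sqnorm v))).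
    apply: ler_pM => //; apply: (le_trans (quad_le_mn1 _ _)).
    by rewrite ler_wpM2r// sqnorm_ge0.
  rewrite mulrA; apply: (@le_trans _ _ (p i / 2 * sqnorm v)).
    by rewrite ler_wpM2r// sqnorm_ge0.
  by have := pq i v; lra.
have lower i : sqnorm ((mu i).1 - (nu k).1)
    + \tr ((1%:M - dual_mx (P i) Hk e) *m (mu i).2)
    + \tr ((1%:M - (P i + e *: Hk)) *m (nu k).2) - C / k <= acost k i (nu k).
  rewrite -lee_fin -(acostE i kp pk).1.
  have si := sum_ge i; have l1 := l00 i; have i1 := tb0 i; have i2 := qb0 i.
  apply: H => //.
  - by apply: (le_trans (dN i)); rewrite /B; lra.
  - apply: (le_trans (mn1_sqnorm _)); apply: (@le_trans _ _ db); last by rewrite /B; lra.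
    rewrite /db ler_wpM2l//; apply: (le_trans (sqrt_le1D (sqnorm_ge0 _))).
    by rewrite lerD2l.
  - by rewrite -/(l0 i) /B; lra.
  - by apply: (le_trans Lb); rewrite /B; lra.
  - by apply: (le_trans (Tb i)); rewrite /B; lra.
  - by apply: (le_trans (Qb i)); rewrite /B; lra.
  - exact: dual_mx_le.
have := perturbed_dual_value (nu k) Hk e; rewrite -/V -/Hk => pv.
have : \sum_i w i * (sqnorm ((mu i).1 - (nu k).1)
    + \tr ((1%:M - dual_mx (P i) Hk e) *m (mu i).2)
    + \tr ((1%:M - (P i + e *: Hk)) *m (nu k).2)) - C / k <= asum k.
  have -> : C / k = \sum_i w i * (C / k) by rewrite -mulr_suml sum_lamt mul1r.
  rewrite -sumrB; apply: ler_sum => i _.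
  have wl := ler_wpM2l (ltW (lamt_gt0 i)) (lower i).
  by apply: le_trans wl; rewrite [leRHS]mulrBr.
rewrite pv; apply: le_trans.
have : 2 * e ^+ 2 * \sum_i w i * \tr (Hk *m invmx (P i) *m Hk *m S0) <= C1 * e ^+ 2.
  rewrite mulrAC /C1 ler_wpM2r ?sqr_ge0// ler_pM2l//; apply: ler_sum => i _.
  rewrite ler_pM2l ?lamt_gt0//; apply: (le_trans (ler_norm _)).
  apply: (le_trans (mn1_trace _)); apply: (le_trans (mn1M _ _)).
  rewrite ler_wpM2r ?mn1_ge0//; apply: (le_trans (mn1M _ _)).
  rewrite ler_pM ?mn1_ge0//; apply: (le_trans (mn1M _ _)).
  by rewrite ler_wpM2r ?mn1_ge0.
lra.
Qed.

(** The unperturbed potentials, [e = 0], already control the mean. *)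
Lemma ev_mean (eta : R) : 0 < eta -> ev (fun k => sqnorm (m0 - (nu k).1) <= eta).
Proof.
move=> eta0; have [C C0 evC] := asum_le.
have [C1 [C2 [e0 [C10 C20 e00 evL]]]] := asum_ge.
apply: ev_imp (evI evC (evI evL (ev_div_le (C + C2) eta0))) => k k0 [hC [hL he]].
have := hL 0 (lexx _) (ltW e00); rewrite expr0n /= mulr0 mul0r.
rewrite mulrDl in he; lra.
Qed.

Lemma ev_cov (eta : R) : 0 < eta ->
  ev (fun k => \tr ((S0 - (nu k).2) *m (S0 - (nu k).2)) <= eta).
Proof.
move=> eta0; have [C C0 evC] := asum_le.
have [C1 [C2 [e0 [C10 C20 e00 evL]]]] := asum_ge.
(* [e] is fixed before [k]. After division by [e], the loss [C1 * e] takes one half of [eta], and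
   [(C + C2) / k / e] takes the other half once [k] is large. *)
pose e := Num.min e0 (eta / (2 * (C1 + 1))).
have C11 : 0 < 2 * (C1 + 1) by lra.
have ep : 0 < e by rewrite lt_min e00 divr_gt0.
have ee : e <= e0 by rewrite ge_min lexx.
have eC : C1 * e <= eta / 2.
  have : e <= eta / (2 * (C1 + 1)) by rewrite ge_min lexx orbT.
  rewrite ler_pdivlMr//; nra.
apply: ev_imp (evI evC (evI evL (ev_div_le (C + C2) (mulr_gt0 ep (divr_gt0 eta0 (ltr0Sn R 1))))))
  => k k0 [hC [hL he]].
have := hL e (ltW ep) ee; set T := \tr _ => hT.
have s0 := sqnorm_ge0 (m0 - (nu k).1).
rewrite mulrDl in he; rewrite -(ler_pM2l ep).
have : C1 * e ^+ 2 <= e * (eta / 2) by rewrite expr2 mulrA [e * _]mulrC ler_pM2r.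
lra.
Qed.

Lemma ev_Phit (eta : R) : 0 < eta -> ev (fun k =>
  Z0 `^ th^-1 * V - eta <= Phit tau0 tau1 lambda a mu k (nu k)).
Proof.
move=> eta0; have [D D0 evD] := ykp_le; have V0 := V_ge0.
have [C1 [C2 [e0 [C10 C20 e00 evL]]]] := asum_ge.
pose z := Z0 `^ th^-1; have z0 : 0 < z by rewrite powR_gt0 ?Z0_gt0.
(* [F / k] gathers the errors of the dual bound and of [ykp_le], and the Taylor remainder of
   [exp (- t)], whose factor [expR 1] comes from [|t| <= 1]. *)
pose C := C2 + D; pose M := V + C; pose F := C + M ^+ 2 / tau0 * expR 1.
have C00 : 0 <= C by rewrite addr_ge0.
have M0 : 0 <= M by rewrite addr_ge0.
apply: ev_imp (evI (evI evD evL) (evI (evI (ev_ge (M / tau0)) (ev_ge 1))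
  (ev_div_le F (divr_gt0 eta0 z0)))) => k k0 [[hD hL] [[hM h1] hF]].
have kt : 0 < k * tau0 by rewrite mulr_gt0.
rewrite PhitE//; last exact: pnu.
pose t := (V - C / k) / (k * tau0).
have le_asum : V - C2 / k <= asum k.
  have := hL 0 (lexx _) (ltW e00); rewrite expr0n /= mulr0 mul0r.
  have := sqnorm_ge0 (m0 - (nu k).1); lra.
have yt : yk k (nu k) `^ th^-1 <= expR (- t).
  apply: (le_trans hD); rewrite ler_expR lerN2 ler_pM2r ?invr_gt0//.
  by rewrite /C mulrDl; lra.
have Ck : C / k <= C by rewrite ler_pdivrMr// ler_peMr.
have Ck0 : 0 <= C / k by rewrite divr_ge0// ltW.
have tM : `|t| <= M / (k * tau0).
  rewrite normrM [`|_^-1|]gtr0_norm ?invr_gt0// ler_pM2r ?invr_gt0//.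
  by rewrite ler_norml /M; apply/andP; split; lra.
have t1 : `|- t| <= 1.
  rewrite normrN; apply: (le_trans tM); rewrite ler_pdivrMr// mul1r.
  by rewrite -ler_pdivrMr.
have et : expR (- t) <= 1 - t + (M / (k * tau0)) ^+ 2 * expR 1.
  apply: (le_trans (expR_le_quadratic _)); rewrite lerD2l sqrrN.
  apply: ler_pM; rewrite ?sqr_ge0 ?expR_ge0 ?ler_expR//.
  by rewrite -real_normK ?num_real// lerXn2r ?nnegrE// divr_ge0// ltW.
have : k * tau0 * (t - (M / (k * tau0)) ^+ 2 * expR 1) <=
    k * tau0 * (1 - yk k (nu k) `^ th^-1) by rewrite ler_pM2l//; lra.
have -> : k * tau0 * (t - (M / (k * tau0)) ^+ 2 * expR 1) = V - F / k.
  by rewrite /t /F; field; rewrite !gt_eqF.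
move=> h; have h2 : z * (V - F / k) <= z * (k * tau0 * (1 - yk k (nu k) `^ th^-1)).
  by rewrite ler_pM2l.
apply: le_trans h2; rewrite mulrBr lerD2l lerN2 mulrC -ler_pdivlMr//.
Qed.

(** Squares fit the available bounds: [sqnorm] and the trace of [H *m H] dominate squared
    entries. *)
Lemma ev_cvg (f : R -> R) (l : R) :
  (forall eta, 0 < eta -> ev (fun k => (l - f k) ^+ 2 <= eta)) ->
  f k @[k --> +oo] --> l.
Proof.
move=> h; apply/cvgrPdist_le => e e0.
have [K K0 hK] := h (e ^+ 2) (exprn_gt0 _ e0).
near=> k; rewrite -ler_sqr ?nnegrE ?(ltW e0)// real_normK ?num_real//.
by apply: hK; near: k; apply: nbhs_pinfty_ge; exact: num_real.
Unshelve. all: by end_near. Qed.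

Lemma cvg_mx p q (f : R -> 'M[R]_(p, q)) (M : 'M[R]_(p, q)) :
  (forall i j, f k i j @[k --> +oo] --> M i j) -> f k @[k --> +oo] --> M.
Proof.
move=> h A [Q hQ QA].
have : \forall k \near +oo, forall i j, Q i j (f k i j).
  apply: filter_forall => i; apply: filter_forall => j.
  exact: (h i j _ (hQ i j)).
by apply: filterS => k hk; apply: QA => i j; exact: hk.
Qed.

Lemma nu_cvg : nu k @[k --> +oo] --> nuBW.
Proof.
have c1 : (nu k).1 @[k --> +oo] --> m0.
  apply: cvg_mx => i j; apply: ev_cvg => eta eta0.
  apply: ev_imp (ev_mean eta0) => k k0; apply: le_trans.
  by rewrite [j]ord1; have := coord_le_sqnorm (m0 - (nu k).1) i; rewrite !mxE.
have c2 : (nu k).2 @[k --> +oo] --> S0.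
  apply: cvg_mx => i j; apply: ev_cvg => eta eta0.
  apply: ev_imp (ev_cov eta0) => k k0; apply: le_trans.
  have := @trace_sqr_ge (S0 - (nu k).2) i j; rewrite !mxE; apply.
  by rewrite linearB/= pS0.1 (pnu k0).1.
have c := cvg_pair c1 c2; rewrite [nuBW]surjective_pairing.
have -> : nu = fun k => ((nu k).1, (nu k).2) by apply/funext => k; exact: surjective_pairing.
exact: c.
Qed.

(** A squeeze: [bk] is [z * y] with [1 - V / (k * tau0) <= y <= 1], from optimality below and
    nonnegative costs above. *)
Lemma bk_cvg : bk tau0 tau1 lambda a mu k (nu k) @[k --> +oo] --> Z0 `^ th^-1.
Proof.
pose z := Z0 `^ th^-1; have z0 : 0 < z by rewrite powR_gt0 ?Z0_gt0.
have V0 := V_ge0.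
apply: ev_cvg => eta eta0.
pose e := Num.sqrt eta; have e0 : 0 < e by rewrite sqrtr_gt0.
apply: ev_imp (ev_div_le (z * V / tau0) e0) => k k0 he.
rewrite bkE//; last exact: pnu.
have yl := ykp_ge k0.
have yu : yk k (nu k) `^ th^-1 <= 1.
  have -> : 1 = 1 `^ th^-1 :> R by rewrite powR1.
  apply: ge0_ler_powR; rewrite ?nnegrE ?yk_ge0//.
    by rewrite invr_ge0 ltW// theta_gt0.
  by rewrite yk_le1//; exact: pnu.
rewrite -/z; move: (yk k (nu k) `^ th^-1) yl yu => y yl yu.
have h1 : 0 <= z - z * y by rewrite subr_ge0 ler_piMr// ltW.
have h2 : z - z * y <= e.
  apply: le_trans he; have -> : z * V / tau0 / k = z * (V / (k * tau0)).
    by field; rewrite !gt_eqF.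
  have -> : z - z * y = z * (1 - y) by ring.
  by rewrite ler_pM2l//; lra.
have -> : eta = e ^+ 2 by rewrite sqr_sqrtr// ltW.
by rewrite lerXn2r ?nnegrE// ltW.
Qed.

Lemma min_cvg :
  ereal_inf [set (Phit tau0 tau1 lambda a mu k x)%:E | x in gaussians R d]
    @[k --> +oo] --> Phi_inf tau0 tau1 lambda a mu nuBW.
Proof.
rewrite /Phi_inf bary_obj_bw -EFinM -/V.
have infE k : 0 < k ->
    ereal_inf [set (Phit tau0 tau1 lambda a mu k x)%:E | x in gaussians R d] =
    (Phit tau0 tau1 lambda a mu k (nu k))%:E.
  move=> k0; apply/eqP; rewrite eq_le; apply/andP; split.
    by apply: ge_ereal_inf; eexists; [exists (nu k) => //; exact: pnu|].
  apply: le_ereal_inf_tmp => _ [x px <-]; rewrite lee_fin.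
  exact: Phit_min_le.
have cv : Phit tau0 tau1 lambda a mu k (nu k) @[k --> +oo] --> Z0 `^ th^-1 * V.
  apply: ev_cvg => eta eta0.
  pose e := Num.sqrt eta; have e0 : 0 < e by rewrite sqrtr_gt0.
  apply: ev_imp (ev_Phit e0) => k k0 h.
  have h' := le_trans (Phit_min_le k0 pS0) (Phit_bw_le k0).
  have -> : eta = e ^+ 2 by rewrite sqr_sqrtr// ltW.
  by rewrite lerXn2r ?nnegrE ?(ltW e0)//; lra.
apply: (@cvg_trans _ ((Phit tau0 tau1 lambda a mu k (nu k))%:E @[k --> +oo])).
  apply: near_eq_cvg; near=> k; apply/esym/infE.
  by near: k; apply: nbhs_pinfty_gt; exact: num_real.
by apply: cvg_EFin => //; near=> k.
Unshelve. all: by end_near. Qed.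

End Barycenter.

Unset Implicit Arguments.

Theorem theorem6p5 (R : realType) (d n : nat) (tau0 tau1 : R)
    (lambda a : 'I_n -> R) (mu : 'I_n -> 'cV[R]_d * 'M[R]_d)
    (nuBW : 'cV[R]_d * 'M[R]_d) (nu : R -> 'cV[R]_d * 'M[R]_d)
    (hd : (0 < d)%N) (hn : (0 < n)%N)
    (htau0 : 0 < tau0) (htau1 : 0 < tau1)
    (hlambda : forall i, 0 < lambda i) (hlambda1 : \sum_(i < n) lambda i = 1)
    (ha : forall i, 0 < a i) (hmu : forall i, gaussians R d (mu i))
    (hBW : argmin (gaussians R d) (bary_obj tau0 tau1 lambda a mu)
             = [set nuBW])
    (hnu : forall k : R, 0 < k ->
       argmin (gaussians R d) (Phik tau0 tau1 lambda a mu k) (nu k)) :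
  [/\ nu k @[k --> +oo] --> nuBW,
      bk tau0 tau1 lambda a mu k (nu k) @[k --> +oo]
        --> Z0 tau0 tau1 lambda a `^ (theta tau0 tau1)^-1 &
      ereal_inf [set (Phit tau0 tau1 lambda a mu k x)%:E | x in gaussians R d]
        @[k --> +oo] --> Phi_inf tau0 tau1 lambda a mu nuBW].
Proof.
have BW : argmin (gaussians R d) (bary_obj tau0 tau1 lambda a mu) nuBW.
  by rewrite hBW.
have [P hP] := optimal_maps hmu BW.
have pP i := (hP i).1; have PSP i := (hP i).2.
split.
- exact: (nu_cvg hn htau0 htau1 hlambda ha hmu BW pP PSP hnu).
- exact: (bk_cvg hn htau0 htau1 hlambda ha hmu BW pP PSP hnu).
- exact: (min_cvg hn htau0 htau1 hlambda ha hmu BW pP PSP hnu).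
Qed.
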